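(* Fix a finite field $\mathbb{F}_q$. For every integer $k\ge1$, there is a deterministic $n^{O(k)}$-time reduction from a Boolean QuadEq instance with $n$ variables over $\mathbb{F}_q$ to a linear subspace $\mathcal{L}\subseteq\mathbb{F}_q^{N\times N}$ with $N=n^{O(k)}$, such that: (YES) if the Boolean QuadEq instance is satisfiable, then $\mathcal{L}$ contains a nonzero matrix of rank $1$; (NO) if the Boolean QuadEq instance is unsatisfiable, then $\mathcal{L}$ contains no nonzero matrix of rank at most $k$.
   Context: A Boolean QuadEq instance over $\mathbb{F}_q$ consists of squarefree polynomials $f_1,\dots,f_m$ of degree at most $2$ over $\mathbb{F}_q$ in variables $x_1,\dots,x_n$; it is satisfiable if there is $a\in\{0,1\}^n\subseteq\mathbb{F}_q^n$ with $f_1(a)=\dots=f_m(a)=0$. *)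

(* Defs.v *)
From HB Require Import structures.
From mathcomp Require Import all_boot all_order all_algebra.
From mathcomp Require Import mpoly.
Set Implicit Arguments. Unset Strict Implicit. Unset Printing Implicit Defensive.
Import Order.TTheory GRing.Theory Num.Theory.
Local Open Scope ring_scope.

Definition sqfree_deg2 (F : fieldType) (n : nat) (p : {mpoly F[n]}) : bool :=
  all (fun m : 'X_{1..n} => [forall i, (m i <= 1)%N] && (mdeg m <= 2)%N) (msupp p).

Definition bool_sat (F : fieldType) (n : nat) (fs : seq {mpoly F[n]}) : Prop :=
  exists a : 'I_n -> bool, forall f, f \in fs -> f.@[fun i => (a i)%:R] = 0.

Inductive sym := Blank | S0 | S1 | Sep.
Inductive tmove := MoveL | MoveR | Stay.

(* finitely many states 'I_(ns.+1); start state ord0; halts when delta = None *)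
Record TM := {
  tm_ns : nat;
  tm_delta : 'I_tm_ns.+1 -> sym -> option ('I_tm_ns.+1 * sym * tmove) }.

(* tape: reversed left part, symbol under head, right part *)
Record tape := Tape { t_left : seq sym; t_head : sym; t_right : seq sym }.

Definition tape_write (s : sym) (t : tape) := Tape (t_left t) s (t_right t).

Definition tape_move (m : tmove) (t : tape) : tape :=
  match m with
  | Stay => t
  | MoveL => match t_left t with
             | [::] => Tape [::] Blank (t_head t :: t_right t)
             | x :: l => Tape l x (t_head t :: t_right t)
             end
  | MoveR => match t_right t with
             | [::] => Tape (t_head t :: t_left t) Blank [::]
             | x :: r => Tape (t_head t :: t_left t) x r
             end
  end.

Definition tm_step (M : TM) (c : 'I_(tm_ns M).+1 * tape)
  : option ('I_(tm_ns M).+1 * tape) :=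
  match tm_delta c.1 (t_head c.2) with
  | None => None
  | Some (q, s, m) => Some (q, tape_move m (tape_write s c.2))
  end.

Fixpoint tm_exec (M : TM) (T : nat) (c : 'I_(tm_ns M).+1 * tape) : option tape :=
  match tm_step c with
  | None => Some c.2
  | Some c' => if T is T'.+1 then tm_exec T' c' else None
  end.

Definition init_tape (w : seq sym) : tape :=
  match w with [::] => Tape [::] Blank [::] | x :: r => Tape [::] x r end.

Fixpoint take_nonblank (s : seq sym) : seq sym :=
  match s with
  | [::] => [::]
  | Blank :: _ => [::]
  | x :: r => x :: take_nonblank r
  end.

Definition tm_output (t : tape) : seq sym := take_nonblank (t_head t :: t_right t).

Definition tm_computes_within (M : TM) (w : seq sym) (T : nat) (out : seq sym) :=
  exists t, @tm_exec M T (ord0, init_tape w) = Some t /\ tm_output t = out.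

Definition enc_nat (k : nat) : seq sym := rcons (nseq k S1) Sep.

Definition enc_elt (F : finFieldType) (x : F) : seq sym :=
  enc_nat (enum_rank x).

Definition sqfree_monomials (n : nat) : seq 'X_{1..n} :=
  0%MM :: [seq mnm1 i | i <- enum 'I_n]
       ++ [seq (mnm1 ij.1 + mnm1 ij.2)%MM
          | ij : 'I_n * 'I_n <- [seq (i, j) | i <- enum 'I_n, j <- enum 'I_n] & (val ij.1 < val ij.2)%N].

Definition enc_poly (F : finFieldType) (n : nat) (p : {mpoly F[n]}) : seq sym :=
  rcons (flatten [seq enc_elt (p@_m) | m <- sqfree_monomials n]) S0.

Definition enc_instance (F : finFieldType) (n : nat) (fs : seq {mpoly F[n]})
  : seq sym := enc_nat n ++ flatten [seq enc_poly p | p <- fs].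

Definition enc_matrix (F : finFieldType) (N : nat) (A : 'M[F]_N) : seq sym :=
  rcons (flatten [seq enc_elt (A i j) | i <- enum 'I_N, j <- enum 'I_N]) S0.

Definition enc_subspace (F : finFieldType) (N : nat) (gens : seq 'M[F]_N)
  : seq sym := enc_nat N ++ flatten [seq enc_matrix A | A <- gens].

(* Main.v *)
(** Homogenise with a coordinate [x_0] standing for [1] and let [d = k]. The subspace
    consists of the tensors [z] of order [2(d+1)] over [F^(n+1)] such that every pair of
    adjacent indices is annihilated by the quadratic forms [x_i x_j - x_j x_i],
    [x_i^2 - x_i x_0] and the homogenised [f]; they are flattened into matrices of size
    [(n+1)^(d+1)]. The tensor power of a satisfying point flattens to a matrix of rank
    one. Conversely, such a [z] is a symmetric function on words, the moments of a
    pseudo-distribution on [{0,1}^n], and a nonzero [z] of rank at most [k] yields a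
    satisfying point by induction on [k]. If neither conditioning on [x_i = 0] nor on
    [x_i = 1] kills [z], the ranks of the two conditioned functions add up to at most
    that of [z]. Otherwise each [x_i] acts on words with a letter [0] as a scalar [a_i] in
    [{0,1}], and [a] is a satisfying point unless [z] is zero on all words with a letter
    [0] or a repeated letter; in that case the blocks [z(i,j,-)] and [z(j,i,-)] are
    orthogonal, so the rank drops again.

    The generators are found by adding one tensor factor at a time and imposing the new
    constraints by an elimination that never discards a vector. The number of loop
    iterations is bounded by a fuel [B] polynomial in the input and in [(n+1)^k], and
    the running time by a polynomial in [B] whose degree does not depend on [k]. *)

(* The constant [C] is chosen before [k], so [k] may enter the machine only as data: it fixes how
   many marks are pushed on two loop counters, and all compiled loops are the same for every [k].
   The field is fixed and finite, so its arithmetic is done at compile time, inside the finite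
   control.

   Keeping the vectors that elimination turns into zero makes the number of generators of tensors of
   order e equal to (n+1)^e for every instance. The machine therefore obtains the matrix size
   (n+1)^(d+1) by counting generators halfway through the computation, without any integer
   arithmetic.

   In the rank argument the two conditionings give orthogonal blocks because x_i (1 - x_i) = 0.
   Fixing two letters lowers [d] by one and the rank by at least one, which is why d = k is enough.

   Without variables the bounds on size and time have no dependence on [k] left, so that case uses d
   = 0 and is settled by the single matrix entry. *)
Require Import Defs.
From HB Require Import structures.
From mathcomp Require Import all_boot all_order all_algebra.
From mathcomp Require Import mpoly.
From mathcomp Require Import zify ring.
Set Implicit Arguments. Unset Strict Implicit. Unset Printing Implicit Defensive.
Import GRing.Theory.

(** * Turing machines acting on lists of cells *)

Notation letter := (option bool).
Notation cell := (option letter).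

Definition sym_of (c : cell) : sym :=
  match c with
  | None => Blank
  | Some None => Sep
  | Some (Some true) => S1
  | Some (Some false) => S0
  end.

Definition cell_of (s : sym) : cell :=
  match s with
  | Blank => None
  | Sep => Some None
  | S1 => Some (Some true)
  | S0 => Some (Some false)
  end.

Lemma sym_ofK : cancel sym_of cell_of. Proof. by case=> [[[]|]|]. Qed.

Section Machine.
Variables (S : Type) (d : S -> cell -> option (S * cell * tmove)).

Definition cfg := (S * seq cell * seq cell)%type.

(* A configuration is (state, reversed tape to the left, tape from the head on),
   with [None] for blank and both lists understood up to trailing blanks. *)
Definition mstep (c : cfg) : option cfg :=
  let: (s, l, u) := c in
  match d s (head None u) with
  | None => None
  | Some (s', y, m) => Some match m with
     | MoveR => (s', y :: l, behead u)
     | MoveL => (s', behead l, head None l :: y :: behead u)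
     | Stay => (s', l, y :: behead u)
     end
  end.

Fixpoint mrun n (c : cfg) : option cfg :=
  if n is n'.+1 then obind (mrun n') (mstep c) else Some c.

Lemma mrunD m n c : mrun (m + n) c = obind (mrun n) (mrun m c).
Proof. by elim: m c => //= m IH c; case: (mstep c) => //= c'; rewrite IH. Qed.

Definition reaches (b : nat) (c c' : cfg) := exists2 n, (n <= b) & mrun n c = Some c'.

Lemma reaches_refl c : reaches 0 c c. Proof. by exists 0. Qed.

Lemma reaches_trans b1 b2 c1 c2 c3 :
  reaches b1 c1 c2 -> reaches b2 c2 c3 -> reaches (b1 + b2) c1 c3.
Proof.
move=> [m lem rm] [n len rn]; exists (m + n); first exact: leq_add.
by rewrite mrunD rm.
Qed.

Lemma reaches_step c1 c2 : mstep c1 = Some c2 -> reaches 1 c1 c2.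
Proof. by move=> E; exists 1 => //=; rewrite E. Qed.

Lemma reachesW b b' c c' : (b <= b') -> reaches b c c' -> reaches b' c c'.
Proof. by move=> le [n len r]; exists n => //; exact: leq_trans le. Qed.

Section Realize.
Variables (Q : finType) (q0 : Q) (dec : Q -> S) (inj : S -> Q) (ok : pred S).
(** [S] may be infinite; [ok] is an invariant of the run under which coding a state into the finite
    type [Q] loses nothing. *)
Hypothesis decK : forall s, ok s -> dec (inj s) = s.
Hypothesis okd : forall s x s' y m, ok s -> d s x = Some (s', y, m) -> ok s'.

(** A [TM] starts in [ord0], whereas [q0] may have any rank in [Q]. The state type therefore gets
    one extra point that decodes to [q0], and the proper states are lifted past it. *)
Definition tm_state (q : 'I_#|Q|.+1) : S :=
  dec (if unlift ord0 q is Some i then enum_val i else q0).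

Definition tm_of : TM :=
  {| tm_ns := #|Q|;
     tm_delta := fun q a =>
       match d (tm_state q) (cell_of a) with
       | None => None
       | Some (s, y, m) => Some (lift ord0 (enum_rank (inj s)), sym_of y, m)
       end |}.

Definition rep (t : tape) (l u : seq cell) :=
  (forall i, nth Blank (t_left t) i = sym_of (nth None l i)) /\
  (forall i, nth Blank (t_head t :: t_right t) i = sym_of (nth None u i)).

Lemma rep_move t l u y m : rep t l u ->
  match m with
  | MoveR => rep (tape_move m (tape_write (sym_of y) t)) (y :: l) (behead u)
  | MoveL => rep (tape_move m (tape_write (sym_of y) t)) (behead l) (head None l :: y :: behead u)
  | Stay => rep (tape_move m (tape_write (sym_of y) t)) l (y :: behead u)
  end.
Proof.
case: t => tl th tr [/= Hl Hr].
have Hb i : nth Blank tr i = sym_of (nth None (behead u) i).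
  by rewrite nth_behead -(Hr i.+1).
case: m => /=.
- case: tl Hl => [|x tl] Hl; split=> /=.
  + by move=> i; rewrite nth_behead -(Hl i.+1) nth_nil.
  + by case=> [|[|i]] //=; move: (Hl 0); rewrite nth0.
  + by move=> i; rewrite nth_behead -(Hl i.+1).
  + by case=> [|[|i]] //=; move: (Hl 0); rewrite nth0.
- case: tr Hr Hb => [|x tr] Hr Hb; split=> /=.
  + by case.
  + by case=> [|i]; rewrite -Hb /= ?nth_nil.
  + by case.
  + by case=> [|i]; rewrite -Hb.
- by split=> //= -[|i] /=.
Qed.

Lemma tm_stateK s : ok s -> tm_state (lift ord0 (enum_rank (inj s))) = s.
Proof. by move=> oks; rewrite /tm_state liftK enum_rankK decK. Qed.

Lemma tm_of_exec n s l u s' l' u' q t T :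
    ok s -> tm_state q = s -> rep t l u ->
    mrun n (s, l, u) = Some (s', l', u') -> d s' (head None u') = None ->
    (n <= T) ->
  exists2 t', @tm_exec tm_of T (q, t) = Some t' & rep t' l' u'.
Proof.
elim: n s l u q t T => [|n IH] s l u q t T oks Eq rt /=.
  case=> <- <- <- dN _; exists t => //.
  have dN' : d (tm_state q) (cell_of (t_head t)) = None.
    by rewrite Eq -dN; case: rt => _ /(_ 0) /= ->; rewrite sym_ofK nth0; congr d.
  by case: T => [|T] /=; rewrite /tm_step /= dN'.
have hd : cell_of (t_head t) = head None u.
  by case: rt => _ /(_ 0) /= ->; rewrite sym_ofK nth0.
case E : (d s (head None u)) => [[[s1 y] m]|] //= run_n dN; case: T => // T leT.
rewrite /= /tm_step /= Eq hd E.
have oks1 := okd oks E.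
have := @rep_move _ _ _ y m rt.
by case: m E run_n => E run_n rt'; apply: (IH _ _ _ _ _ _ oks1 _ rt' run_n) => //;
  exact: tm_stateK.
Qed.

End Realize.
End Machine.

(** * A register machine and its simulation *)

Inductive instr :=
  | IPush of nat & letter
  | IPop of nat & nat & (letter -> nat)
  | IJmp of nat.

Notation regs := (seq (seq letter)).

Definition astep (code : seq instr) (c : nat * regs) : option (nat * regs) :=
  let: (pc, st) := c in
  if onth code pc is Some i then
    Some match i with
    | IPush r a => (pc.+1, set_nth [::] st r (a :: nth [::] st r))
    | IPop r e j =>
        if nth [::] st r is a :: w then (j a, set_nth [::] st r w) else (e, st)
    | IJmp l => (l, st)
    end
  else None.

Fixpoint arun code n (c : nat * regs) : option (nat * regs) :=
  if n is n'.+1 then obind (arun code n') (astep code c) else Some c.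

Lemma arunD code m n c : arun code (m + n) c = obind (arun code n) (arun code m c).
Proof. by elim: m c => //= m IH c; case: (astep code c) => //= c'; rewrite IH. Qed.

Definition wf_instr R L (i : instr) :=
  match i with
  | IPush r _ => (r < R)
  | IPop r e j => [&& r < R, e <= L & [forall a, j a <= L]]%N
  | IJmp l => (l <= L)
  end.

Definition wf_code R code := all (wf_instr R (size code)) code.

Section Simulation.
Variables (R : nat) (code : seq instr).
Hypotheses (R_gt0 : (0 < R)) (wfc : wf_code R code).

(* Registers are stored on the tape one after the other, each followed by a blank. *)
Definition layout (st : regs) : seq cell :=
  flatten [seq rcons (map Some c) None | c <- st].
Arguments layout : simpl never.

(* [j] counts the blanks still to be crossed; in phases [PCarry] and [PHome] the program counter
   is already that of the next instruction. *)
Inductive phase := PFetch | PRight | PCarry | PDel | PHome.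

Definition mstate := (nat * phase * cell * nat)%type.

(** A push shifts everything from its register on one cell to the right, carrying the displaced cell
    in the state. A pop makes two passes: with [c = None] it tests whether the register is empty;
    with [c = Some None] it runs to the end of the tape, from where [PDel] shifts everything back to
    the left, so that the letter still carried on arrival is the popped one. *)
Definition mdelta (s : mstate) (x : cell) : option (mstate * cell * tmove) :=
  let: (pc, ph, c, j) := s in
  match ph with
  | PFetch =>
      match onth code pc with
      | None => None
      | Some (IPush r _) | Some (IPop r _ _) => Some ((pc, PRight, None, r), x, Stay)
      | Some (IJmp l) => Some ((l, PFetch, None, 0), x, Stay)
      end
  | PRight =>
      if j is j'.+1 then
        Some ((pc, PRight, c, if x is None then j' else j), x, MoveR)
      else
        match onth code pc with
        | Some (IPush r a) => Some ((pc.+1, PCarry, Some a, R - r), x, Stay)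
        | Some (IPop r e _) =>
            if c is None then
              if x is None then Some ((e, PHome, None, r.+2), x, Stay)
              else Some ((pc, PRight, Some None, R - r), x, Stay)
            else Some ((pc, PDel, None, R - r), x, MoveL)
        | _ => None
        end
  | PCarry =>
      if x is None then
        if j is j'.+2 then Some ((pc, PCarry, None, j'.+1), c, MoveR)
        else Some ((pc, PHome, None, R.+1), c, MoveR)
      else Some ((pc, PCarry, x, j), c, MoveR)
  | PDel =>
      if x is None then
        if j is j'.+1 then Some ((pc, PDel, None, j'), c, MoveL)
        else match onth code pc, c with
             | Some (IPop r _ jmp), Some a => Some ((jmp a, PHome, None, r.+1), x, Stay)
             | _, _ => None
             end
      else Some ((pc, PDel, x, j), c, MoveL)
  | PHome =>
      if x is None then
        if j is j'.+2 then Some ((pc, PHome, c, j'.+1), x, MoveL)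
        else Some ((pc, PFetch, None, 0), x, MoveR)
      else Some ((pc, PHome, c, j), x, MoveL)
  end.

Definition ok_state (s : mstate) : bool :=
  let: (pc, _, _, j) := s in (pc <= size code) && (j <= R.+2).

Lemma onth_wf pc i : onth code pc = Some i -> (pc < size code) /\ wf_instr R (size code) i.
Proof.
move=> E; have lt : (pc < size code) by rewrite -onthTE E.
by split=> //; have /(all_nthP (IJmp 0))/(_ _ lt) := wfc; rewrite (@onth_nth _ (IJmp 0) _ _ _ E).
Qed.

Lemma mdelta_ok s x s' y m : ok_state s -> mdelta s x = Some (s', y, m) -> ok_state s'.
Proof.
case: s => [[[pc ph] c] j] /= /andP[lepc lej].
have le0 : (R - 0 <= R) by rewrite subn0.
case: ph => /=.
- case E : (onth code pc) => [[r a|r e f|l]|] // [<- _ _] /=; have [_ /=] := onth_wf E.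
  + by move=> lt; rewrite lepc /=; lia.
  + by case/and3P=> lt _ _; rewrite lepc /=; lia.
  + by move=> ->.
- case: j lej => [|j] lej; last by case: x => [?|] [<- _ _] /=; rewrite lepc //=; lia.
  case E : (onth code pc) => [[r a|r e f|l]|] //; have [lt /=] := onth_wf E.
    by move=> _ [<- _ _] /=; rewrite lt /=; lia.
  case/and3P=> ltr lee _; case: c => [?|] ; first by case=> <- _ _ /=; rewrite lepc /=; lia.
  by case: x => [?|] [<- _ _] /=; rewrite ?lepc ?lee //=; lia.
- case: x => [?|]; first by case=> <- _ _ /=; rewrite lepc.
  by case: j lej => [|[|j]] lej [<- _ _] /=; lia.
- case: x => [?|]; first by case=> <- _ _ /=; rewrite lepc.
  case: j lej => [|j] lej; last by case=> <- _ _ /=; rewrite lepc /=; lia.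
  case E : (onth code pc) => [[r a|r e f|l]|] //; have [_ /=] := onth_wf E.
  case: c => [a|] // /and3P[ltr _ /forallP/(_ a) le] [<- _ _] /=; rewrite le /=; lia.
- case: x => [?|]; first by case=> <- _ _ /=; rewrite lepc.
  by case: j lej => [|[|j]] lej [<- _ _] /=; lia.
Qed.

Local Notation reach := (reaches mdelta).
Local Notation blanks a := (nseq a (@None letter)).
Local Notation cnt := (count_mem (@None letter)).

Lemma step_reach b s x l u s' y m c' :
    mdelta s x = Some (s', y, m) ->
    reach b (match m with
      | MoveR => (s', y :: l, u)
      | MoveL => (s', behead l, head None l :: y :: u)
      | Stay => (s', l, y :: u) end) c' ->
  reach b.+1 (s, l, x :: u) c'.
Proof.
move=> E [n len r]; exists n.+1 => //=; rewrite E /=.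
by case: m r {E}.
Qed.

(* The head sits on the last cell of [V], whose cells lie just right of [l]. *)
Definition at_end (s : mstate) (V l u : seq cell) : cfg mstate :=
  (s, behead (rev V ++ l), head None (rev V ++ l) :: u).

Lemma reach_home pc c V l u j :
  reach (size V) (at_end (pc, PHome, c, cnt V + j.+1) V l u)
                 (at_end (pc, PHome, c, j.+1) [::] l (V ++ u)).
Proof.
elim/last_ind: V u => [|V x IH] u; first exact: reaches_refl.
rewrite /at_end rev_rcons size_rcons /= cat_rcons -cats1 count_cat /= addn0.
case: x => [x|]; first by rewrite addn0; apply: step_reach => //=; exact: IH.
have -> : (cnt V + 1 + j.+1 = (cnt V + j).+2) by lia.
by apply: step_reach => //=; rewrite -addnS; exact: IH.
Qed.

Lemma reach_del pc c V l u j :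
  reach (size V) (at_end (pc, PDel, c, cnt V + j) V l u)
                 (at_end (pc, PDel, head c V, j) [::] l (behead (rcons V c) ++ u)).
Proof.
elim/last_ind: V u c => [|V x IH] u c; first exact: reaches_refl.
rewrite /at_end rev_rcons size_rcons /= -cats1 count_cat /= addn0.
have -> : behead (rcons (V ++ [:: x]) c) ++ u = behead (rcons V x) ++ c :: u.
  by case: V {IH} => //= y V; rewrite !cats1 cat_rcons.
have -> : head c (V ++ [:: x]) = head x V by case: V {IH}.
case: x => [x|]; first by rewrite addn0; apply: step_reach => //=; exact: IH.
by rewrite addn1 addSn; apply: step_reach => //=; exact: IH.
Qed.

Lemma reach_right_word pc c j w l u :
  reach (size w).+1 (pc, PRight, c, j.+1, l, rcons (map Some w) None ++ u)
     (pc, PRight, c, j, rev (rcons (map Some w) None) ++ l, u).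
Proof.
elim: w l => [|x w IH] l /=; apply: step_reach => //=.
  exact: reaches_refl.
by rewrite rev_cons (cat_rcons (Some x)); exact: IH.
Qed.

Lemma layout_cons w st : layout (w :: st) = rcons (map Some w) None ++ layout st.
Proof. by []. Qed.

Lemma layout_cat st1 st2 : layout (st1 ++ st2) = layout st1 ++ layout st2.
Proof. by rewrite /layout map_cat flatten_cat. Qed.

Lemma count_layout st : cnt (layout st) = size st.
Proof.
elim: st => //= w st IH; rewrite layout_cons count_cat IH -cats1 count_cat /= count_map.
by rewrite (@eq_count _ _ pred0) // count_pred0.
Qed.

Lemma reach_right pc c st j l u :
  reach (size (layout st)) (pc, PRight, c, size st + j, l, layout st ++ u)
     (pc, PRight, c, j, rev (layout st) ++ l, u).
Proof.
elim: st l => [|w st IH] l; first exact: reaches_refl.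
rewrite layout_cons size_cat rev_cat -!catA size_rcons size_map.
by apply: reaches_trans; [exact: reach_right_word | exact: IH].
Qed.

Lemma reach_right0 pc c st k l u : size st = k ->
  reach (size (layout st)) (pc, PRight, c, k, l, layout st ++ u)
     (pc, PRight, c, 0, rev (layout st) ++ l, u).
Proof. by move<-; have := reach_right pc c st 0 l u; rewrite addn0. Qed.

Lemma reach_carry_word pc c j w l u :
  reach (size w).+1 (pc, PCarry, c, j.+2, l, rcons (map Some w) None ++ u)
     (pc, PCarry, None, j.+1, rev (c :: map Some w) ++ l, u).
Proof.
elim: w c l => [|y w IH] c l /=; apply: step_reach => //=.
  exact: reaches_refl.
by rewrite rev_cons (cat_rcons c); exact: IH.
Qed.

Lemma reach_carry_last pc c w l u :
  reach (size w).+1 (pc, PCarry, c, 1, l, rcons (map Some w) None ++ u)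
     (pc, PHome, None, R.+1, rev (c :: map Some w) ++ l, u).
Proof.
elim: w c l => [|y w IH] c l /=; apply: step_reach => //=.
  exact: reaches_refl.
by rewrite rev_cons (cat_rcons c); exact: IH.
Qed.

Lemma layout_rcons w st : exists V, layout (w :: st) = rcons V None.
Proof.
elim: st w => [|w' st IH] w; first by exists (map Some w); rewrite /layout /= cats0.
by have [V E] := IH w'; rewrite layout_cons E -rcons_cat; eexists.
Qed.

Lemma reach_carry pc c w st l u V : rcons V None = c :: layout (w :: st) ->
  reach (size V) (pc, PCarry, c, (size st).+1, l, layout (w :: st) ++ u)
     (pc, PHome, None, R.+1, rev V ++ l, u).
Proof.
elim: st c w l V => [|w' st IH] c w l V.
  rewrite /layout /= cats0 -rcons_cons => /rcons_inj[->] /=.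
  by rewrite size_map; exact: reach_carry_last.
rewrite layout_cons -cat_cons -rcons_cons cat_rcons => EV.
have [V1 EV1] := layout_rcons w' st.
move: EV; rewrite EV1 -rcons_cons -rcons_cat => /rcons_inj[-> {V}].
rewrite -EV1 -!cat_cons size_cat rev_cat -[(rcons _ _ ++ _) ++ _]catA -[(rev _ ++ _) ++ _]catA /= size_map.
by apply: reaches_trans; [exact: reach_carry_word | apply: (IH _ _ _ (None :: V1))]; rewrite /= EV1.
Qed.

Lemma layout_setnth st r w : (r < size st) ->
  layout (set_nth [::] st r w) =
  layout (take r st) ++ layout (w :: drop r.+1 st).
Proof.
by move=> lt; rewrite -layout_cat set_nthE lt.
Qed.

Lemma layout_split st r : (r < size st) ->
  layout st = layout (take r st) ++ layout (nth [::] st r :: drop r.+1 st).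
Proof. by move=> lt; rewrite -layout_cat -drop_nth // cat_take_drop. Qed.

Definition represents (c : nat * regs) (m : cfg mstate) :=
  exists a b, m = (c.1, PFetch, None, 0, blanks a, layout c.2 ++ blanks b).

Lemma head_rev_layout st a : head None (rev (layout st) ++ blanks a) = None.
Proof.
case: st => [|w st]; first by case: a.
by have [V' ->] := layout_rcons w st; rewrite rev_rcons.
Qed.

Lemma reach_home_end pc c st a u :
  reach (size (layout st)).+1 (at_end (pc, PHome, c, (size st).+1) (layout st) (blanks a) u)
    (pc, PFetch, None, 0, blanks a.-1.+1, layout st ++ u).
Proof.
rewrite -addn1; apply: reaches_trans.
  by rewrite -{1}(count_layout st) -addn1; exact: reach_home.
rewrite /at_end /=.
have -> : head None (blanks a) = None by case: (a).
have -> : behead (blanks a) = blanks a.-1 by case: (a).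
by apply: step_reach => //=; exact: reaches_refl.
Qed.

Lemma stay_reach b s s' l u c' : (0 < size u) ->
    mdelta s (head None u) = Some (s', head None u, Stay) ->
  reach b (s', l, u) c' -> reach b.+1 (s, l, u) c'.
Proof. by case: u => // x u _ E; exact: step_reach E. Qed.

Lemma layout_gt0 st u : (0 < size st) -> (0 < size (layout st ++ u)).
Proof. by case: st => // w st _; rewrite layout_cons size_cat size_cat size_rcons. Qed.

(* A blank read beyond the end of the tape is indistinguishable from a written one. *)
Lemma reach_pad b s l n c' : s <> c'.1.1 ->
  reach b (s, l, None :: blanks n.-1) c' -> reach b (s, l, blanks n) c'.
Proof.
case: n => [|n] // ns [[|m] lem /=]; first by case=> E; case: ns; rewrite -E.
by move=> E; exists m.+1.
Qed.

Lemma reach_push pc r x st a b : size st = R -> onth code pc = Some (IPush r x) ->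
  exists m, represents (pc.+1, set_nth [::] st r (x :: nth [::] st r)) m /\
  reach (4 * size (layout st) + 10)
    (pc, PFetch, None, 0, blanks a, layout st ++ blanks b) m.
Proof.
move=> szR E; have [_ ltr] := onth_wf E; rewrite /= -szR in ltr.
set st' := set_nth _ _ _ _.
(* The insertion uses up one trailing blank if there is one, and on the way home the head visits one
   blank to the left of the registers. *)
exists (pc.+1, PFetch, None, 0, blanks a.-1.+1, layout st' ++ blanks b.-1); split.
  by exists a.-1.+1, b.-1.
set w := nth [::] st r in st' *.
have [V1 EV1] := layout_rcons w (drop r.+1 st).
have Est : layout st = layout (take r st) ++ layout (w :: drop r.+1 st).
  exact: layout_split.
have Est' : layout st' = layout (take r st) ++ (Some x :: layout (w :: drop r.+1 st)).
  by rewrite layout_setnth.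
have szst' : size st' = R by rewrite size_set_nth szR; apply/maxn_idPr; rewrite -szR.
have szd : (size (drop r.+1 st)).+1 = (R - r) by rewrite size_drop szR; lia.
have szt : size (take r st) = r by rewrite size_takel // ltnW.
have sz1 := congr1 size Est; rewrite size_cat in sz1.
have sz2 := congr1 size EV1; rewrite size_rcons in sz2.
have sz3 := congr1 size Est'; rewrite size_cat /= in sz3.
apply: (@reachesW _ _ (size (layout (take r st)) + (size (Some x :: V1) + (size (layout st')).+1).+1).+1).
  by rewrite /=; lia.
apply: stay_reach; [by apply: layout_gt0; lia | by rewrite /= E |].
rewrite Est -catA; apply: reaches_trans; first exact: (reach_right0 _ _ _ _ szt).
apply: stay_reach; [by apply: layout_gt0 | by rewrite /= E |].
rewrite -szd; apply: reaches_trans.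
  by apply: reach_carry; rewrite EV1.
have Erev : rev (layout st') ++ blanks a =
    None :: rev (Some x :: V1) ++ rev (layout (take r st)) ++ blanks a.
  by rewrite Est' EV1 -rcons_cons rev_cat rev_rcons /= -catA.
have := @reach_home_end pc.+1 None st' a (blanks b.-1).
by rewrite /at_end Erev szst' /= => H; apply: reach_pad.
Qed.

Lemma reach_pop_nil pc r e f st a b : size st = R ->
    onth code pc = Some (IPop r e f) -> nth [::] st r = [::] ->
  exists m, represents (e, st) m /\
  reach (4 * size (layout st) + 10)
    (pc, PFetch, None, 0, blanks a, layout st ++ blanks b) m.
Proof.
move=> szR E Ew; have [_ /= /and3P[ltr _ _]] := onth_wf E; rewrite -szR in ltr.
exists (e, PFetch, None, 0, blanks a.-1.+1, layout st ++ blanks b); split.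
  by exists a.-1.+1, b.
have Est : layout st = layout (take r st) ++ layout ([::] :: drop r.+1 st).
  by rewrite -Ew; exact: layout_split.
have szt : size (take r st) = r by rewrite size_takel // ltnW.
have sz1 := congr1 size Est; rewrite size_cat layout_cons size_cat /= in sz1.
apply: (@reachesW _ _ (size (layout (take r st)) + ((size (layout (take r st))).+2).+1).+1).
  by lia.
apply: stay_reach; [by apply: layout_gt0; lia | by rewrite /= E |].
rewrite Est -catA; apply: reaches_trans; first exact: (reach_right0 _ _ _ _ szt).
apply: stay_reach; [by apply: layout_gt0 | by rewrite /= E |].
have := @reach_home_end e None (rcons (take r st) [::]) a (layout (drop r.+1 st) ++ blanks b).
by rewrite -cats1 layout_cat !size_cat szt /at_end rev_cat -!catA /= !addn1.
Qed.

Lemma reach_pop_cons pc r e f st a b y w : size st = R ->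
    onth code pc = Some (IPop r e f) -> nth [::] st r = y :: w ->
  exists m, represents (f y, set_nth [::] st r w) m /\
  reach (4 * size (layout st) + 10)
    (pc, PFetch, None, 0, blanks a, layout st ++ blanks b) m.
Proof.
move=> szR E Ew; have [_ /= /and3P[ltr _ _]] := onth_wf E; rewrite -szR in ltr.
set st' := set_nth _ _ _ _.
(* The head has visited at least one blank beyond the last register, and the deletion frees one more
   cell. *)
exists (f y, PFetch, None, 0, blanks a.-1.+1, layout st' ++ blanks b.-1.+2); split.
  by exists a.-1.+1, b.-1.+2.
set V := layout ((y :: w) :: drop r.+1 st).
have Est : layout st = layout (take r st) ++ V.
  by rewrite /V -Ew; exact: layout_split.
have EV : V = Some y :: layout (w :: drop r.+1 st) by [].
have Est' : layout st' = layout (take r st) ++ layout (w :: drop r.+1 st).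
  by rewrite layout_setnth.
have szt : size (take r st) = r by rewrite size_takel // ltnW.
have szd : size ((y :: w) :: drop r.+1 st) = (R - r) by rewrite /= size_drop szR; lia.
have sz1 := congr1 size Est; rewrite size_cat in sz1.
apply: (@reachesW _ _ (size (layout (take r st)) + (size V + (1 + (size V + (size (layout (take r st))).+2))).+1).+1).
  by lia.
apply: stay_reach; [by apply: layout_gt0; lia | by rewrite /= E |].
rewrite Est -catA; apply: reaches_trans; first exact: (reach_right0 _ _ _ _ szt).
apply: stay_reach; [by rewrite EV | by rewrite /= E |].
apply: reaches_trans; first exact: (reach_right0 _ _ _ _ szd).
set l := rev (layout (take r st)) ++ blanks a.
apply: (@reaches_trans _ _ _ _ _ (at_end (pc, PDel, None, (R - r)) V l (blanks b.-1.+1))).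
  by apply: reaches_step; rewrite /at_end; case: (b) => [|b'] /=; rewrite E.
apply: reaches_trans.
  by have := reach_del pc None V l (blanks b.-1.+1) 0; rewrite addn0 count_layout szd; apply.
have -> : behead (rcons V None) ++ blanks b.-1.+1 = layout (w :: drop r.+1 st) ++ blanks b.-1.+2.
  by rewrite EV [rcons (_ :: _) _]/= [behead _]/= cat_rcons.
have -> s u : at_end s [::] l u = (s, behead l, None :: u) by rewrite /at_end head_rev_layout.
apply: stay_reach => //; first by rewrite EV /= E.
have := @reach_home_end (f y) None (take r st) a (layout (w :: drop r.+1 st) ++ blanks b.-1.+2).
by rewrite szt /at_end head_rev_layout catA -Est'.
Qed.

Lemma astep_sim c c' m : size c.2 = R -> represents c m -> astep code c = Some c' ->
  [/\ size c'.2 = R, (sumn (map size c'.2) <= (sumn (map size c.2)).+1) &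
  exists m', represents c' m' /\ reach (4 * (sumn (map size c.2) + R) + 10) m m'].
Proof.
case: c => pc st /= szR [a [b ->]] /=.
have szl : size (layout st) = (sumn (map size st) + R).
  rewrite -szR; elim: st {szR} => //= w st IH.
  by rewrite layout_cons size_cat IH size_rcons size_map; lia.
have sums r w : (r < size st) ->
   (sumn (map size (set_nth [::] st r w)) + size (nth [::] st r) = sumn (map size st) + size w).
  move=> lt; rewrite set_nthE lt -{4}(cat_take_drop r st) (drop_nth [::] lt).
  by rewrite !map_cat !sumn_cat /=; lia.
case E : (onth code pc) => [i|] // [<-]; have [_ wfi] := onth_wf E.
case: i E wfi => [r x|r e f|l] E /= wfi.
- have sum := sums r (x :: nth [::] st r); rewrite szR wfi in sum.
  have /= sum' := sum isT; split.
  + by rewrite size_set_nth szR; apply/maxn_idPr.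
  + by lia.
  + by rewrite -szl; exact: reach_push.
- case/and3P: wfi => ltr _ _; case Ew : (nth [::] st r) => [|y w].
    by split=> //; rewrite -szl; apply: reach_pop_nil E Ew.
  have sum := sums r w; rewrite szR ltr Ew in sum.
  have /= sum' := sum isT; split.
  + by rewrite size_set_nth szR; apply/maxn_idPr.
  + by lia.
  + by rewrite -szl; apply: reach_pop_cons E Ew.
- split=> //; exists (l, PFetch, None, 0, blanks a, layout st ++ blanks b).
  split; first by exists a, b.
  apply: (@reachesW _ _ 1); first by lia.
  apply: stay_reach; [by apply: layout_gt0; rewrite szR | by rewrite /= E | exact: reaches_refl].
Qed.

(** An instruction lengthens the registers by at most one letter and costs a bounded number of
    passes over the tape, whose length thus never exceeds the initial one by more than [n]. *)
Lemma arun_sim n c c' m : size c.2 = R -> represents c m -> arun code n c = Some c' ->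
  exists m', represents c' m' /\
    reach (n * (4 * (sumn (map size c.2) + n + R) + 10)) m m'.
Proof.
elim: n c m => [|n IH] c m szR rm /=.
  by case=> <-; exists m; split=> //; exact: reaches_refl.
case E : (astep code c) => [c1|] //= run1.
have [sz1 sum1 [m1 [rm1 re1]]] := astep_sim szR rm E.
have [m' [rm' re']] := IH _ _ sz1 rm1 run1.
exists m'; split=> //; apply: reachesW (reaches_trans re1 re').
rewrite (mulSn n) leq_add //; first by lia.
by rewrite leq_mul2l; apply/orP; right; move: sum1; lia.
Qed.

Definition tm_instr_state := ('I_(size code).+1 * 'I_5 * cell * 'I_R.+3)%type.

Definition phase_code (p : phase) : 'I_5 :=
  inord match p with PFetch => 0 | PRight => 1 | PCarry => 2 | PDel => 3 | PHome => 4 end.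

Definition phase_decode (i : 'I_5) : phase :=
  match val i with 0 => PFetch | 1 => PRight | 2 => PCarry | 3 => PDel | _ => PHome end.

Definition state_decode (q : tm_instr_state) : mstate :=
  let: (pc, ph, c, j) := q in (val pc, phase_decode ph, c, val j).

Definition state_code (s : mstate) : tm_instr_state :=
  let: (pc, ph, c, j) := s in (inord pc, phase_code ph, c, inord j).

Lemma state_codeK s : ok_state s -> state_decode (state_code s) = s.
Proof.
case: s => [[[pc ph] c] j] /= /andP[lepc lej].
by rewrite !inordK //; congr (_, _, _, _); case: ph; rewrite /phase_decode /= inordK.
Qed.

Definition asm_tm : TM :=
  tm_of mdelta (state_code (0, PFetch, None, 0)) state_decode state_code.

Definition sym_of_letter (a : letter) : sym := sym_of (Some a).

(** No letter is coded by the blank symbol and register 0 is closed by a blank, so the output ends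
    exactly where register 0 does. *)
Lemma take_nonblank_layout t w st b l :
  rep t l (layout (w :: st) ++ blanks b) -> tm_output t = map sym_of_letter w.
Proof.
move=> [_ H]; rewrite /tm_output; move: (_ :: t_right t) H => s {t l}.
elim: w s => [|a w IH] [|x s] H //=.
- by have := H 0; case: x {H}.
- by have := H 0; case: a {H} => [[]|].
- have /= Hx := H 0; rewrite (IH s) => [|i]; last exact: (H i.+1).
  by rewrite Hx /sym_of_letter; case: a {Hx H} => [[]|].
Qed.

Lemma arun_size n c c' : size c.2 = R -> arun code n c = Some c' -> size c'.2 = R.
Proof.
elim: n c => [|n IH] c szc /=; first by case=> <-.
case E : (astep code c) => [c1|] //= run1; apply: IH run1.
have rc : represents c (c.1, PFetch, None, 0, blanks 0, layout c.2 ++ blanks 0) by exists 0, 0.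
by have [] := astep_sim szc rc E.
Qed.

Lemma asm_tm_computes w n st T :
  arun code n (0, w :: nseq R.-1 [::]) = Some (size code, st) ->
  (n * (4 * (size w + n + R) + 10) <= T) ->
  tm_computes_within asm_tm (map sym_of_letter w) T (map sym_of_letter (head [::] st)).
Proof.
move=> run leT.
have szR : size (w :: nseq R.-1 (@nil letter)) = R by rewrite /= size_nseq prednK.
have rm : represents (0, w :: nseq R.-1 [::])
    (0, PFetch, None, 0, blanks 0, layout (w :: nseq R.-1 [::]) ++ blanks 0).
  by exists 0, 0.
have [m' [[a [b ->]] [N leN re]]] := arun_sim (c := (0, w :: nseq R.-1 [::])) szR rm run.
have szst : size st = R by exact: (arun_size (c := (0, w :: nseq R.-1 [::])) szR run).
have sumE : sumn (map size (w :: nseq R.-1 (@nil letter))) = size w.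
  by rewrite /= map_nseq sumn_nseq mul0n addn0.
rewrite [_.2]/= sumE in leN.
(* Empty registers consist of their closing blank only, so the bare input tape already is a layout
   with the input in register 0. *)
have rep0 : rep (init_tape (map sym_of_letter w)) (blanks 0)
    (layout (w :: nseq R.-1 [::]) ++ blanks 0).
  have nth_blank k i : nth None (layout (nseq k [::])) i = None.
    by elim: k i => [|k IH] [|i] //=; exact: IH.
  split=> i; first by case: w {run leT szR rm sumE leN re} => //=; rewrite !nth_nil.
  rewrite cats0 layout_cons.
  have : nth None (map Some w) i = nth None (rcons (map Some w) None ++ layout (nseq R.-1 [::])) i.
    by elim: w i {run leT szR rm sumE leN re} => [|x w IH] [|i] /=.
  move=> <-; case: w {run leT szR rm sumE leN re} => [|x w] //=.
    by case: i => [|i] /=; rewrite ?nth_nil.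
  by case: i => [|i] //=; elim: w i => [|y w IH] [|i] //=.
have dN : mdelta (size code, PFetch, None, 0) (head None (layout st ++ blanks b)) = None.
  by rewrite /= onth_default.
have st0 : tm_state (state_code (0, PFetch, None, 0)) state_decode ord0 = (0, PFetch, None, 0).
  by rewrite /tm_state unlift_none state_codeK.
have [t' ex rt'] := tm_of_exec state_codeK mdelta_ok (s := (0, PFetch, None, 0)) isT st0
  rep0 re dN (leq_trans leN leT).
exists t'; split=> //.
case: st szst {run re dN} rt' => [|w' st] szst rt'; first by move: R_gt0; rewrite -szst.
exact: take_nonblank_layout rt'.
Qed.

End Simulation.

(** * Structured programs *)

(* [Case] and [While] pop the letter they branch on; a [While] loop ends when its
   register is empty or when a letter satisfying the stop predicate is popped. *)
Inductive prog :=
  | Skip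
  | Push of nat & letter
  | Seq of prog & prog
  | Case of nat & prog & (letter -> prog)
  | While of nat & pred letter & (letter -> prog).

Section Loop.
Variables (r : nat) (stop : pred letter) (body : letter -> regs -> option regs).

Fixpoint wloop k (st : regs) : option regs :=
  if nth [::] st r is a :: w then
    if stop a then Some (set_nth [::] st r w)
    else if k is k'.+1 then obind (wloop k') (body a (set_nth [::] st r w)) else None
  else Some st.

End Loop.

(* [run B] fails as soon as some loop is iterated more than [B] times: a successful
   run therefore has a running time bounded by [scost B p], whatever the registers. *)
Fixpoint run B p (st : regs) : option regs :=
  match p with
  | Skip => Some st
  | Push r a => Some (set_nth [::] st r (a :: nth [::] st r))
  | Seq p q => obind (run B q) (run B p st)
  | Case r pe f =>
      if nth [::] st r is a :: w then run B (f a) (set_nth [::] st r w) else run B pe st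
  | While r stop f => wloop r stop (fun a => run B (f a)) B st
  end.

Fixpoint scost B p : nat :=
  match p with
  | Skip => 0
  | Push _ _ => 1
  | Seq p q => scost B p + scost B q
  | Case _ pe f =>
      2 + (scost B pe + (scost B (f (Some false)) + (scost B (f (Some true)) + scost B (f None))))
  | While _ _ f =>
      B.+1 * (2 + (scost B (f (Some false)) + (scost B (f (Some true)) + scost B (f None))))
  end.

(** Outside loops this follows the branch actually taken. It is what keeps [k] out of the time bound
    when there are no variables: the branch of the initialisation that depends on [k] is then not
    executed. *)
Fixpoint cost B p (st : regs) : nat :=
  match p with
  | Seq p q => cost B p st + (if run B p st is Some st' then cost B q st' else 0)
  | Case r pe f =>
      2 + (if nth [::] st r is a :: w then cost B (f a) (set_nth [::] st r w) else cost B pe st)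
  | _ => scost B p
  end.

Lemma cost_le B p st : (cost B p st <= scost B p).
Proof.
elim: p st => //= [p IHp q IHq|r pe IHe f IHf] st.
  by apply: leq_add => //; case: (run B p st).
rewrite leq_add2l; case: (nth _ _ _) => [|a w]; first exact: leq_trans (IHe _) (leq_addr _ _).
apply: leq_trans (IHf _ _) _.
by case: a => [[]|]; lia.
Qed.

Fixpoint csize p : nat :=
  match p with
  | Skip => 0
  | Push _ _ => 1
  | Seq p q => csize p + csize q
  | Case _ pe f =>
      (csize pe + (csize (f (Some false)) + (csize (f (Some true)) + (csize (f None)).+1).+1).+1).+2
  | While _ _ f =>
      (csize (f (Some false)) + (csize (f (Some true)) + (csize (f None)).+1).+1).+2
  end.

Definition jump_table (l0 l1 l2 : nat) (a : letter) : nat :=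
  match a with Some false => l0 | Some true => l1 | None => l2 end.

Fixpoint compile o p : seq instr :=
  match p with
  | Skip => [::]
  | Push r a => [:: IPush r a]
  | Seq p q => compile o p ++ compile (o + csize p) q
  | Case r pe f =>
      let l0 := (o.+1 + (csize pe).+1) in
      let l1 := (l0 + (csize (f (Some false))).+1) in
      let l2 := (l1 + (csize (f (Some true))).+1) in
      let e := (l2 + (csize (f None)).+1) in
      (IPop r o.+1 (jump_table l0 l1 l2) :: compile o.+1 pe ++
      (IJmp e :: compile l0 (f (Some false)) ++
      (IJmp e :: compile l1 (f (Some true)) ++
      (IJmp e :: compile l2 (f None) ++ [:: IJmp e]))))
  | While r stop f =>
      let l0 := o.+1 in
      let l1 := (l0 + (csize (f (Some false))).+1) in
      let l2 := (l1 + (csize (f (Some true))).+1) in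
      let e := (l2 + (csize (f None)).+1) in
      (IPop r e (fun a => if stop a then e else jump_table l0 l1 l2 a) ::
      compile l0 (f (Some false)) ++ (IJmp o :: compile l1 (f (Some true)) ++
      (IJmp o :: compile l2 (f None) ++ [:: IJmp o])))
  end.

Lemma size_compile o p : size (compile o p) = csize p.
Proof.
elim: p o => //= [p IHp q IHq|r pe IHe f IHf|r s f IHf] o.
- by rewrite size_cat IHp IHq.
- by do 4![rewrite size_cat /=]; rewrite IHe !IHf; lia.
- by do 3![rewrite size_cat /=]; rewrite !IHf; lia.
Qed.

Fixpoint wf_prog R p : bool :=
  match p with
  | Skip => true
  | Push r _ => r < R
  | Seq p q => wf_prog R p && wf_prog R q
  | Case r pe f =>
      [&& r < R, wf_prog R pe, wf_prog R (f (Some false)), wf_prog R (f (Some true))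
        & wf_prog R (f None)]
  | While r _ f =>
      [&& r < R, wf_prog R (f (Some false)), wf_prog R (f (Some true)) & wf_prog R (f None)]
  end%N.

Lemma wf_compile R L o p : wf_prog R p -> (o + csize p <= L) ->
  all (wf_instr R L) (compile o p).
Proof.
elim: p o => //= [r a|p IHp q IHq|r pe IHe f IHf|r s f IHf] o.
- by rewrite andbT.
- case/andP=> wp wq le; rewrite all_cat IHp ?IHq //; lia.
- case/and5P=> -> wpe w0 w1 w2 le /=.
  rewrite all_cat /= all_cat /= all_cat /= all_cat /=.
  rewrite IHe ?IHf //; try lia.
  by rewrite !andbT; repeat (apply/andP; split); try (by lia); apply/forallP=> -[[]|] /=; lia.
- case/and4P=> -> w0 w1 w2 le /=.
  rewrite all_cat /= all_cat /= all_cat /=.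
  rewrite ?IHf //; try lia.
  rewrite !andbT; repeat (apply/andP; split); try (by lia).
  by apply/forallP=> a; case: ifP => _; [lia | case: a => [[]|] /=; lia].
Qed.

Definition code_at (code : seq instr) o c :=
  exists pre post, code = pre ++ c ++ post /\ size pre = o.

Lemma code_at_cat code o c1 c2 : code_at code o (c1 ++ c2) ->
  code_at code o c1 /\ code_at code (o + size c1) c2.
Proof.
move=> [pre [post [-> <-]]]; split; first by exists pre, (c2 ++ post); rewrite -catA.
by exists (pre ++ c1), post; rewrite -!catA size_cat.
Qed.

Lemma code_at_cons code o i c : code_at code o (i :: c) ->
  onth code o = Some i /\ code_at code o.+1 c.
Proof.
move=> [pre [post [-> <-]]]; split; first by rewrite onth_cat ltnn subnn.
by exists (rcons pre i), post; rewrite cat_rcons size_rcons.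
Qed.

Definition aruns code b c c' := exists2 t, (t <= b) & arun code t c = Some c'.

Lemma aruns_trans code b1 b2 c1 c2 c3 :
  aruns code b1 c1 c2 -> aruns code b2 c2 c3 -> aruns code (b1 + b2) c1 c3.
Proof.
move=> [m lem rm] [n len rn]; exists (m + n); first exact: leq_add.
by rewrite arunD rm.
Qed.

Lemma aruns_step code b c1 c2 c3 :
  astep code c1 = Some c2 -> aruns code b c2 c3 -> aruns code b.+1 c1 c3.
Proof. by move=> E [t le_t r]; exists t.+1; rewrite //= E. Qed.

Lemma aruns_refl code c : aruns code 0 c c. Proof. by exists 0. Qed.

Lemma arunsW code b b' c c' : (b <= b') -> aruns code b c c' -> aruns code b' c c'.
Proof. by move=> le [n len r]; exists n => //; exact: leq_trans le. Qed.

Lemma compileP B code p o st st' : code_at code o (compile o p) ->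
  run B p st = Some st' -> aruns code (cost B p st) (o, st) (o + csize p, st').
Proof.
elim: p o st st' => /= [|r a|p IHp q IHq|r pe IHe f IHf|r s f IHf] o st st'.
- by move=> _ [->]; rewrite addn0; exact: aruns_refl.
- move=> /code_at_cons[E _] [<-]; apply: aruns_step; first by rewrite /= E.
  by rewrite addn1; exact: aruns_refl.
- move=> /code_at_cat[]; rewrite size_compile => cp cq.
  case E : (run B p st) => [st1|] //= run2.
  by apply: aruns_trans (IHp _ _ _ cp E) _; rewrite addnA; exact: IHq.
- move=> /code_at_cons[E0 /code_at_cat[ce]].
  rewrite size_compile => /code_at_cons[Ee]; rewrite -addnS => /code_at_cat[c0].
  rewrite size_compile => /code_at_cons[E1]; rewrite -addnS => /code_at_cat[c1].
  rewrite size_compile => /code_at_cons[E2]; rewrite -addnS => /code_at_cat[c2].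
  rewrite size_compile => /code_at_cons[E3 _].
  set e := (_ + (csize (f None)).+1) in E0 Ee E1 E2 E3.
  have Eo : (o + (csize pe + (csize (f (Some false)) + (csize (f (Some true)) +
     (csize (f None)).+1).+1).+1).+2) = e by rewrite /e; lia.
  rewrite Eo.
  have fin l s : onth code l = Some (IJmp e) -> aruns code 1 (l, s) (e, s).
    by move=> E; apply: aruns_step; [rewrite /= E | exact: aruns_refl].
  rewrite -[2]/(1 + 1) -addnA [(1 + (if _ is _ :: _ then _ else _))]addnC add1n.
  case Ew : (nth [::] st r) => [|a w] runb.
    apply: aruns_step; first by rewrite /= E0 Ew.
    by apply: aruns_trans (IHe _ _ _ ce runb) _; exact: fin.
  apply: aruns_step; first by rewrite /= E0 Ew.
  case: a Ew runb => [[]|] Ew runb; apply: aruns_trans (IHf _ _ _ _ _ runb) _ => //=; exact: fin.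
- move=> /code_at_cons[E0 /code_at_cat[c0]].
  rewrite size_compile => /code_at_cons[E1]; rewrite -addnS => /code_at_cat[c1].
  rewrite size_compile => /code_at_cons[E2]; rewrite -addnS => /code_at_cat[c2].
  rewrite size_compile => /code_at_cons[E3 _].
  set e := (_ + (csize (f None)).+1) in E0.
  have Eo : (o + (csize (f (Some false)) + (csize (f (Some true)) +
     (csize (f None)).+1).+1).+2) = e by rewrite /e; lia.
  rewrite Eo; set m := (2 + _).
  have fin l s1 : onth code l = Some (IJmp o) -> aruns code 1 (l, s1) (o, s1).
    by move=> E; apply: aruns_step; [rewrite /= E | exact: aruns_refl].
  have : (0 < m) by [].
  (* The counter of this loop is generalised apart from the fuel of its body, which is [B] again in
     every iteration. *)
  elim: {2 3}B st => [|k IHk] st m_gt0 /=; case Ew : (nth [::] st r) => [|a w].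
  + case=> <-; apply: (@arunsW _ 1); first by rewrite mul1n.
    by apply: aruns_step; [rewrite /= E0 Ew | exact: aruns_refl].
  + case Es : (s a) => // -[<-]; apply: (@arunsW _ 1); first by rewrite mul1n.
    by apply: aruns_step; [rewrite /= E0 Ew Es | exact: aruns_refl].
  + case=> <-; apply: (@arunsW _ 1); first by rewrite muln_gt0.
    by apply: aruns_step; [rewrite /= E0 Ew | exact: aruns_refl].
  + case Es : (s a).
      case=> <-; apply: (@arunsW _ 1); first by rewrite muln_gt0.
      by apply: aruns_step; [rewrite /= E0 Ew Es | exact: aruns_refl].
    case Eb : (run B (f a) _) => [st1|] //= runl.
    rewrite mulSn; apply: aruns_trans _ (IHk _ m_gt0 runl).
    apply: (@arunsW _ (scost B (f a) + 1).+1); first by rewrite /m; case: (a) => [[]|]; lia.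
    apply: aruns_step; first by rewrite /= E0 Ew Es.
    set l1 := jump_table _ _ _ _.
    suff [l El runs] : exists2 l, onth code l = Some (IJmp o) &
        aruns code (scost B (f a)) (l1, set_nth [::] st r w) (l, st1).
      by apply: aruns_trans runs _; exact: fin.
    by rewrite /l1; case: (a) Eb => [[]|] Eb; (eexists; last by
      apply: arunsW (cost_le _ _ _) _; apply: IHf Eb).
Qed.

Lemma scost_poly p : exists c e, forall B, (scost B p <= c * B.+1 ^ e).
Proof.
have le_pow c1 e1 c e B : (c1 <= c) -> (e1 <= e) -> (c1 * B.+1 ^ e1 <= c * B.+1 ^ e).
  by move=> lec lee; rewrite leq_mul // leq_pexp2l.
elim: p => /= [|r a|p [c1 [e1 H1]] q [c2 [e2 H2]]|r pe [c0 [e0 H0]] f IHf|r s f IHf].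
- by exists 0, 0.
- by exists 1%N, 0%N.
- exists (c1 + c2), (e1 + e2) => B; rewrite mulnDl.
  by apply: leq_add; [apply: leq_trans (H1 B) _ | apply: leq_trans (H2 B) _]; apply: le_pow; lia.
- have [c1 [e1 H1]] := IHf (Some false); have [c2 [e2 H2]] := IHf (Some true).
  have [c3 [e3 H3]] := IHf None.
  exists (2 + (c0 + (c1 + (c2 + c3)))), (e0 + (e1 + (e2 + e3))) => B; rewrite !mulnDl.
  have le2 e : (2 <= 2 * B.+1 ^ e) by rewrite -[X in (X <= _)]muln1 leq_mul2l expn_gt0.
  apply: (leq_add (le2 _)); apply: leq_add; last apply: leq_add; last apply: leq_add;
    first [apply: leq_trans (H0 B) _; apply: le_pow; lia |
    apply: leq_trans (H1 B) _; apply: le_pow; lia |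
    apply: leq_trans (H2 B) _; apply: le_pow; lia |
    apply: leq_trans (H3 B) _; apply: le_pow; lia].
- have [c1 [e1 H1]] := IHf (Some false); have [c2 [e2 H2]] := IHf (Some true).
  have [c3 [e3 H3]] := IHf None.
  exists (2 + (c1 + (c2 + c3))), (e1 + (e2 + e3)).+1 => B.
  rewrite expnS mulnCA leq_mul2l !mulnDl; apply/orP; right.
  have le2 e : (2 <= 2 * B.+1 ^ e) by rewrite -[X in (X <= _)]muln1 leq_mul2l expn_gt0.
  apply: (leq_add (le2 _)); apply: leq_add; last apply: leq_add;
    first [apply: leq_trans (H1 B) _; apply: le_pow; lia |
    apply: leq_trans (H2 B) _; apply: le_pow; lia |
    apply: leq_trans (H3 B) _; apply: le_pow; lia].
Qed.

(** * Programs on registers of field elements *)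

Section Tokens.
Variable F : finFieldType.
Local Open Scope ring_scope.

Notation token := (option F).

(** A token is a field element or, for [None], the mark that closes a polynomial or a matrix. The
    code is the one prescribed for inputs and outputs, so nothing has to be translated; [None] also
    serves as the unit of unary counters. *)
Definition enc_tok (t : token) : seq letter :=
  if t is Some x then rcons (nseq (enum_rank x) (Some true)) None else [:: Some false].

Definition enc (ts : seq token) : seq letter := flatten (map enc_tok ts).

Definition enc_st (st : seq (seq token)) : regs := map enc st.

Definition elt (i : nat) : F := nth 0 (enum F) i.

Lemma elt_rank x : elt (enum_rank x) = x.
Proof. by rewrite /elt nth_enum_rank. Qed.

Lemma enc_st_nth st r : nth [::] (enc_st st) r = enc (nth [::] st r).
Proof.
case: (ltnP r (size st)) => lt; first by rewrite (nth_map [::]).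
by rewrite !nth_default ?size_map.
Qed.

Lemma enc_st_set st r w :
  set_nth [::] (enc_st st) r (enc w) = enc_st (set_nth [::] st r w).
Proof.
elim: r st => [|r IH] [|v st] //=; last by rewrite IH.
by congr (_ :: _); elim: r {IH} => //= r ->.
Qed.

Definition push_tok r (t : token) : prog :=
  foldr (fun a p => Seq p (Push r a)) Skip (enc_tok t).

(** A nest of cases instead of a loop: the number of ones read sits in the program counter, so the
    continuation [k] can be a different program for every element. This is how field operations are
    done by the finite control. *)
Fixpoint read_elt r i fuel (k : F -> prog) : prog :=
  Case r Skip (fun a =>
    match a with
    | None => k (elt i)
    | Some true => if fuel is fuel'.+1 then read_elt r i.+1 fuel' k else Skip
    | Some false => Skip
    end).

Definition read_tok r (f : token -> prog) (a : letter) : prog :=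
  match a with
  | Some false => f None
  | None => f (Some (elt 0))
  | Some true => read_elt r 1 #|F| (fun x => f (Some x))
  end.

Definition case_tok r pe f := Case r pe (read_tok r f).

(** With [stop] the loop consumes one vector together with its end mark; without it, the whole
    register. The end mark is recognised by its single letter, with which no element code begins. *)
Definition while_tok r (stop : bool) f :=
  While r (fun a => stop && (a == Some false)) (read_tok r f).

Definition tloop B r (stop : bool) f k : regs -> option regs :=
  wloop r (fun a => stop && (a == Some false)) (fun a => run B (read_tok r f a)) k.

Lemma run_seq B p q st : run B (Seq p q) st = obind (run B q) (run B p st).
Proof. by []. Qed.

Lemma run_skip B st : run B Skip st = Some st.
Proof. by []. Qed.

Lemma run_push B r t st :
  run B (push_tok r t) (enc_st st) = Some (enc_st (set_nth [::] st r (t :: nth [::] st r))).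
Proof.
rewrite /push_tok -enc_st_set -[enc (t :: _)]/(enc_tok t ++ enc _) -enc_st_nth.
move: (enc_st st) => {}st.
have [a [s ->]] : exists a s, enc_tok t = a :: s.
  case: t => [x|] /=; last by exists (Some false), [::].
  by case: (nat_of_ord (enum_rank x)) => [|m]; eexists; eexists; rewrite /=; reflexivity.
elim: s a => [|b s IH] a //=.
have := IH b; rewrite /= => ->.
by rewrite /= nth_set_nth /= eqxx set_set_nth eqxx.
Qed.

Lemma run_read_elt B r k (x : F) st w i fuel : (i <= enum_rank x)%N ->
    (enum_rank x < fuel + i)%N ->
  nth [::] st r = rcons (nseq (enum_rank x - i) (Some true)) None ++ w ->
  run B (read_elt r i fuel k) st = run B (k x) (set_nth [::] st r w).
Proof.
elim: fuel i st => [|fuel IH] i st lei lt E; first by lia.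
rewrite /= E; case Ex : (enum_rank x - i)%N => [|m] /=.
  by rewrite (_ : i = enum_rank x) ?elt_rank //; lia.
rewrite (IH i.+1) //; try lia.
  by rewrite set_set_nth eqxx.
by rewrite nth_set_nth /= eqxx; have -> : (enum_rank x - i.+1 = m)%N by lia.
Qed.

Lemma run_read_tok B r f t st a s w : enc_tok t = a :: s ->
  run B (read_tok r f a) (set_nth [::] st r (s ++ w)) = run B (f t) (set_nth [::] st r w).
Proof.
case: t => [x|] /=; last by case=> <- <-.
case Ex : (nat_of_ord (enum_rank x)) => [|m] /= [<- <-] /=.
  by rewrite -Ex elt_rank.
have lt : (enum_rank x < #|F|)%N by [].
rewrite (@run_read_elt _ _ _ x _ w) ?Ex //; last 2 first.
- by rewrite -Ex addn1; apply: leqW.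
- by rewrite nth_set_nth /= eqxx subSS subn0.
by rewrite set_set_nth eqxx.
Qed.

Lemma enc_cons t ts : exists a s, enc_tok t = a :: s /\ enc (t :: ts) = a :: (s ++ enc ts).
Proof.
rewrite /enc /=; case: t => [x|] /=; last by exists (Some false), [::].
by case: (nat_of_ord (enum_rank x)) => [|m]; eexists; eexists; split; reflexivity.
Qed.

Lemma run_case B r pe f st :
  run B (case_tok r pe f) (enc_st st) =
  if nth [::] st r is t :: ts then run B (f t) (enc_st (set_nth [::] st r ts))
  else run B pe (enc_st st).
Proof.
rewrite /= enc_st_nth; case: (nth _ _ _) => [|t ts] //=.
have [a [s [Et ->]]] := enc_cons t ts.
by rewrite (run_read_tok _ _ _ _ _ Et) enc_st_set.
Qed.

Lemma run_while B r stop f st : run B (while_tok r stop f) st = tloop B r stop f B st.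
Proof. by []. Qed.

Lemma tloopE B r stop f k st :
  tloop B r stop f k (enc_st st) =
  if nth [::] st r is t :: ts then
    if stop && (t == None) then Some (enc_st (set_nth [::] st r ts))
    else if k is k'.+1 then
      obind (tloop B r stop f k') (run B (f t) (enc_st (set_nth [::] st r ts)))
    else None
  else Some (enc_st st).
Proof.
rewrite /tloop; case: k => [|k] /=; rewrite enc_st_nth; case: (nth _ _ _) => [|t ts] //=.
- have [a [s [Et ->]]] := enc_cons t ts.
  have -> : (a == Some false) = (t == None).
    case: t Et => [x|] /=; last by case=> <-.
    by case: (nat_of_ord (enum_rank x)) => [|m] /= [<-].
  case Es : (stop && _) => //; congr Some.
  case: t Et Es => [x|] /=; first by rewrite andbF.
  by case=> _ <- _; rewrite enc_st_set.
- have [a [s [Et ->]]] := enc_cons t ts.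
  have -> : (a == Some false) = (t == None).
    case: t Et => [x|] /=; last by case=> <-.
    by case: (nat_of_ord (enum_rank x)) => [|m] /= [<-].
  case Es : (stop && _).
    congr Some; case: t Et Es => [x|] /=; first by rewrite andbF.
    by case=> _ <- _; rewrite enc_st_set.
  by rewrite (run_read_tok _ _ _ _ _ Et) enc_st_set.
Qed.

Lemma run_then B p q st st1 : run B p st = Some st1 -> run B (Seq p q) st = run B q st1.
Proof. by move=> E; rewrite run_seq E. Qed.

Lemma wf_push R r t : (r < R)%N -> wf_prog R (push_tok r t).
Proof. by move=> lt; rewrite /push_tok; elim: (enc_tok t) => //= a s ->. Qed.

Lemma wf_read R r f a : (r < R)%N -> (forall t, wf_prog R (f t)) -> wf_prog R (read_tok r f a).
Proof.
move=> lt wf; case: a => [[]|] //=; elim: #|F| 1%N => [|m IH] i /=; rewrite lt ?IH //= !wf //.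
Qed.

Lemma wf_case R r pe f : (r < R)%N -> wf_prog R pe -> (forall t, wf_prog R (f t)) ->
  wf_prog R (case_tok r pe f).
Proof.
move=> lt wpe wf; have H a := wf_read a lt wf.
by apply/and5P; split.
Qed.

Lemma wf_while R r b f : (r < R)%N -> (forall t, wf_prog R (f t)) ->
  wf_prog R (while_tok r b f).
Proof.
move=> lt wf; have H a := wf_read a lt wf.
by apply/and4P; split.
Qed.

End Tokens.

Arguments run : simpl never.
Arguments tloop : simpl never.
Arguments enc_st : simpl never.

(** * Computation of the generators *)

Section Program.
Variable F : finFieldType.
Local Open Scope ring_scope.

Notation token := (option F).
Notation "p ;; q" := (Seq p q) (at level 60, right associativity).

Local Notation while_t := (while_tok (F := F)).
Local Notation case_t := (case_tok (F := F)).

Definition tok_val (t : token) : F := odflt 0 t.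

(** Registers are stacks, so moving a register reverses it; order is restored by a second move or by
    working on reversed vectors. *)
Definition mv s d : prog := while_t s false (fun t => push_tok d t).
Definition clr r : prog := while_t r false (fun _ => Skip).
Definition cp (h : token -> token) s tmp d : prog :=
  mv s tmp ;; while_t tmp false (fun t => push_tok s t ;; push_tok d (h t)).
Definition vec s d : prog := while_t s true (fun t => push_tok d t).
Definition vec2 s d d' : prog :=
  while_t s true (fun t => push_tok d t ;; push_tok d' t).

(** With x, y, u, w in registers 6, 7, 8, 9, each reversed, this pushes the tensor x ⊗ y - u ⊗ w on
    register 4. All products needed for generators and symmetry constraints have this shape. *)
Definition outer_prog : prog :=
  while_t 6 false (fun ta => case_t 8 Skip (fun tc =>
    while_t 7 false (fun tb => push_tok 10 tb ;;
      case_t 9 Skip (fun td => push_tok 11 td ;;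
        push_tok 4 (Some (tok_val ta * tok_val tb - tok_val tc * tok_val td)))) ;;
    mv 10 7 ;; mv 11 9)).

Definition step_prog prep : prog :=
  vec2 12 7 13 ;; push_tok 13 (@None F) ;; prep ;; cp id 5 3 6 ;;
  push_tok 4 (@None F) ;; outer_prog ;; clr 7 ;; clr 9.

(** The popped token only tests for emptiness; it is put back because the body consumes a whole
    vector. *)
Definition each r body : prog := while_t r false (fun t => push_tok r t ;; body).

(** With x in register 5 and y in register 7, the three preparations make [step_prog] produce x ⊗ y,
    x ⊗ y - y ⊗ x and x ⊗ x - x ⊗ y respectively. *)
Definition prep_expand : prog := cp (fun=> Some 0) 7 3 9 ;; cp id 5 3 8.
Definition prep_sym : prog := cp id 5 3 9 ;; cp id 7 3 8.
Definition prep_bool : prog := cp id 7 3 9 ;; clr 7 ;; cp id 5 3 7 ;; cp id 5 3 8.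

Definition expand_prog : prog :=
  each 0 (vec 0 5 ;; each 12 (step_prog prep_expand) ;; mv 13 12 ;; clr 5) ;; mv 4 3 ;; mv 3 0.

(** The single extra step after the inner loop meets the first vector of register 12, the unit
    vector of letter 0, and so yields the constraint x_i^2 - x_i x_0. *)
Definition sym_prog : prog :=
  each 0 (vec 0 5 ;; each 12 (step_prog prep_sym) ;; mv 13 12 ;;
          step_prog prep_bool ;; mv 13 12 ;; clr 5).

(** Registers 1 and 2 hold in unary the index of the row and the number of entries to the right of
    its diagonal. One program serves twice: with no coefficients and 1 on the diagonal it writes
    unit vectors, with coefficients and 0 on the diagonal the rows of a strictly upper triangular
    matrix. *)
Definition row_prog pre (mid : F) : prog :=
  pre ;;
  while_t 2 false (fun t => push_tok 3 t ;;
    case_t 5 (push_tok 4 (Some (0 : F))) (fun c => push_tok 4 c)) ;; mv 3 2 ;;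
  push_tok 4 (Some mid) ;;
  while_t 1 false (fun t => push_tok 3 t ;; push_tok 4 (Some (0 : F))) ;; mv 3 1.

Definition rows_prog pre mid : prog :=
  row_prog pre mid ;;
  while_t 1 false (fun t => push_tok 2 t ;; row_prog pre mid) ;; mv 2 1.

(** The constant coefficient is the last one left in the reversed list; it replaces the corner
    entry, since the constant is homogenised to a multiple of x_0^2. *)
Definition poly_prog : prog :=
  each 0 (vec 0 5 ;; push_tok 4 (@None F) ;; rows_prog Skip 0 ;;
    case_t 4 Skip (fun _ => case_t 5 Skip (fun c => push_tok 4 c))).

Definition constraints_prog : prog :=
  rows_prog (push_tok 4 (@None F)) 1 ;; mv 4 3 ;; mv 3 12 ;;
  poly_prog ;; cp id 12 3 0 ;; sym_prog ;; mv 4 3 ;; mv 3 14 ;; cp id 12 3 0 ;;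
  push_tok 16 (Some (0 : F)).

(** The generator is cut into blocks of the length of the constraint in register 7. Register 16
    accumulates the product with the current block, and register 17 gets one mark per block: these
    marks later count the elimination rounds. *)
Definition contract_prog : prog :=
  while_t 6 false (fun ta => case_t 7 Skip (fun tb =>
    push_tok 10 tb ;;
    case_t 16 Skip (fun tc => push_tok 16 (Some (tok_val tc + tok_val tb * tok_val ta))) ;;
    case_t 7
      (mv 10 7 ;; case_t 16 Skip (fun tv => push_tok 4 tv) ;;
       push_tok 16 (Some (0 : F)) ;; push_tok 17 (@None F))
      (fun t => push_tok 7 t))).

Definition augment_prog : prog :=
  each 0 (clr 17 ;; vec 0 5 ;; cp id 5 3 6 ;; push_tok 4 (@None F) ;; mv 5 4 ;; contract_prog) ;;
  mv 4 3 ;; mv 3 0.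

Definition pivot_prog : prog :=
  while_t 0 false (fun t => push_tok 0 t ;; vec 0 5 ;;
    (if tok_val t != 0 then clr 8 ;; cp id 5 3 6 ;; mv 6 8 else Skip) ;;
    push_tok 4 (@None F) ;; mv 5 4).

Definition sub_prog (s : F) : prog :=
  while_t 4 true (fun ta => case_t 8 (push_tok 6 ta) (fun tb =>
    push_tok 9 tb ;; push_tok 6 (Some (tok_val ta - s * tok_val tb)))).

Definition reduce_prog : prog :=
  while_t 4 false (fun tu => case_t 8
    (sub_prog 0 ;; push_tok 0 (@None F) ;; mv 6 0)
    (fun tp => sub_prog (tok_val tu / tok_val tp) ;; push_tok 0 (@None F) ;; mv 6 0 ;;
       mv 9 8 ;; push_tok 8 tp)).

Definition round_prog : prog := pivot_prog ;; reduce_prog ;; clr 8.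

Definition elim_prog : prog :=
  each 14 (vec2 14 7 15 ;; push_tok 15 (@None F) ;; augment_prog ;;
    while_t 17 false (fun _ => round_prog) ;; clr 7) ;; mv 15 14.

Definition iter_prog : prog := expand_prog ;; elim_prog.

(** End marks are counted, hence generators: at the moment of the call there are as many of them as
    the output matrices have rows. *)
Definition count_prog : prog :=
  while_t 0 false (fun t =>
    (if t is None then push_tok 20 (@None F) else Skip) ;; push_tok 3 t) ;; mv 3 0.

(* Register 0 holds the generators, 1 and 20 the number of variables and the size of
   the matrices in unary, 12 the unit vectors, 14 the constraints, 13 and 15 the already
   processed parts of 12 and 14, 18 and 19 the numbers of iterations left before and
   after the matrix size is read off; the other registers are work space. *)
Definition main_prog : prog :=
  constraints_prog ;; while_t 18 false (fun _ => iter_prog) ;; count_prog ;;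
  while_t 19 false (fun _ => iter_prog).

(** * Correctness of the basic register operations *)

Variable B : nat.

Definition ev (v : seq F) : seq token := rcons (map Some v) None.
Definition eG (G : seq (seq F)) : seq token := flatten (map ev G).

Lemma eG_cat G1 G2 : eG (G1 ++ G2) = eG G1 ++ eG G2.
Proof. by rewrite /eG map_cat flatten_cat. Qed.

Lemma eG_cons v G : eG (v :: G) = ev v ++ eG G. Proof. by []. Qed.

(** The loop rule behind all specifications: if the registers are a function [I] of the unread items
    and of an accumulator, the loop computes a left fold. [fin] is separate from [I [::]] because a
    loop over a single vector also pops the end mark. *)
Lemma while_fold X A (P : seq X -> A -> Prop) (I : seq X -> A -> seq (seq token))
    (step : A -> X -> A) (fin : A -> seq (seq token)) r stop f xs a :
  (size xs <= B)%N -> P xs a ->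
  (forall k a, P [::] a -> tloop B r stop f k (enc_st (I [::] a)) = Some (enc_st (fin a))) ->
  (forall k x xs a, P (x :: xs) a -> P xs (step a x) /\
     tloop B r stop f k.+1 (enc_st (I (x :: xs) a)) = tloop B r stop f k (enc_st (I xs (step a x)))) ->
  run B (while_t r stop f) (enc_st (I xs a)) = Some (enc_st (fin (foldl step a xs))).
Proof.
move=> lex Px Hend Hstep; rewrite run_while.
elim: xs a {-2}B lex Px => [|x xs IH] a k; first by move=> _; apply: Hend.
by case: k => // k lek /(Hstep k)[Px' ->]; exact: IH.
Qed.

Lemma tloop_body r stop f k (st st' : seq (seq token)) t ts : nth [::] st r = t :: ts ->
    stop && (t == None) = false ->
    run B (f t) (enc_st (set_nth [::] st r ts)) = Some (enc_st st') ->
  tloop (F := F) B r stop f k.+1 (enc_st st) = tloop B r stop f k (enc_st st').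
Proof. by move=> E Es H; rewrite tloopE E Es H. Qed.

Lemma tloop_end r stop f k (st : seq (seq token)) : nth [::] st r = [::] ->
  tloop (F := F) B r stop f k (enc_st st) = Some (enc_st st).
Proof. by move=> E; rewrite tloopE E. Qed.

Lemma tloop_stop r f k (st : seq (seq token)) ts : nth [::] st r = None :: ts ->
  tloop (F := F) B r true f k (enc_st st) = Some (enc_st (set_nth [::] st r ts)).
Proof. by move=> E; rewrite tloopE E. Qed.

Lemma set_nth2 (st : seq (seq token)) i j v w :
  i != j -> set_nth [::] (set_nth [::] st i v) j w = set_nth [::] (set_nth [::] st j w) i v.
Proof. by move=> ne; rewrite set_set_nth (negPf ne). Qed.

Lemma set_nth_eq (st : seq (seq token)) i v w :
  set_nth [::] (set_nth [::] st i v) i w = set_nth [::] st i w.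
Proof. by rewrite set_set_nth eqxx. Qed.

Lemma set_nth_id (st : seq (seq token)) i : (i < size st)%N -> set_nth [::] st i (nth [::] st i) = st.
Proof.
move=> lt; apply: (@eq_from_nth _ [::]); first by rewrite size_set_nth; apply/maxn_idPr.
by move=> j _; rewrite nth_set_nth /=; case: eqP => [->|].
Qed.

Lemma nth_set_eq (st : seq (seq token)) i v : nth [::] (set_nth [::] st i v) i = v.
Proof. by rewrite nth_set_nth /= eqxx. Qed.

Lemma nth_set_neq (st : seq (seq token)) i j v : i != j ->
  nth [::] (set_nth [::] st i v) j = nth [::] st j.
Proof. by move=> ne; rewrite nth_set_nth /= eq_sym (negPf ne). Qed.

Lemma run_mv s d (st : seq (seq token)) : s != d -> (s < size st)%N -> (d < size st)%N ->
    (size (nth [::] st s) <= B)%N ->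
  run B (mv s d) (enc_st st) =
  Some (enc_st (set_nth [::] (set_nth [::] st s [::]) d (rev (nth [::] st s) ++ nth [::] st d))).
Proof.
move=> ne lts ltd le.
pose I ts a := set_nth [::] (set_nth [::] st s ts) d a.
have nI ts a : nth [::] (I ts a) s = ts by rewrite /I nth_set_neq 1?eq_sym // nth_set_eq.
have nId ts a : nth [::] (I ts a) d = a by rewrite /I nth_set_eq.
have {1}-> : st = I (nth [::] st s) (nth [::] st d) by rewrite /I !set_nth_id.
have -> : rev (nth [::] st s) ++ nth [::] st d =
   foldl (fun a t => t :: a) (nth [::] st d) (nth [::] st s).
  by elim: (nth _ st s) (nth _ st d) => //= t l IH a; rewrite -IH rev_cons cat_rcons.
apply: (while_fold (P := fun _ _ => True) (I := I) (fin := I [::])) => //.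
- by move=> k a _; apply: tloop_end; rewrite nI.
- move=> k t ts a _; split=> //; apply: tloop_body; first by rewrite nI.
    by [].
  have -> : set_nth [::] (I (t :: ts) a) s ts = I ts a.
    by rewrite /I set_nth2 1?eq_sym // set_nth_eq.
  by rewrite run_push nId /I set_nth_eq.
Qed.

Lemma run_clr r (st : seq (seq token)) : (r < size st)%N -> (size (nth [::] st r) <= B)%N ->
  run B (clr r) (enc_st st) = Some (enc_st (set_nth [::] st r [::])).
Proof.
move=> lt le; pose I ts (a : unit) := set_nth [::] st r ts.
have nI ts a : nth [::] (I ts a) r = ts by rewrite /I nth_set_eq.
have {1}-> : st = I (nth [::] st r) tt by rewrite /I set_nth_id.
rewrite -[set_nth _ _ _ _]/(I [::] (foldl (fun a _ => a) tt (nth [::] st r))).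
apply: (while_fold (P := fun _ _ => True) (I := I) (fin := I [::])) => //.
- by move=> k a _; apply: tloop_end; rewrite nI.
- move=> k t ts a _; split=> //; apply: tloop_body; first by rewrite nI.
    by [].
  by rewrite run_skip /I set_nth_eq.
Qed.

Lemma foldl_cons_map (X Y : Type) (h : X -> Y) l a :
  foldl (fun a t => h t :: a) a l = map h (rev l) ++ a.
Proof. by elim: l a => //= t l IH a; rewrite IH rev_cons map_rcons cat_rcons. Qed.

Lemma run_cp h s tmp d (st : seq (seq token)) : uniq [:: s; tmp; d] ->
    (s < size st)%N -> (tmp < size st)%N -> (d < size st)%N -> nth [::] st tmp = [::] ->
    (size (nth [::] st s) <= B)%N ->
  run B (cp h s tmp d) (enc_st st) =
  Some (enc_st (set_nth [::] st d (map h (nth [::] st s) ++ nth [::] st d))).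
Proof.
rewrite [uniq _]/= !inE negb_or andbT => /andP[/andP[st_ne sd_ne] td_ne] lts ltt ltd tmp0 le.
rewrite /cp (run_then _ (run_mv _ _ _ _)) // tmp0 cats0.
pose I ts a := set_nth [::] (set_nth [::] (set_nth [::] st tmp ts) s a.1) d a.2.
have nt ts a : nth [::] (I ts a) tmp = ts.
  by rewrite /I nth_set_neq 1?eq_sym // nth_set_neq // nth_set_eq.
have ns ts a : nth [::] (I ts a) s = a.1.
  by rewrite /I nth_set_neq 1?eq_sym // nth_set_eq.
have nd ts a : nth [::] (I ts a) d = a.2 by rewrite /I nth_set_eq.
have -> : set_nth [::] (set_nth [::] st s [::]) tmp (rev (nth [::] st s)) =
   I (rev (nth [::] st s)) ([::], nth [::] st d).
  rewrite /I /= set_nth2 //.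
  set st1 := set_nth [::] (set_nth _ _ _ _) _ _.
  have -> : nth [::] st d = nth [::] st1 d.
    by rewrite /st1 !nth_set_neq.
  by rewrite set_nth_id // /st1 !size_set_nth !leq_max ltd !orbT.
rewrite (while_fold (P := fun _ _ => True) (I := I)
   (step := fun a t => (t :: a.1, h t :: a.2)) (fin := I [::])) //.
- have -> l a : foldl (fun a t => (t :: a.1, h t :: a.2)) a l =
     (foldl (fun a t => t :: a) a.1 l, foldl (fun a t => h t :: a) a.2 l).
    by elim: l a => [|t l IH] [a1 a2] //=; rewrite IH.
  rewrite !foldl_cons_map revK map_id cats0 /I /=; congr (Some (enc_st (set_nth _ _ _ _))).
  by have := set_nth_id ltt; rewrite tmp0 => ->; rewrite set_nth_id.
- by rewrite size_rev.
- by move=> k a _; apply: tloop_end; rewrite nt.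
- move=> k t ts a _; split=> //; apply: tloop_body; first by rewrite nt.
    by [].
  have -> : set_nth [::] (I (t :: ts) a) tmp ts = I ts a.
    rewrite /I set_nth2 1?eq_sym // [set_nth [::] (set_nth [::] _ s _) tmp _]set_nth2 //.
    by rewrite set_nth_eq.
  rewrite (run_then _ (run_push _ _ _ _)) ns run_push.
  rewrite nth_set_neq // nd /I.
  by rewrite [set_nth [::] (set_nth [::] _ d _) s _]set_nth2 1?eq_sym // !set_nth_eq.
Qed.

Lemma foldl_cons_rev (X Y : Type) (h : X -> Y) l a :
  foldl (fun a t => h t :: a) a l = rev (map h l) ++ a.
Proof. by rewrite foldl_cons_map map_rev. Qed.

Lemma run_vec s d (st : seq (seq token)) v rest : s != d -> (s < size st)%N -> (d < size st)%N ->
    nth [::] st s = ev v ++ rest -> (size v <= B)%N ->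
  run B (vec s d) (enc_st st) =
  Some (enc_st (set_nth [::] (set_nth [::] st s rest) d (rev (map Some v) ++ nth [::] st d))).
Proof.
move=> ne lts ltd Es le.
pose I (v : seq F) a := set_nth [::] (set_nth [::] st s (ev v ++ rest)) d a.
have nI ts a : nth [::] (I ts a) s = ev ts ++ rest.
  by rewrite /I nth_set_neq 1?eq_sym // nth_set_eq.
have nId ts a : nth [::] (I ts a) d = a by rewrite /I nth_set_eq.
have {1}-> : st = I v (nth [::] st d) by rewrite /I -Es !set_nth_id.
rewrite -foldl_cons_rev.
apply: (while_fold (P := fun _ _ => True) (I := I)
  (fin := fun a => set_nth [::] (set_nth [::] st s rest) d a)) => //.
- move=> k a _; rewrite (@tloop_stop _ _ _ _ rest); last by rewrite nI.
  by rewrite /I set_nth2 1?eq_sym // set_nth_eq.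
- move=> k t ts a _; split=> //; apply: tloop_body; first by rewrite nI.
    by rewrite andbF.
  have -> : set_nth [::] (I (t :: ts) a) s (ev ts ++ rest) = I ts a.
    by rewrite /I set_nth2 1?eq_sym // set_nth_eq.
  by rewrite run_push nId /I set_nth_eq.
Qed.

Lemma run_vec2 s d d' (st : seq (seq token)) v rest : uniq [:: s; d; d'] ->
    (s < size st)%N -> (d < size st)%N -> (d' < size st)%N ->
    nth [::] st s = ev v ++ rest -> (size v <= B)%N ->
  run B (vec2 s d d') (enc_st st) =
  Some (enc_st (set_nth [::] (set_nth [::] (set_nth [::] st s rest)
     d (rev (map Some v) ++ nth [::] st d)) d' (rev (map Some v) ++ nth [::] st d'))).
Proof.
rewrite [uniq _]/= !inE negb_or andbT => /andP[/andP[sd sd'] dd'] lts ltd ltd' Es le.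
pose I (v : seq F) a := set_nth [::] (set_nth [::] (set_nth [::] st s (ev v ++ rest)) d a.1) d' a.2.
have nI ts a : nth [::] (I ts a) s = ev ts ++ rest.
  by rewrite /I nth_set_neq 1?eq_sym // nth_set_neq 1?eq_sym // nth_set_eq.
have nd ts a : nth [::] (I ts a) d = a.1 by rewrite /I nth_set_neq 1?eq_sym // nth_set_eq.
have nd' ts a : nth [::] (I ts a) d' = a.2 by rewrite /I nth_set_eq.
have {1}-> : st = I v (nth [::] st d, nth [::] st d') by rewrite /I -Es !set_nth_id.
have Is w a ts : set_nth [::] (I w a) s ts =
    set_nth [::] (set_nth [::] (set_nth [::] st s ts) d a.1) d' a.2.
  rewrite /I set_nth2 1?eq_sym // [set_nth [::] (set_nth [::] _ d _) s _]set_nth2 1?eq_sym //.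
  by rewrite set_nth_eq.
have Efold l a : foldl (fun a t => (Some t :: a.1, Some t :: a.2)) a l =
   (rev (map Some l) ++ a.1, rev (map Some l) ++ a.2) :> seq token * seq token.
  elim: l a => [|t l IH] [a1 a2] //=; first by rewrite IH !rev_cons !cat_rcons.
rewrite (while_fold (P := fun _ _ => True) (I := I)
  (step := fun a t => (Some t :: a.1, Some t :: a.2))
  (fin := fun a => set_nth [::] (set_nth [::] (set_nth [::] st s rest) d a.1) d' a.2)) //.
- by rewrite Efold.
- by move=> k a _; rewrite (@tloop_stop _ _ _ _ rest) ?Is // nI.
- move=> k t ts a _; split=> //; apply: tloop_body; first by rewrite nI.
    by rewrite andbF.
  rewrite Is -[set_nth [::] _ d' _]/(I ts a).
  rewrite (run_then _ (run_push _ _ _ _)) nd run_push nth_set_neq // nd' /I.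
  by rewrite [set_nth [::] (set_nth [::] _ d' _) d _]set_nth2 1?eq_sym // !set_nth_eq.
Qed.

(** The tensor x ⊗ y - u ⊗ w in row-major order. *)
Definition outerd (x y u w : seq F) : seq F :=
  flatten [seq [seq p.1 * q.1 - p.2 * q.2 | q <- zip y w] | p <- zip x u].

Definition rs (v : seq F) : seq token := rev (map Some v).

(** * Tensor products: expansion of generators and symmetry constraints *)

Section Specs.
Variables (l r b b' k k' a c e1 e2 nn : seq token).

Local Notation St g t o x0 x y u w y' w' bs bs' :=
  [:: g; l; r; t; o; x0; x; y; u; w; y'; w'; bs; bs'; k; k'; a; c; e1; e2; nn].

Lemma rs_rcons v x : rs (rcons v x) = Some x :: rs v.
Proof. by rewrite /rs map_rcons rev_rcons. Qed.

Lemma size_rs v : size (rs v) = size v. Proof. by rewrite size_rev size_map. Qed.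

Lemma map_rs v : rev (rs v) = map Some v. Proof. exact: revK. Qed.

Lemma foldl_cat_rev (X Y : Type) (h : X -> seq Y) ps s :
  foldl (fun s p => h p ++ s) s (rev ps) = flatten (map h ps) ++ s.
Proof.
elim/last_ind: ps s => [|ps p IH] s //=.
by rewrite rev_rcons /= IH map_rcons -cats1 flatten_cat /= cats0 catA.
Qed.

Lemma zip_unzip_rs (v w : seq F) : size w = size v ->
  rs v = map (fun p => Some p.1) (rev (zip v w)) /\
  rs w = map (fun p => Some p.2) (rev (zip v w)).
Proof.
move=> sz; have le : (size v <= size w)%N by rewrite sz.
have ge : (size w <= size v)%N by rewrite sz.
by split; rewrite /rs map_rev; congr rev;
  [rewrite -{1}(unzip1_zip le) | rewrite -{1}(unzip2_zip ge)]; rewrite -map_comp.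
Qed.

Lemma run_outer_row g t x0 x u y w o bs bs' (ta tc : token) :
  size w = size y -> (size y <= B)%N ->
  run B (while_t 7 false (fun tb => push_tok 10 tb ;;
      case_t 9 Skip (fun td => push_tok 11 td ;;
        push_tok 4 (Some (tok_val ta * tok_val tb - tok_val tc * tok_val td)))) ;;
    mv 10 7 ;; mv 11 9) (enc_st (St g t o x0 x (rs y) u (rs w) [::] [::] bs bs')) =
  Some (enc_st (St g t (map Some [seq tok_val ta * q.1 - tok_val tc * q.2 | q <- zip y w] ++ o)
     x0 x (rs y) u (rs w) [::] [::] bs bs')).
Proof.
move=> szw ley; have [Ey Ew] := zip_unzip_rs szw.
have szz : size (zip y w) = size y by apply: size1_zip; rewrite szw.
pose I (ps : seq (F * F)) (z : seq token * seq token * seq token) :=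
  St g t z.2 x0 x (map (fun p => Some p.1) ps) u (map (fun p => Some p.2) ps) z.1.1 z.1.2 bs bs'.
pose step (z : seq token * seq token * seq token) (p : F * F) :=
  (Some p.1 :: z.1.1, Some p.2 :: z.1.2, Some (tok_val ta * p.1 - tok_val tc * p.2) :: z.2).
have Efold z ps : foldl step z ps = (map (fun p => Some p.1) (rev ps) ++ z.1.1,
   map (fun p => Some p.2) (rev ps) ++ z.1.2,
   map (fun p => Some (tok_val ta * p.1 - tok_val tc * p.2)) (rev ps) ++ z.2).
  elim: ps z => [|p ps IH] [[z1 z2] z3] //=.
  by rewrite IH rev_cons !map_rcons !cat_rcons.
rewrite Ey Ew -[St _ _ _ _ _ _ _ _ _ _ _ _]/(I (rev (zip y w)) ([::], [::], o)).
rewrite (run_then _ (while_fold (step := step) (fin := I [::])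
  (P := fun _ _ => True) _ _ _ _)) //; first last.
- move=> m p ps z _; split=> //; apply: tloop_body; [by [] | by [] |].
  by rewrite /I /= (run_then _ (run_push _ _ _ _)) /= run_case /=
    (run_then _ (run_push _ _ _ _)) /= run_push.
- by move=> m z _; apply: tloop_end.
- by rewrite size_rev szz.
rewrite Efold revK /I /= !cats0 (run_then _ (run_mv _ _ _ _)) //= ?size_map ?szz //.
rewrite run_mv //= ?size_map ?szz // !cats0 -!map_rev.
by rewrite -map_comp.
Qed.

Lemma run_outer g x0 x y u w o bs bs' :
  size u = size x -> size w = size y -> (size x <= B)%N -> (size y <= B)%N ->
  run B outer_prog (enc_st (St g [::] o x0 (rs x) (rs y) (rs u) (rs w) [::] [::] bs bs')) =
  Some (enc_st (St g [::] (map Some (outerd x y u w) ++ o) x0 [::] (rs y) [::] (rs w) [::] [::] bs bs')).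
Proof.
move=> szu szw lex ley; have [Ex Eu] := zip_unzip_rs szu.
have szz : size (zip x u) = size x by apply: size1_zip; rewrite szu.
pose I (ps : seq (F * F)) (z : seq token) :=
  St g [::] z x0 (map (fun p => Some p.1) ps) (rs y) (map (fun p => Some p.2) ps) (rs w)
    [::] [::] bs bs'.
pose step (z : seq token) (p : F * F) :=
  map Some [seq p.1 * q.1 - p.2 * q.2 | q <- zip y w] ++ z.
rewrite Ex Eu -[St _ _ _ _ _ _ _ _ _ _ _ _]/(I (rev (zip x u)) o).
rewrite (while_fold (step := step) (fin := I [::]) (P := fun _ _ => True)) //; first last.
- move=> m p ps z _; split=> //; apply: tloop_body; [by [] | by [] |].
  by rewrite run_case; apply: (@run_outer_row _ _ _ _ _ _ _ _ _ _ (Some p.1) (Some p.2)).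
- by move=> m z _; apply: tloop_end.
- by rewrite size_rev szz.
by rewrite /step foldl_cat_rev /I /= /outerd map_flatten -map_comp.
Qed.

Lemma run_each X A (P : seq X -> A -> Prop) (I : seq X -> A -> seq (seq token))
    (step : A -> X -> A) i body xs z :
  (size xs <= B)%N -> P xs z ->
  (forall z, P [::] z -> nth [::] (I [::] z) i = [::]) ->
  (forall v vs z, P (v :: vs) z -> [/\ P vs (step z v), (i < size (I (v :: vs) z))%N,
     nth [::] (I (v :: vs) z) i <> [::] &
     run B body (enc_st (I (v :: vs) z)) = Some (enc_st (I vs (step z v)))]) ->
  run B (each i body) (enc_st (I xs z)) = Some (enc_st (I [::] (foldl step z xs))).
Proof.
move=> le Pz Hend Hstep; apply: (while_fold (P := P)) => //.
- by move=> m z' Pz'; apply: tloop_end; exact: Hend.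
- move=> m v vs z' /Hstep[P' lt ne runb]; split=> //.
  case E : (nth [::] (I (v :: vs) z') i) => [|t ts] //.
  apply: (tloop_body _ E) => //.
  rewrite (run_then _ (run_push _ _ _ _)) nth_set_eq set_nth_eq -E set_nth_id //.
Qed.

Lemma rev_ev v : rev (ev v) = None :: rs v. Proof. by rewrite /ev rev_rcons. Qed.

Lemma size_ev v : size (ev v) = (size v).+1. Proof. by rewrite size_rcons size_map. Qed.

Lemma ev_cat v s : ev v ++ s = map Some v ++ None :: s. Proof. by rewrite cat_rcons. Qed.

Definition prep_spec prep x y y1 u1 w1 := forall g o bs bs',
  run B prep (enc_st (St g [::] o (rs x) [::] (rs y) [::] [::] [::] [::] bs bs')) =
  Some (enc_st (St g [::] o (rs x) [::] (rs y1) (rs u1) (rs w1) [::] [::] bs bs')).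

Lemma prep_expandP x y : (size x <= B)%N -> (size y <= B)%N ->
  prep_spec prep_expand x y y x (nseq (size y) 0).
Proof.
move=> lex ley g o bs bs'; rewrite /prep_expand (run_then _ (run_cp _ _ _ _ _ _ _)) //= ?size_rs //.
rewrite run_cp //= ?size_rs // !cats0 map_id; congr (Some (enc_st (St _ _ _ _ _ _ _ _ _ _ _ _))).
have -> : rs (nseq (size y) 0) = nseq (size (rs y)) (Some 0).
  by rewrite size_rs /rs map_nseq rev_nseq.
by elim: (rs y) => //= _ s ->.
Qed.

Lemma prep_symP x y : (size x <= B)%N -> (size y <= B)%N -> prep_spec prep_sym x y y y x.
Proof.
move=> lex ley g o bs bs'; rewrite /prep_sym (run_then _ (run_cp _ _ _ _ _ _ _)) //= ?size_rs //.
by rewrite run_cp //= ?size_rs // !cats0 !map_id.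
Qed.

Lemma prep_boolP x y : (size x <= B)%N -> (size y <= B)%N -> prep_spec prep_bool x y x x y.
Proof.
move=> lex ley g o bs bs'; rewrite /prep_bool (run_then _ (run_cp _ _ _ _ _ _ _)) //= ?size_rs //.
rewrite (run_then _ (run_clr _ _)) //= ?size_rs //.
rewrite (run_then _ (run_cp _ _ _ _ _ _ _)) //= ?size_rs //.
by rewrite run_cp //= ?size_rs // !cats0 !map_id.
Qed.

Lemma run_step prep x y y1 u1 w1 g o bs bs' : prep_spec prep x y y1 u1 w1 ->
  size u1 = size x -> size w1 = size y1 ->
  (size x <= B)%N -> (size y <= B)%N -> (size y1 <= B)%N ->
  run B (step_prog prep)
    (enc_st (St g [::] o (rs x) [::] [::] [::] [::] [::] [::] (ev y ++ bs) bs')) =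
  Some (enc_st (St g [::] (ev (outerd x y1 u1 w1) ++ o) (rs x)
     [::] [::] [::] [::] [::] [::] bs (rev (ev y) ++ bs'))).
Proof.
move=> Hprep szu szw lex ley ley1; rewrite /step_prog.
rewrite (run_then _ (@run_vec2 12 7 13 _ y bs _ _ _ _ _ _)) //= cats0.
rewrite (run_then _ (run_push _ _ _ _)) /= (run_then _ (Hprep _ _ _ _)).
rewrite (run_then _ (run_cp _ _ _ _ _ _ _)) //= ?size_rs // cats0 map_id.
rewrite (run_then _ (run_push _ _ _ _)) /= (run_then _ (run_outer _ _ _ _ _ _ _ _ _)) //.
rewrite (run_then _ (run_clr _ _)) //= ?size_rs //.
by rewrite run_clr //= ?size_rs ?szw // rev_ev ev_cat.
Qed.

Lemma eG_rev_flatten X (h : X -> seq (seq F)) xs o :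
  foldl (fun o x => eG (rev (h x)) ++ o) o xs = eG (rev (flatten (map h xs))) ++ o.
Proof. by elim: xs o => //= x xs IH o; rewrite IH rev_cat eG_cat catA. Qed.

Lemma eG_rev_map X (h : X -> seq F) xs o :
  foldl (fun o x => ev (h x) ++ o) o xs = eG (rev (map h xs)) ++ o.
Proof. by elim: xs o => //= x xs IH o; rewrite IH rev_cons -cats1 eG_cat -catA /eG /= cats0. Qed.

Lemma rev_eG ys bs : foldl (fun s y => rev (ev y) ++ s) bs ys = rev (eG ys) ++ bs.
Proof. by elim: ys bs => //= y ys IH bs; rewrite IH eG_cons rev_cat catA. Qed.

Lemma run_each_step prep x (y1 u1 w1 : seq F -> seq F) ys g o bs' :
  (size ys <= B)%N -> (size x <= B)%N ->
  (forall y, y \in ys -> [/\ prep_spec prep x y (y1 y) (u1 y) (w1 y),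
     size (u1 y) = size x, size (w1 y) = size (y1 y), (size y <= B)%N & (size (y1 y) <= B)%N]) ->
  run B (each 12 (step_prog prep))
    (enc_st (St g [::] o (rs x) [::] [::] [::] [::] [::] [::] (eG ys) bs')) =
  Some (enc_st (St g [::] (eG (rev [seq outerd x (y1 y) (u1 y) (w1 y) | y <- ys]) ++ o) (rs x)
     [::] [::] [::] [::] [::] [::] [::] (rev (eG ys) ++ bs'))).
Proof.
move=> leys lex Hys.
pose I ys (z : seq token * seq token) :=
  St g [::] z.1 (rs x) [::] [::] [::] [::] [::] [::] (eG ys) z.2.
pose step (z : seq token * seq token) y :=
  (ev (outerd x (y1 y) (u1 y) (w1 y)) ++ z.1, rev (ev y) ++ z.2).
rewrite -[St _ _ _ _ _ _ _ _ _ _ _ _]/(I ys (o, bs')).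
rewrite (run_each (step := step) (P := fun ys' _ => {subset ys' <= ys})) //; last first.
  move=> y ys' z sub; split=> //.
  - by move=> v vin; apply: sub; rewrite inE vin orbT.
  - by rewrite /= eG_cons ev_cat; case: (y).
  - have [Hp szu szw ley ley1] := Hys _ (sub y (mem_head _ _)).
    by rewrite /I eG_cons (run_step _ _ _ _ Hp).
have Efold z : foldl step z ys = (eG (rev [seq outerd x (y1 y) (u1 y) (w1 y) | y <- ys]) ++ z.1,
   rev (eG ys) ++ z.2).
  rewrite -eG_rev_map -rev_eG; by elim: (ys) z => [|y ys' IH] [z1 z2] //=.
by rewrite Efold.
Qed.

Lemma size_eG G : size (eG G) = (sumn (map size G) + size G)%N.
Proof. by elim: G => //= v G IH; rewrite eG_cons size_cat IH size_ev; lia. Qed.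

Lemma size_le_eG (v : seq F) G : v \in G -> (size v <= size (eG G))%N.
Proof.
move=> vin; rewrite size_eG; apply: leq_trans (leq_addr _ _).
by elim: G vin => //= w G IH; rewrite inE => /orP[/eqP->|/IH]; lia.
Qed.

Definition expand (Bs G : seq (seq F)) : seq (seq F) :=
  rev (flatten [seq [seq outerd x y x (nseq (size y) 0) | y <- Bs] | x <- G]).

Lemma run_expand_body x ys gs o :
  (size (eG ys) <= B)%N -> (size x <= B)%N ->
  run B (vec 0 5 ;; each 12 (step_prog prep_expand) ;; mv 13 12 ;; clr 5)
   (enc_st (St (ev x ++ gs) [::] o [::] [::] [::] [::] [::] [::] [::] (eG ys) [::])) =
  Some (enc_st (St gs [::] (eG (rev [seq outerd x y x (nseq (size y) 0) | y <- ys]) ++ o) [::]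
     [::] [::] [::] [::] [::] [::] (eG ys) [::])).
Proof.
move=> leG lex.
have leys y : y \in ys -> (size y <= B)%N by move/size_le_eG => /leq_trans; apply.
rewrite (run_then _ (@run_vec 0 5 _ x gs _ _ _ _ _)) //= cats0.
rewrite (run_then _ (run_each_step (y1 := id) (u1 := fun=> x) (w1 := fun y => nseq (size y) 0)
  _ _ _ _ _ _)) //; first last.
- by move=> y /leys ley; split; rewrite ?size_nseq //; exact: prep_expandP.
- by apply: leq_trans leG; rewrite size_eG leq_addl.
rewrite cats0 (run_then _ (run_mv _ _ _ _)) //= ?size_rev // revK cats0.
by rewrite run_clr //= size_rs.
Qed.

Lemma run_expand ys G :
  (size (eG ys) <= B)%N -> (size (eG G) <= B)%N -> (size (eG (expand ys G)) <= B)%N ->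
  run B expand_prog (enc_st (St (eG G) [::] [::] [::] [::] [::] [::] [::] [::] [::] (eG ys) [::])) =
  Some (enc_st (St (eG (expand ys G)) [::] [::] [::] [::] [::] [::] [::] [::] [::] (eG ys) [::])).
Proof.
move=> leys leG leE; rewrite /expand_prog.
pose I G o := St (eG G) [::] o [::] [::] [::] [::] [::] [::] [::] (eG ys) [::].
pose step o x := eG (rev [seq outerd x y x (nseq (size y) 0) | y <- ys]) ++ o.
rewrite -[St _ _ _ _ _ _ _ _ _ _ _ _]/(I G [::]).
rewrite (run_then _ (run_each (step := step) (P := fun G' _ => {subset G' <= G}) _ _ _ _)) //; first last.
- move=> x G' o sub; split=> //.
  + by move=> v vin; apply: sub; rewrite inE vin orbT.
  + by rewrite /= eG_cons ev_cat; case: (x).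
  + rewrite /I eG_cons run_expand_body //.
    by apply: leq_trans leG; apply: size_le_eG; apply: sub; rewrite mem_head.
- by apply: leq_trans leG; rewrite size_eG leq_addl.
rewrite /step eG_rev_flatten -/(expand ys G) cats0 /I.
rewrite (run_then _ (run_mv _ _ _ _)) //= cats0 run_mv //= ?size_rev //.
by rewrite revK cats0.
Qed.

Definition sym_constraints (e0 : seq F) (Bs : seq (seq F)) : seq (seq F) :=
  rev (flatten [seq rcons [seq outerd x y y x | y <- Bs] (outerd x x x e0) | x <- Bs]).

Lemma run_sym_body x e0 ys gs o :
  (size (eG (e0 :: ys)) <= B)%N -> (size x <= B)%N ->
  (forall y, y \in e0 :: ys -> size y = size x) ->
  run B (vec 0 5 ;; each 12 (step_prog prep_sym) ;; mv 13 12 ;;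
          step_prog prep_bool ;; mv 13 12 ;; clr 5)
   (enc_st (St (ev x ++ gs) [::] o [::] [::] [::] [::] [::] [::] [::] (eG (e0 :: ys)) [::])) =
  Some (enc_st (St gs [::]
     (eG (rev (rcons [seq outerd x y y x | y <- e0 :: ys] (outerd x x x e0))) ++ o) [::]
     [::] [::] [::] [::] [::] [::] (eG (e0 :: ys)) [::])).
Proof.
move=> leG lex szy.
have [L EL] : exists L, [seq outerd x y y x | y <- e0 :: ys] = L by eexists.
rewrite EL.
have leys y : y \in e0 :: ys -> (size y <= B)%N by move/size_le_eG => /leq_trans; apply.
rewrite (run_then _ (@run_vec 0 5 _ x gs _ _ _ _ _)) //= cats0.
rewrite (run_then _ (run_each_step (y1 := id) (u1 := id) (w1 := fun=> x)
  _ _ _ _ _ _)) //; first last.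
- by move=> y yin; split; [apply: prep_symP => //; exact: leys | exact: szy | rewrite szy | exact: leys | exact: leys].
- by apply: leq_trans leG; rewrite size_eG leq_addl.
rewrite [X in eG (rev X) ++ o]EL cats0.
rewrite (run_then _ (run_mv _ _ _ _)) //= ?size_rev // revK cats0 eG_cons.
have sze0 : size e0 = size x by rewrite szy ?mem_head.
rewrite (run_then _ (@run_step _ _ _ _ _ _ _ _ _ _ (prep_boolP _ _) _ _ _ _ _)) ?sze0 //.
rewrite (run_then _ (run_mv _ _ _ _)) //= ?cats0 ?revK; last first.
  by rewrite size_rev size_ev sze0; move: leG; rewrite eG_cons size_cat size_ev sze0; lia.
by rewrite run_clr //= ?size_rs // rev_rcons eG_cons -catA.
Qed.

Lemma run_sym e0 ys o : let Bs := e0 :: ys in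
  (size (eG Bs) <= B)%N -> (forall y, y \in Bs -> size y = size e0) ->
  run B sym_prog (enc_st (St (eG Bs) [::] o [::] [::] [::] [::] [::] [::] [::] (eG Bs) [::])) =
  Some (enc_st (St [::] [::] (eG (sym_constraints e0 Bs) ++ o) [::] [::] [::] [::] [::] [::] [::]
    (eG Bs) [::])).
Proof.
move=> Bs leG szy; rewrite /sym_prog.
pose I G o := St (eG G) [::] o [::] [::] [::] [::] [::] [::] [::] (eG Bs) [::].
pose step o x := eG (rev (rcons [seq outerd x y y x | y <- Bs] (outerd x x x e0))) ++ o.
rewrite -[St _ _ _ _ _ _ _ _ _ _ _ _]/(I Bs o).
rewrite (run_each (step := step) (P := fun G' _ => {subset G' <= Bs})) //; first last.
- move=> x G' o' sub; split=> //.
  + by move=> v vin; apply: sub; rewrite inE vin orbT.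
  + by rewrite /= eG_cons ev_cat; case: (x).
  + have xin : x \in Bs by apply: sub; rewrite mem_head.
    rewrite /I eG_cons run_sym_body //; first exact: leq_trans (size_le_eG xin) leG.
    by move=> y yin; rewrite !szy.
- by apply: leq_trans leG; rewrite size_eG leq_addl.
by rewrite /step eG_rev_flatten.
Qed.
End Specs.

(** * Unit vectors and coefficient matrices of the polynomials *)

Section Rows.
Variables (b b' k k' a c e1 e2 nn : seq token).

Local Notation Sr g l r t o x0 bs :=
  [:: g; l; r; t; o; x0; [::]; [::]; [::]; [::]; [::]; [::]; bs; [::]; k; k'; a; c; e1; e2; nn].

Lemma mkseq_head (s : seq F) m :
  mkseq (nth 0 s) m.+1 = head 0 s :: mkseq (nth 0 (behead s)) m.
Proof.
rewrite /mkseq /= nth0 (iotaDl 1 0) -map_comp; congr (_ :: _).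
by apply: eq_map => q /=; rewrite nth_behead.
Qed.

Definition row_out (mid : F) i j (cs : seq F) : seq F :=
  nseq i 0 ++ mid :: rev (mkseq (nth 0 cs) j).
Arguments row_out : simpl never.

(** Rows are produced from the last one to row 0. The coefficient list is threaded through them,
    each row using up the [j] entries to the right of its diagonal. *)
Fixpoint rows_out po mid i j (cs : seq F) (o : seq token) : seq token * seq F :=
  let o' := map Some (row_out mid i j cs) ++ po ++ o in
  if i is i'.+1 then rows_out po mid i' j.+1 (drop j cs) o' else (o', drop j cs).

Definition pre_spec pre po := forall g l r t o x0 bs,
  run B pre (enc_st (Sr g l r t o x0 bs)) = Some (enc_st (Sr g l r t (po ++ o) x0 bs)).

Local Notation blk n := (nseq n (@None F)).

Lemma run_row pre po mid i j cs g o bs : pre_spec pre po -> (i <= B)%N -> (j <= B)%N ->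
  run B (row_prog pre mid) (enc_st (Sr g (blk i) (blk j) [::] o (map Some cs) bs)) =
  Some (enc_st (Sr g (blk i) (blk j) [::] (map Some (row_out mid i j cs) ++ po ++ o)
    (map Some (drop j cs)) bs)).
Proof.
move=> Hpre lei lej; rewrite /row_prog (run_then _ (Hpre _ _ _ _ _ _ _)).
pose I (ts : seq token) (z : seq token * seq F * seq token) :=
  Sr g (blk i) ts z.1.1 z.2 (map Some z.1.2) bs.
pose step (z : seq token * seq F * seq token) (t : token) :=
  (t :: z.1.1, behead z.1.2, Some (head 0 z.1.2) :: z.2).
have Efold m z : foldl step z (blk m) = (blk m ++ z.1.1, drop m z.1.2,
    rev (map Some (mkseq (nth 0 z.1.2) m)) ++ z.2).
  elim: m z => [|m IH] [[z1 z2] z3]; first by rewrite /= drop0.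
  rewrite [LHS]/= IH mkseq_head map_cons rev_cons cat_rcons; congr (_, _, _).
    by elim: (m) => //= p' ->.
  by case: (z2).
rewrite -[Sr _ _ _ _ _ _ _]/(I (blk j) ([::], cs, po ++ o)).
rewrite (run_then _ (while_fold (step := step) (fin := I [::])
  (P := fun _ _ => True) _ _ _ _)) ?size_nseq //; first last.
- move=> m t ts [[z1 z2] z3] _; split=> //; apply: tloop_body; [by [] | by rewrite andFb |].
  rewrite /I /= (run_then _ (run_push _ _ _ _)) /= run_case /=.
  by case: z2 => [|z z2] /=; rewrite run_push.
- by move=> m z _; apply: tloop_end.
rewrite Efold /I /= cats0 (run_then _ (run_mv _ _ _ _)) //= ?size_nseq //.
rewrite rev_nseq cats0 (run_then _ (run_push _ _ _ _)) /=.
pose I' (ts : seq token) (z : seq token * seq token) :=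
  Sr g ts (blk j) z.1 z.2 (map Some (drop j cs)) bs.
pose step' (z : seq token * seq token) (t : token) := (t :: z.1, Some (0 : F) :: z.2).
have Efold' m z : foldl step' z (blk m) = (blk m ++ z.1, nseq m (Some 0) ++ z.2).
  elim: m z => [|m IH] [z1 z2] //=; rewrite IH /=; congr (_, _).
    by elim: (m) => //= p' ->.
  by elim: (m) => //= p' ->.
set o1 := Some mid :: _.
rewrite -[Sr _ _ _ _ _ _ _]/(I' (blk i) ([::], o1)).
rewrite (run_then _ (while_fold (step := step') (fin := I' [::])
  (P := fun _ _ => True) _ _ _ _)) ?size_nseq //; first last.
- move=> m t ts [z1 z2] _; split=> //; apply: tloop_body; [by [] | by rewrite andFb |].
  by rewrite /I' /= (run_then _ (run_push _ _ _ _)) /= run_push.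
- by move=> m z _; apply: tloop_end.
rewrite Efold' /I' /= cats0 run_mv //= ?size_nseq // rev_nseq cats0.
by rewrite /o1 /row_out map_cat map_nseq /= map_rev -catA.
Qed.

Lemma run_rows pre po mid n cs g o bs : pre_spec pre po -> (n <= B)%N ->
  run B (rows_prog pre mid) (enc_st (Sr g (blk n) [::] [::] o (map Some cs) bs)) =
  Some (enc_st (Sr g (blk n) [::] [::] (rows_out po mid n 0 cs o).1
    (map Some (rows_out po mid n 0 cs o).2) bs)).
Proof.
move=> Hpre len; rewrite /rows_prog (run_then _ (run_row mid _ _ _ _ Hpre _ (leq0n B))) //.
pose f (t : token) := push_tok 2 t ;; row_prog pre mid.
have loop m i j cs' o' : (i <= m)%N -> (i + j <= B)%N ->
  tloop B 1 false f m (enc_st (Sr g (blk i) (blk j) [::]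
      (map Some (row_out mid i j cs') ++ po ++ o') (map Some (drop j cs')) bs)) =
  Some (enc_st (Sr g [::] (blk (i + j)) [::] (rows_out po mid i j cs' o').1
    (map Some (rows_out po mid i j cs' o').2) bs)).
  elim: i m j cs' o' => [|i IH] m j cs' o' lem leB; first by apply: tloop_end.
  case: m lem => // m lem.
  rewrite (@tloop_body _ _ _ _ _ (Sr g (blk i) (blk j.+1) [::]
     (map Some (row_out mid i j.+1 (drop j cs')) ++ po ++
        (map Some (row_out mid i.+1 j cs') ++ po ++ o')) (map Some (drop j.+1 (drop j cs'))) bs)
     None (blk i)) //; last first.
    rewrite /f (run_then _ (run_push _ _ _ _)) /=.
    by have := @run_row pre po mid i j.+1 (drop j cs') g; rewrite /=; apply=> //; lia.
  by rewrite IH ?addSnnS //; lia.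
rewrite (run_then _ (etrans (run_while _ _ _ _ _) (loop B n 0 cs o _ _))) ?addn0 //.
by rewrite run_mv //= ?size_nseq // rev_nseq cats0.
Qed.

Lemma iota_rcons m n : iota m n.+1 = rcons (iota m n) (m + n)%N.
Proof. by rewrite -cats1 -addn1 iotaD. Qed.

Definition unitv n i : seq F := nseq i 0 ++ 1 :: nseq (n - i) 0.
Arguments unitv : simpl never.
Definition basisv n : seq (seq F) := map (unitv n) (iota 0 n.+1).

Lemma row_out_unit i j : row_out 1 i j [::] = unitv (i + j) i.
Proof.
rewrite /row_out /unitv addKn; congr (_ ++ _ :: _).
have -> : mkseq (nth 0 (Nil F)) j = nseq j 0; last by rewrite rev_nseq.
by apply: (@eq_from_nth _ 0) => [|q]; rewrite size_mkseq ?size_nseq // => lt;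
  rewrite nth_mkseq // nth_nil nth_nseq lt.
Qed.

Lemma rows_basis i j o : rows_out [:: None] 1 i j [::] o =
  (eG (map (unitv (i + j)) (iota 0 i.+1)) ++ o, [::]).
Proof.
elim: i j o => [|i IH] j o.
  rewrite -[LHS]/(map Some (row_out 1 0 j [::]) ++ [:: None] ++ o, [::]) row_out_unit.
  by rewrite -[map _ _ in RHS]/[:: unitv (0 + j) 0] eG_cons -catA ev_cat.
rewrite -[LHS]/(rows_out [:: None] 1 i j.+1 [::] (map Some (row_out 1 i.+1 j [::]) ++ [:: None] ++ o)).
rewrite IH addnS (iota_rcons 0 i.+1) map_rcons -cats1 eG_cat -catA row_out_unit addSn.
by rewrite [eG [:: _]]eG_cons -catA ev_cat.
Qed.

Definition segv n (co : nat -> nat -> F) i := [seq co i j | j <- iota i.+1 (n - i)].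

(** Here [co i j] is the coefficient of x_i x_j with x_0 = 1, so row 0 carries the linear part. The
    order is that of [sqfree_monomials]. *)
Definition coefv n (co : nat -> nat -> F) : seq F :=
  co 0%N 0%N :: flatten [seq segv n co i | i <- iota 0 n.+1].

Definition polyv n (co : nat -> nat -> F) : seq F :=
  flatten [seq [seq (if (i < j)%N || (i + j == 0)%N then co i j else 0) | j <- iota 0 n.+1]
          | i <- iota 0 n.+1].

Lemma row_out_seg n co i rest : (i <= n)%N ->
  row_out 0 i (n - i) (rev (segv n co i) ++ rest) = nseq i.+1 0 ++ segv n co i.
Proof.
move=> lein; rewrite /row_out.
have -> : mkseq (nth 0 (rev (segv n co i) ++ rest)) (n - i) = rev (segv n co i).
  have sz : size (rev (segv n co i)) = (n - i)%N by rewrite size_rev size_map size_iota.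
  apply: (@eq_from_nth _ 0) => [|q]; rewrite size_mkseq ?sz // => lt.
  by rewrite nth_mkseq // nth_cat sz lt.
by rewrite revK -[0 :: _]/([:: 0] ++ _) catA; congr (_ ++ _); elim: (i) => //= ? ->.
Qed.

Lemma rows_poly n co i rest o : (i <= n)%N ->
  rows_out [::] 0 i (n - i) (rev (flatten [seq segv n co t | t <- iota 0 i.+1]) ++ rest) o =
  (map Some (flatten [seq nseq t.+1 0 ++ segv n co t | t <- iota 0 i.+1]) ++ o, rest).
Proof.
elim: i o => [|i IH] o lein.
  rewrite [iota _ _]/= [map _ [:: _]]/= [flatten _]/= cats0 /rows_out row_out_seg // subn0.
  rewrite drop_size_cat ?size_rev ?size_map ?size_iota ?subn0 //.
  by rewrite /= cats0.
rewrite (iota_rcons 0 i.+1) !map_rcons -!cats1 !flatten_cat [flatten [:: _]]/= cats0 rev_cat -catA.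
rewrite [(0 + i.+1)%N]add0n; set CS := rev (segv n co i.+1) ++ _.
rewrite -[LHS]/(rows_out [::] 0 i (n - i.+1).+1 (drop (n - i.+1) CS)
  (map Some (row_out 0 i.+1 (n - i.+1) CS) ++ [::] ++ o)) /CS row_out_seg //.
rewrite drop_size_cat ?size_rev ?size_map ?size_iota //.
rewrite -subSn // subSS IH ?(ltnW lein) //; congr (_, _).
by rewrite map_cat -catA [flatten [:: _]]/= cats0.
Qed.

Lemma map_zero (f : nat -> F) s : (forall j, j \in s -> f j = 0) -> map f s = nseq (size s) 0.
Proof.
elim: s => //= j s IH H; rewrite H ?mem_head // IH // => i si.
by apply: H; rewrite inE si orbT.
Qed.

(** The right-hand side is what the row program writes, with the leading zero exchanged for the
    constant coefficient. *)
Lemma polyvE n co :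
  polyv n co = co 0%N 0%N :: behead (flatten [seq nseq t.+1 0 ++ segv n co t | t <- iota 0 n.+1]).
Proof.
pose rowL i := [seq (if (i < j)%N || (i + j == 0)%N then co i j else 0) | j <- iota 0 n.+1].
have E0 : rowL 0%N = co 0%N 0%N :: segv n co 0.
  rewrite /rowL /segv subn0 /=; congr (_ :: _).
  by apply/eq_in_map => j; rewrite mem_iota => /andP[-> _].
rewrite -[LHS]/(rowL 0%N ++ flatten (map rowL (iota 1 n))) E0.
rewrite -[RHS]/(co 0%N 0%N :: segv n co 0 ++ flatten [seq nseq t.+1 0 ++ segv n co t | t <- iota 1 n]).
congr (_ :: _ ++ flatten _); apply/eq_in_map => i.
rewrite mem_iota add1n ltnS => /andP[i_gt0 lein]; rewrite /rowL.
have -> : iota 0 n.+1 = iota 0 i.+1 ++ iota i.+1 (n - i).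
  by rewrite -{2}[i.+1]add0n -iotaD; congr iota; lia.
rewrite map_cat; congr (_ ++ _).
- rewrite -[in RHS](size_iota 0 i.+1); apply: map_zero => j.
  rewrite mem_iota add0n ltnS => /andP[_ leji].
  by rewrite ltnNge leji /=; case: eqP => //; lia.
- by apply/eq_in_map => j; rewrite mem_iota => /andP[-> _].
Qed.

Lemma size_coefv n co : (size (coefv n co) <= size (polyv n co))%N.
Proof.
rewrite polyvE /= /coefv /= ltnS !size_cat leq_add //.
elim: (iota 1 n) => //= t s IH; rewrite !size_cat size_nseq /=; lia.
Qed.

Lemma run_poly_body n co g o bs : (n <= B)%N -> (size (coefv n co) <= B)%N ->
  run B (vec 0 5 ;; push_tok 4 (@None F) ;; rows_prog Skip 0 ;;
    case_t 4 Skip (fun _ => case_t 5 Skip (fun c => push_tok 4 c)))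
    (enc_st (Sr (ev (coefv n co) ++ g) (blk n) [::] [::] o [::] bs)) =
  Some (enc_st (Sr g (blk n) [::] [::] (ev (polyv n co) ++ o) [::] bs)).
Proof.
move=> len lec.
rewrite polyvE.
have [fl Efl] : exists fl, flatten [seq nseq t.+1 0 ++ segv n co t | t <- iota 0 n.+1] = fl.
  by eexists.
rewrite Efl; have [cv Ecv] : exists cv, coefv n co = cv by eexists.
rewrite Ecv in lec *; rewrite (run_then _ (@run_vec 0 5 _ cv g _ _ _ _ _)) //= cats0.
rewrite (run_then _ (run_push _ _ _ _)) /= -map_rev -Ecv /coefv rev_cons -cats1.
rewrite (run_then _ (@run_rows Skip [::] _ _ _ _ _ _ _ _)) //.
have := @rows_poly n co n [:: co 0%N 0%N] (None :: o) (leqnn n); rewrite subnn => ->.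
rewrite Efl; case: fl Efl => [|x s] //= _.
by rewrite run_case /= run_case /= run_push /= ev_cat.
Qed.

Lemma run_poly n cos o bs : (n <= B)%N -> (size cos <= B)%N ->
   (forall co, co \in map (coefv n) cos -> (size co <= B)%N) ->
  run B poly_prog (enc_st (Sr (eG (map (coefv n) cos)) (blk n) [::] [::] o [::] bs)) =
  Some (enc_st (Sr [::] (blk n) [::] [::] (eG (rev (map (polyv n) cos)) ++ o) [::] bs)).
Proof.
move=> len leB lec; rewrite /poly_prog.
pose I (cos : seq (nat -> nat -> F)) o := Sr (eG (map (coefv n) cos)) (blk n) [::] [::] o [::] bs.
pose step o co := ev (polyv n co) ++ o.
rewrite -[Sr _ _ _ _ _ _ _]/(I cos o).
rewrite (run_each (step := step)
  (P := fun cos' _ => {subset map (coefv n) cos' <= map (coefv n) cos})) //; last first.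
  move=> co cos' o' sub; split=> //.
  - by move=> v vin; apply: sub; rewrite inE vin orbT.
  - by rewrite /I /= run_poly_body //; apply: lec; apply: sub; rewrite mem_head.
by rewrite /step eG_rev_map.
Qed.

End Rows.

(** * Values of a constraint on the blocks of a generator *)

Section Contraction.
Variables (l r u w w' bs bs' k k' e1 e2 nn : seq token).

Local Notation Sc g t o x0 x y y' a c :=
  [:: g; l; r; t; o; x0; x; y; u; w; y'; w'; bs; bs'; k; k'; a; c; e1; e2; nn].
Local Notation blk n := (nseq n (@None F)).

Definition dot (v1 v2 : seq F) : F := \sum_(p <- zip v1 v2) p.1 * p.2.

Lemma dot0s v2 : dot [::] v2 = 0.
Proof. by case: v2 => [|x v2]; rewrite /dot big_nil. Qed.

Lemma dot_rcons v1 v2 x1 x2 : size v1 = size v2 ->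
  dot (rcons v1 x1) (rcons v2 x2) = dot v1 v2 + x1 * x2.
Proof. by move=> sz; rewrite /dot zip_rcons // -cats1 big_cat big_seq1. Qed.

Definition contract_body (ta : token) := case_t 7 Skip (fun tb =>
    push_tok 10 tb ;;
    case_t 16 Skip (fun tc => push_tok 16 (Some (tok_val tc + tok_val tb * tok_val ta))) ;;
    case_t 7
      (mv 10 7 ;; case_t 16 Skip (fun tv => push_tok 4 tv) ;;
       push_tok 16 (Some (0 : F)) ;; push_tok 17 (@None F))
      (fun t => push_tok 7 t)).

(** The state in the middle of a block: [v2] has been consumed with partial sum [acc], and [v1]
    remains. The induction runs from the end because both registers present their last entry
    first. *)
Lemma tloop_chunk_aux m v v1 v2 cv1 cv2 acc g o x0 c : size cv1 = size v1 ->
    v1 <> [::] -> (size (v1 ++ v2) <= B)%N -> v1 ++ v2 = v ->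
  tloop B 6 false contract_body (m + size v1)
    (enc_st (Sc g [::] o x0 (rs (cv2 ++ cv1)) (rs v1) (map Some v2) [:: Some acc] c)) =
  tloop B 6 false contract_body m
    (enc_st (Sc g [::] (Some (acc + dot v1 cv1) :: o) x0 (rs cv2) (rs v) [::]
       [:: Some 0] (None :: c))).
Proof.
move=> szc ne leB <-; elim/last_ind: v1 v2 cv1 acc szc ne leB => [|v1 x IH] v2 cv1 acc //.
case/lastP: cv1 => [|cv1 y]; rewrite ?size_rcons // => -[szc] _ leB.
rewrite -rcons_cat !rs_rcons addnS dot_rcons //.
rewrite cat_rcons size_cat /= in leB *.
case: (v1 =P [::]) => [E|ne].
  have -> : dot v1 cv1 = 0 by rewrite E dot0s.
  move: szc leB; rewrite E => /size0nil -> leB; rewrite cats0 add0r addn0.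
  apply: tloop_body; [by [] | by rewrite andFb |].
  rewrite /contract_body run_case /= (run_then _ (run_push _ _ _ _)) /=.
  rewrite run_seq run_case /= run_push /= run_case /=.
  rewrite (run_then _ (run_mv _ _ _ _)) //=; last by rewrite size_map.
  rewrite run_seq run_case /= run_push /= (run_then _ (run_push _ _ _ _)) /= run_push /=.
  by rewrite cats0.
have -> : acc + (dot v1 cv1 + x * y) = acc + x * y + dot v1 cv1 by ring.
rewrite -(IH (x :: v2) cv1 (acc + x * y)) //; last first.
  by rewrite size_cat /=.
have [q [v1' Ev1]] : exists q v1', rs v1 = q :: v1'.
  by case/lastP: (v1) ne => // v1' q _; rewrite rs_rcons; eexists; eexists.
apply: tloop_body; [by [] | by rewrite andFb |].
rewrite /contract_body run_case /= (run_then _ (run_push _ _ _ _)) /=.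
rewrite run_seq run_case /= run_push /= run_case /= Ev1 /=.
by rewrite run_push.
Qed.

Lemma tloop_chunks m v cs g o x0 c : v <> [::] -> (size v <= B)%N ->
    (forall cv, cv \in cs -> size cv = size v) ->
  tloop B 6 false contract_body (m + size cs * size v)
    (enc_st (Sc g [::] o x0 (rs (flatten cs)) (rs v) [::] [:: Some 0] c)) =
  tloop B 6 false contract_body m
    (enc_st (Sc g [::] (map Some (map (dot v) cs) ++ o) x0 [::] (rs v) [::]
       [:: Some 0] (blk (size cs) ++ c))).
Proof.
move=> ne leB; elim/last_ind: cs m o c => [|cs cv IH] m o c Hcs.
  by rewrite mul0n addn0.
have szcv : size cv = size v by rewrite Hcs // mem_rcons mem_head.
have Ecs : flatten (rcons cs cv) = flatten cs ++ cv by rewrite -cats1 flatten_cat /= cats0.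
have -> : (m + size (rcons cs cv) * size v = m + size cs * size v + size v)%N.
  by rewrite size_rcons mulSn; lia.
rewrite Ecs (@tloop_chunk_aux _ v v [::] cv (flatten cs) 0) ?cats0 //.
rewrite IH => [|cv' cvin]; last by rewrite Hcs // mem_rcons inE cvin orbT.
by rewrite size_rcons !map_rcons cat_rcons add0r -[None :: c]/(blk 1 ++ c) catA -nseqD addn1.
Qed.

Definition values v g := map (dot v) (reshape (nseq (size g %/ size v) (size v)) g).

Lemma valuesE v g m : size g = (m * size v)%N -> v <> [::] ->
  exists cs, [/\ g = flatten cs, size cs = m, forall cv, cv \in cs -> size cv = size v &
    values v g = map (dot v) cs].
Proof.
move=> szg ne; have v_gt0 : (0 < size v)%N by case: (v) ne.
have Ediv : (size g %/ size v = m)%N by rewrite szg mulnK.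
exists (reshape (nseq m (size v)) g); split.
- by rewrite reshapeKr // sumn_nseq szg mulnC.
- by rewrite size_reshape size_nseq.
- have : all (fun s => s == size v) (shape (reshape (nseq m (size v)) g)).
    by rewrite reshapeKl ?sumn_nseq ?szg 1?mulnC // all_nseq eqxx orbT.
  by rewrite all_map => /allP H cv /H /eqP.
- by rewrite /values Ediv.
Qed.

Lemma run_augment_body v g m gs o c : v <> [::] -> size g = (m * size v)%N ->
    (size v <= B)%N -> (size g <= B)%N -> (size c <= B)%N ->
  run B (clr 17 ;; vec 0 5 ;; cp id 5 3 6 ;; push_tok 4 (@None F) ;; mv 5 4 ;; contract_prog)
    (enc_st (Sc (ev g ++ gs) [::] o [::] [::] (rs v) [::] [:: Some 0] c)) =
  Some (enc_st (Sc gs [::] (ev (values v g ++ g) ++ o) [::] [::] (rs v) [::]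
    [:: Some 0] (blk m))).
Proof.
move=> ne szg lev leg lec.
rewrite (run_then _ (run_clr _ _)) //= (run_then _ (@run_vec 0 5 _ g gs _ _ _ _ _)) //= cats0.
rewrite (run_then _ (run_cp _ _ _ _ _ _ _)) //= ?size_rs // cats0 map_id.
rewrite (run_then _ (run_push _ _ _ _)) /= (run_then _ (run_mv _ _ _ _)) //= ?size_rs //.
rewrite map_rs; have [cs [Eg szcs Hcs ->]] := valuesE szg ne.
rewrite -/(rs g) [in rs g]Eg /contract_prog run_while.
have := @tloop_chunks (B - size cs * size v) v cs gs (map Some g ++ None :: o) [::] [::] ne lev Hcs.
rewrite subnK ?szcs -?szg // => ->.
by rewrite tloop_end //= cats0 ev_cat map_cat -catA.
Qed.

Lemma run_augment v gs m c : v <> [::] -> (forall g, g \in gs -> size g = (m * size v)%N) ->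
    (size v <= B)%N -> (size c <= B)%N -> (m * size v + m <= B)%N -> gs <> [::] ->
    (size gs * (m * size v + m).+1 <= B)%N ->
  run B augment_prog (enc_st (Sc (eG gs) [::] [::] [::] [::] (rs v) [::] [:: Some 0] c)) =
  Some (enc_st (Sc (eG (rev [seq values v g ++ g | g <- gs])) [::] [::] [::] [::] (rs v) [::]
    [:: Some 0] (blk m))).
Proof.
move=> ne Hgs lev lec lem negs leB; rewrite /augment_prog.
pose I gs (z : seq token * seq token) :=
  Sc (eG gs) [::] z.1 [::] [::] (rs v) [::] [:: Some 0] z.2.
pose step (z : seq token * seq token) (g : seq F) := (ev (values v g ++ g) ++ z.1, blk m).
have lem' : (m <= B)%N by lia.
rewrite -[Sc _ _ _ _ _ _ _ _ _]/(I gs ([::], c)).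
rewrite (run_then _ (run_each (step := step)
  (P := fun gs' z => {subset gs' <= gs} /\ (size z.2 <= B)%N) _ _ _ _)) //; first last.
- move=> g gs' z [sub lez]; split=> //.
  + split; last by rewrite size_nseq.
    by move=> h hin; apply: sub; rewrite inE hin orbT.
  + by rewrite /= eG_cons ev_cat; case: (g).
  + have gin : g \in gs by apply: sub; rewrite mem_head.
    by rewrite /I eG_cons (@run_augment_body _ _ m) // Hgs //; lia.
- by split.
- by apply: leq_trans leB; rewrite leq_pmulr.
have Efold z gs' : foldl step z gs' = (foldl (fun o g => ev (values v g ++ g) ++ o) z.1 gs',
    if gs' is [::] then z.2 else blk m).
  by elim: gs' z => [|g gs' IH] [z1 z2] //=; rewrite IH; case: (gs').
have -> : foldl step ([::], c) gs = (eG (rev [seq values v g ++ g | g <- gs]) ++ [::], blk m).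
  by rewrite Efold eG_rev_map; case: (gs) negs.
have szG : (size (eG (rev [seq values v g ++ g | g <- gs])) <= B)%N.
  apply: leq_trans leB; rewrite size_eG size_rev size_map map_rev sumn_rev mulnS addnC leq_add2l.
  rewrite -map_comp; elim: (gs) Hgs => // g gs' IH Hgs; rewrite /= mulSn; apply: leq_add.
    have szg : size g = (m * size v)%N by rewrite Hgs ?mem_head.
    have [cs [_ szcs _ ->]] := valuesE szg ne.
    by rewrite size_cat size_map szcs szg addnC.
  by apply: IH => h hin; apply: Hgs; rewrite inE hin orbT.
rewrite /I cats0 (run_then _ (run_mv _ _ _ _)) //= cats0 run_mv //= ?size_rev //.
by rewrite revK cats0.
Qed.

End Contraction.

(** * One round of Gaussian elimination *)

Section Rounds.
Variables (l r y y' w' bs bs' k k' a c e1 e2 nn : seq token).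

Local Notation Sp g t o x0 x u w :=
  [:: g; l; r; t; o; x0; x; y; u; w; y'; w'; bs; bs'; k; k'; a; c; e1; e2; nn].

Definition pivot (gs : seq (seq F)) : seq F :=
  foldl (fun p v => if head 0 v != 0 then v else p) [::] gs.

Fixpoint subs (s : F) (v p : seq F) : seq F :=
  match v, p with
  | x :: v', z :: p' => (x - s * z) :: subs s v' p'
  | _, _ => v
  end.

(** When no vector has a nonzero head the pivot is empty, [subs] leaves its vector unchanged, and
    the round merely drops the common zero coordinate. *)
Definition reduce p v := subs (head 0 v / head 0 p) (behead v) (behead p).

Definition round (gs : seq (seq F)) := map (reduce (pivot gs)) gs.

Lemma size_subs s v p : size (subs s v p) = size v.
Proof. by elim: v p => [|x v IH] [|z p] //=; rewrite IH. Qed.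

Lemma run_pivot gs : (forall v, v \in gs -> (size v <= B)%N) -> (size gs <= B)%N ->
  run B pivot_prog (enc_st (Sp (eG gs) [::] [::] [::] [::] [::] [::])) =
  Some (enc_st (Sp [::] [::] (eG (rev gs)) [::] [::] (map Some (pivot gs)) [::])).
Proof.
move=> Hgs leB; rewrite /pivot_prog.
pose I gs (z : seq token * seq F) := Sp (eG gs) [::] z.1 [::] [::] (map Some z.2) [::].
pose step (z : seq token * seq F) (v : seq F) :=
  (ev v ++ z.1, if head 0 v != 0 then v else z.2).
rewrite -[Sp _ _ _ _ _ _ _]/(I gs ([::], [::])).
rewrite (while_fold (step := step) (fin := I [::])
  (P := fun gs' z => {subset gs' <= gs} /\ (size z.2 <= B)%N)) //; first last.
- move=> m v gs' z [sub lez].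
  have vin : v \in gs by apply: sub; rewrite mem_head.
  have lev := Hgs _ vin.
  split.
    split; last by rewrite /=; case: ifP.
    by move=> h hin; apply: sub; rewrite inE hin orbT.
  have [t [ts [Et Eh]]] : exists t ts, ev v = t :: ts /\ tok_val t = head 0 v.
    by case: (v) => [|x v']; do 2!eexists.
  apply: (@tloop_body _ _ _ _ _ _ t (ts ++ eG gs')); first by rewrite /I /= eG_cons Et.
    by [].
  rewrite [enc_st _]/= (run_then _ (run_push _ _ _ _)) /= -cat_cons -Et Eh.
  rewrite (run_then _ (@run_vec 0 5 _ v (eG gs') _ _ _ _ _)) //= cats0 -/(rs v).
  case Hh : (head 0 v != 0); last first.
    rewrite run_seq run_skip /= (run_then _ (run_push _ _ _ _)) /=.
    by rewrite run_mv //= ?size_rs // map_rs /I /step Hh ev_cat.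
  rewrite run_seq (run_then _ (run_clr _ _)) //= ?size_map //.
  rewrite (run_then _ (run_cp _ _ _ _ _ _ _)) //= ?size_rs // cats0 map_id.
  rewrite run_mv //= ?size_rs // map_rs cats0 (run_then _ (run_push _ _ _ _)) /=.
  by rewrite run_mv //= ?size_rs // map_rs /I /step Hh ev_cat.
- by move=> m z _; apply: tloop_end.
- by split.
have Efold z : foldl step z gs = (foldl (fun o v => ev v ++ o) z.1 gs,
    foldl (fun p v => if head 0 v != 0 then v else p) z.2 gs).
  by elim: (gs) z => [|v gs' IH] [z1 z2] //=; rewrite IH.
by rewrite Efold /I /= (eG_rev_map id) map_id cats0.
Qed.

Lemma run_sub s v p g o u0 : (size p = size v \/ p = [::]) -> (size v <= B)%N ->
  run B (sub_prog s) (enc_st (Sp g [::] (ev v ++ o) u0 [::] (map Some p) [::])) =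
  Some (enc_st (Sp g [::] o u0 (rs (subs s v p)) [::] (rs p))).
Proof.
move=> szp lev; rewrite /sub_prog run_while.
suff loop m x w : (size v <= m)%N ->
  tloop B 4 true (fun ta => case_t 8 (push_tok 6 ta) (fun tb =>
    push_tok 9 tb ;; push_tok 6 (Some (tok_val ta - s * tok_val tb)))) m
    (enc_st (Sp g [::] (ev v ++ o) u0 x (map Some p) w)) =
  Some (enc_st (Sp g [::] o u0 (rs (subs s v p) ++ x) [::] (rs p ++ w))).
  by rewrite loop // !cats0.
elim: v p m x w szp {lev} => [|x0 v IH] p m x w szp lem.
  have -> : p = [::] by case: szp => // /size0nil.
  by rewrite (@tloop_stop _ _ _ _ o).
case: m lem => // m lem; case: p szp => [|z p] szp.
  rewrite (@tloop_body _ _ _ _ _ (Sp g [::] (ev v ++ o) u0 (Some x0 :: x) [::] w)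
    (Some x0) (ev v ++ o)) //; last by rewrite run_case /= run_push.
  rewrite (IH [::]) //; last by right.
  by case: (v) => [|q v'] //; rewrite /rs /= !rev_cons !cat_rcons.
rewrite (@tloop_body _ _ _ _ _ (Sp g [::] (ev v ++ o) u0 (Some (x0 - s * z) :: x)
    (map Some p) (Some z :: w)) (Some x0) (ev v ++ o)) //; last first.
  by rewrite run_case /= (run_then _ (run_push _ _ _ _)) /= run_push.
rewrite IH //; last by left; case: szp => // -[].
by rewrite /rs /= !rev_cons !cat_rcons.
Qed.

Lemma run_reduce us p g : (forall v, v \in us -> v <> [::] /\ (size v <= B)%N) ->
    (forall v, v \in us -> p = [::] \/ size p = size v) -> (size us <= B)%N ->
  run B reduce_prog (enc_st (Sp g [::] (eG us) [::] [::] (map Some p) [::])) =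
  Some (enc_st (Sp (eG (rev (map (reduce p) us)) ++ g) [::] [::] [::] [::] (map Some p) [::])).
Proof.
move=> Hus Hp leB; rewrite /reduce_prog.
pose I us g := Sp g [::] (eG us) [::] [::] (map Some p) [::].
pose step (g : seq token) (v : seq F) := ev (reduce p v) ++ g.
rewrite -[Sp _ _ _ _ _ _ _]/(I us g).
rewrite (while_fold (step := step) (fin := I [::])
  (P := fun us' _ => {subset us' <= us})) //; first last.
- move=> m v us' z sub.
  have vin : v \in us by apply: sub; rewrite mem_head.
  split; first by move=> h hin; apply: sub; rewrite inE hin orbT.
  have [ne lev] := Hus _ vin; have Hpv := Hp _ vin.
  case: v sub vin ne lev Hpv => // x v sub vin _ lev Hpv.
  apply: (@tloop_body _ _ _ _ _ _ (Some x) (ev v ++ eG us')); [by [] | by [] |].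
  rewrite /I [set_nth _ _ _ _]/= run_case /=.
  case Ep : {2}(p) Hpv => [|q p'] Hpv; rewrite Ep /=.
    rewrite (run_then _ (@run_sub 0 v [::] _ _ _ _ _)) //; last 2 first.
    - by right.
    - exact: ltnW.
    rewrite (run_then _ (run_push _ _ _ _)) /= run_mv //= ?size_rs ?size_subs; last exact: ltnW.
    rewrite map_rs /step /reduce Ep /= ev_cat.
    by have -> : subs 0 v [::] = subs (x / 0) v [::] by case: (v).
  have szp' : size p' = size v by case: Hpv => H; move: H; rewrite ?Ep //= => -[].
  rewrite (run_then _ (@run_sub (x / q) v p' _ _ _ _ _)) //; last 2 first.
  - by left.
  - exact: ltnW.
  rewrite (run_then _ (run_push _ _ _ _)) /= (run_then _ (run_mv _ _ _ _)) //=; last first.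
    by rewrite size_rs size_subs ltnW.
  rewrite map_rs (run_then _ (run_mv _ _ _ _)) //=; last by rewrite size_rs szp' ltnW.
  by rewrite run_push /= map_rs cats0 /step /reduce Ep /= ev_cat.
- by move=> m z _; apply: tloop_end.
by rewrite /step /I eG_rev_map.
Qed.

Lemma pivot_mem gs : pivot gs = [::] \/ pivot gs \in gs.
Proof.
suff : forall p, foldl (fun p v => if head 0 v != 0 then v else p) p gs = p \/
   foldl (fun p v => if head 0 v != 0 then v else p) p gs \in gs by apply.
elim: gs => [|v gs IH] p; first by left.
rewrite /= inE; case: (IH (if head 0 v != 0 then v else p)) => [->|->]; last by right; rewrite orbT.
by case: ifP => _; [right; rewrite eqxx | left].
Qed.

Lemma run_round gs m : (forall v, v \in gs -> size v = m.+1) -> (m.+1 <= B)%N ->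
    (size gs <= B)%N ->
  run B round_prog (enc_st (Sp (eG gs) [::] [::] [::] [::] [::] [::])) =
  Some (enc_st (Sp (eG (round gs)) [::] [::] [::] [::] [::] [::])).
Proof.
move=> Hgs lem leB; rewrite /round_prog (run_then _ (run_pivot _ _)) //; last first.
  by move=> v vin; rewrite Hgs.
have Hpiv : pivot gs = [::] \/ size (pivot gs) = m.+1.
  by case: (pivot_mem gs) => [->|/Hgs ->]; [left | right].
rewrite (run_then _ (run_reduce _ _ _ _)) ?size_rev //; last 2 first.
- by move=> v; rewrite mem_rev => /Hgs szv; split; [move=> E; rewrite E in szv | rewrite szv].
- by move=> v; rewrite mem_rev => /Hgs ->.
rewrite map_rev revK cats0 run_clr //= size_map.
by case: Hpiv => ->.
Qed.

End Rounds.

(** * Imposing all constraints on the generators *)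

Section Elimination.
Variables (l bs e1 e2 nn : seq token).

Local Notation Sm g y k k' a c :=
  [:: g; l; [::]; [::]; [::]; [::]; [::]; y; [::]; [::]; [::]; [::]; bs; [::]; k; k'; a; c; e1; e2; nn].
Local Notation blk n := (nseq n (@None F)).

(* The values of [v] on the blocks of each generator are put in front of it; every round
   then clears the first coordinate of all generators with a pivot. The pivot becomes
   zero but is kept, so that the number of generators does not change. *)
Definition elim1 (gs : seq (seq F)) (v : seq F) : seq (seq F) :=
  iter (size (head [::] gs) %/ size v) round (rev [seq values v g ++ g | g <- gs]).

Lemma size_round gs m : (forall v, v \in gs -> size v = m.+1) ->
  forall v, v \in round gs -> size v = m.
Proof.
by move=> Hgs v /mapP[u uin ->]; rewrite size_subs size_behead Hgs.
Qed.

Lemma size_iter_round gs m t : (forall v, v \in gs -> size v = (m + t)%N) ->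
  forall v, v \in iter t round gs -> size v = m.
Proof.
elim: t m => [|t IH] m Hgs; first by move=> v /Hgs; rewrite addn0.
by apply: size_round; apply: IH => v /Hgs ->; rewrite addnS.
Qed.

Lemma size_values v g m : size g = (m * size v)%N -> v <> [::] -> size (values v g) = m.
Proof. by move=> szg ne; have [cs [_ <- _ ->]] := valuesE szg ne; rewrite size_map. Qed.

Lemma size_augmented v gs m : (forall g, g \in gs -> size g = (m * size v)%N) -> v <> [::] ->
  forall u, u \in rev [seq values v g ++ g | g <- gs] -> size u = (m * size v + m)%N.
Proof.
move=> Hgs ne u; rewrite mem_rev => /mapP[g gin ->].
by rewrite size_cat (size_values (Hgs _ gin) ne) (Hgs _ gin) addnC.
Qed.

Lemma elim1E gs v m : (forall g, g \in gs -> size g = (m * size v)%N) -> v <> [::] ->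
  gs <> [::] -> elim1 gs v = iter m round (rev [seq values v g ++ g | g <- gs]).
Proof.
move=> Hgs ne negs; rewrite /elim1; case: gs negs Hgs => // g gs _ Hgs.
by rewrite [head _ _]/= Hgs ?mem_head // mulnK //; case: (v) ne.
Qed.

Lemma elim1_size gs v m : (forall g, g \in gs -> size g = (m * size v)%N) -> v <> [::] ->
  gs <> [::] -> size (elim1 gs v) = size gs /\
  (forall g, g \in elim1 gs v -> size g = (m * size v)%N).
Proof.
move=> Hgs ne negs; rewrite (elim1E Hgs) //; split.
  by elim: (m) => [|t IH] /=; rewrite ?size_map ?size_rev ?size_map.
exact/size_iter_round/size_augmented.
Qed.

Lemma run_elim1 v gs m k k' c : v <> [::] -> gs <> [::] ->
    (forall g, g \in gs -> size g = (m * size v)%N) ->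
    (size v <= B)%N -> (size c <= B)%N -> (m * size v + m <= B)%N ->
    (size gs * (m * size v + m).+1 <= B)%N ->
  run B (vec2 14 7 15 ;; push_tok 15 (@None F) ;; augment_prog ;;
    while_t 17 false (fun _ => round_prog) ;; clr 7)
    (enc_st (Sm (eG gs) [::] (ev v ++ k) k' [:: Some 0] c)) =
  Some (enc_st (Sm (eG (elim1 gs v)) [::] k (rev (ev v) ++ k') [:: Some 0] [::])).
Proof.
move=> ne negs Hgs lev lec lem leB.
rewrite (run_then _ (@run_vec2 14 7 15 _ v k _ _ _ _ _ _)) //= cats0 -/(rs v).
rewrite (run_then _ (run_push _ _ _ _)) /=.
rewrite (run_then _ (@run_augment _ _ _ _ _ _ _ _ _ _ _ _ v gs m c _ _ _ _ _ _ _)) //.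
pose gs' := rev [seq values v g ++ g | g <- gs].
pose I (ts : seq token) t := Sm (eG (iter t round gs')) (rs v) k (None :: rs v ++ k') [:: Some 0] ts.
rewrite (run_then _ (while_fold (I := I) (xs := blk m) (a := 0%N) (step := fun t _ => t.+1)
  (P := fun ts t => (size ts + t = m)%N) (fin := I [::]) _ _ _ _)) //; first last.
- move=> q t ts s /= Es; split; first by rewrite addnS.
  apply: tloop_body; [by [] | by rewrite andFb |].
  rewrite /I [set_nth _ _ _ _]/= (@run_round _ _ _ _ _ _ _ _ _ _ _ _ _ _ _ (m * size v + size ts)) //.
  + have := size_augmented Hgs ne; rewrite -/gs' => Haug.
    have Haug' u : u \in gs' -> size u = ((m * size v + size ts).+1 + s)%N.
      by move=> /Haug ->; lia.
    exact: size_iter_round Haug'.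
  + by lia.
  + have -> : size (iter s round gs') = size gs.
      by elim: (s) => [|s' IH] /=; rewrite ?size_map ?size_rev ?size_map.
    by apply: leq_trans leB; rewrite leq_pmulr.
- by move=> q t _; apply: tloop_end.
- by rewrite size_nseq addn0.
- by rewrite size_nseq; lia.
have -> : foldl (fun t _ => t.+1) 0%N (blk m) = m.
  have H t : foldl (fun t _ => t.+1) t (blk m) = (t + m)%N.
    by elim: (m) t => [|q IH] t /=; rewrite ?addn0 // IH addSnnS.
  by rewrite H.
by rewrite /I run_clr //= ?size_rs // (elim1E Hgs) // rev_ev.
Qed.

Lemma run_elim K gs m L c : (0 < L)%N -> (forall v, v \in K -> size v = L) ->
    gs <> [::] -> (forall g, g \in gs -> size g = (m * L)%N) ->
    (size (eG K) <= B)%N -> (L <= B)%N -> (size c <= B)%N -> (m * L + m <= B)%N ->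
    (size gs * (m * L + m).+1 <= B)%N ->
  exists2 c', (size c' <= B)%N &
  run B elim_prog (enc_st (Sm (eG gs) [::] (eG K) [::] [:: Some 0] c)) =
  Some (enc_st (Sm (eG (foldl elim1 gs K)) [::] (eG K) [::] [:: Some 0] c')).
Proof.
move=> L_gt0 HK negs Hgs leK leL lec lem leB; rewrite /elim_prog.
pose I K (z : seq (seq F) * seq token * seq token) :=
  Sm (eG z.1.1) [::] (eG K) z.1.2 [:: Some 0] z.2.
pose step (z : seq (seq F) * seq token * seq token) v :=
  (elim1 z.1.1 v, rev (ev v) ++ z.1.2, Nil token).
have ne v : v \in K -> v <> [::] by move=> /HK szv E; rewrite E in szv; rewrite -szv in L_gt0.
rewrite -[Sm _ _ _ _ _ _]/(I K (gs, [::], c)).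
rewrite (run_then _ (run_each (step := step)
  (P := fun K' z => {subset K' <= K} /\ [/\ z.1.1 <> [::], size z.1.1 = size gs,
     (forall g, g \in z.1.1 -> size g = (m * L)%N) & (size z.2 <= B)%N]) _ _ _ _)) //; first last.
- move=> v K' z [sub [neg szg Hz lez]]; have vin : v \in K by apply: sub; rewrite mem_head.
  have szv := HK _ vin; rewrite -szv in Hz lem leB.
  have [sz1 sz2] := elim1_size Hz (ne _ vin) neg; split=> //.
  + split; first by move=> h hin; apply: sub; rewrite inE hin orbT.
    split=> //; last by rewrite -szv.
      by move=> E; move: sz1; rewrite [elim1 _ _]E; case: (z.1.1) neg.
    by rewrite sz1.
  + by rewrite /= eG_cons ev_cat; case: (v).
  + rewrite /I eG_cons (@run_elim1 _ _ m) ?szv ?szg //; first exact: ne.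
    * by rewrite -szv.
    * by rewrite -szv.
    * by rewrite -szv.
- by split.
- by apply: leq_trans leK; rewrite size_eG leq_addl.
have Efold z : foldl step z K = (foldl elim1 z.1.1 K, rev (eG K) ++ z.1.2,
    if K is [::] then z.2 else [::]).
  elim: (K) z => [|v K' IH] [[z1 z2] z3] //=; rewrite IH /= eG_cons rev_cat catA.
  by case: (K').
exists (if K is [::] then c else [::]); first by case: (K).
by rewrite Efold /I cats0 run_mv //= ?size_rev // revK cats0.
Qed.

End Elimination.

Local Notation blk n := (nseq n (@None F)).

Local Notation Sx g l x0 bs k a c e1 e2 nn :=
  [:: g; l; [::]; [::]; [::]; x0; [::]; [::]; [::]; [::]; [::]; [::]; bs; [::]; k; [::]; a; c; e1; e2; nn].

(** * Sizes of the generators and the main loop *)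

Definition constraints n (cos : seq (nat -> nat -> F)) : seq (seq F) :=
  sym_constraints (unitv n 0) (basisv n) ++ rev (map (polyv n) cos).

Lemma size_unitv n i : (i <= n)%N -> size (unitv n i) = n.+1.
Proof. by move=> le; rewrite size_cat /= !size_nseq; lia. Qed.

Lemma size_basisv n v : v \in basisv n -> size v = n.+1.
Proof. by case/mapP=> i; rewrite mem_iota add0n ltnS => /andP[_ le] ->; exact: size_unitv. Qed.

Lemma basisv_cons n : basisv n = unitv n 0 :: map (unitv n) (iota 1 n).
Proof. by []. Qed.

Lemma run_constraints n cos e1 e2 :
    (size (eG (basisv n)) <= B)%N -> (size cos <= B)%N ->
    (forall v, v \in map (coefv n) cos -> (size v <= B)%N) ->
    (size (eG (constraints n cos)) <= B)%N ->
  run B constraints_prog (enc_st (Sx (eG (map (coefv n) cos)) (blk n) [::] [::] [::] [::] [::] e1 e2 [::])) =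
  Some (enc_st (Sx (eG (basisv n)) (blk n) [::] (eG (basisv n)) (eG (constraints n cos))
    [:: Some 0] [::] e1 e2 [::])).
Proof.
move=> leb lecs lec leK.
have len : (n <= B)%N.
  by apply: leq_trans leb; rewrite size_eG size_map size_iota; lia.
have Hpre : pre_spec [::] [::] [::] [::] e1 e2 [::] (push_tok 4 (@None F)) [:: None].
  by move=> g l r t o x0 bs; rewrite run_push.
have [Bs EB] : exists Bs, basisv n = Bs by eexists.
rewrite /constraints_prog.
rewrite (run_then _ (run_rows 1 [::] _ [::] [::] Hpre len)).
rewrite rows_basis addn0 cats0 -/(basisv n) EB in leb *.
rewrite [map Some _]/= [_.1]/=.
rewrite (run_then _ (run_mv _ _ _ _)) //= cats0 (run_then _ (run_mv _ _ _ _)) //= ?size_rev //.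
rewrite revK cats0 (run_then _ (run_poly _ _ _ _ _ _ _ _ _ len lecs lec)).
have [Ks EK] : exists Ks, map (polyv n) cos = Ks by eexists.
rewrite EK (run_then _ (run_cp _ _ _ _ _ _ _)) //= map_id !cats0.
have [S ES] : exists S, sym_constraints (unitv n 0) Bs = S by eexists.
have leK' : (size (eG S ++ eG (rev Ks)) <= B)%N by rewrite -ES -EB -EK -eG_cat.
rewrite /constraints EK EB ES.
have Esym : run B sym_prog (enc_st [:: eG Bs; blk n; [::]; [::]; eG (rev Ks); [::]; [::]; [::];
   [::]; [::]; [::]; [::]; eG Bs; [::]; [::]; [::]; [::]; [::]; e1; e2; [::]]) =
  Some (enc_st [:: [::]; blk n; [::]; [::]; eG S ++ eG (rev Ks); [::]; [::]; [::];
   [::]; [::]; [::]; [::]; eG Bs; [::]; [::]; [::]; [::]; [::]; e1; e2; [::]]).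
  rewrite -ES -EB basisv_cons run_sym -?basisv_cons ?EB //.
  by move=> y yin; rewrite size_unitv // (@size_basisv n) // EB.
rewrite (run_then _ Esym) (run_then _ (run_mv _ _ _ _)) //= cats0.
rewrite (run_then _ (run_mv _ _ _ _)) //= ?size_rev // revK cats0.
by rewrite (run_then _ (run_cp _ _ _ _ _ _ _)) //= map_id cats0 run_push /= eG_cat.
Qed.

Definition iter_gens (Bs K G : seq (seq F)) : seq (seq F) := foldl elim1 (expand Bs G) K.

Definition gens_at n cos e : seq (seq F) :=
  iter e (iter_gens (basisv n) (constraints n cos)) (basisv n).

Lemma size_outerd x y u w : size u = size x -> size w = size y ->
  size (outerd x y u w) = (size x * size y)%N.
Proof.
move=> szu szw; rewrite /outerd size_flatten /shape -map_comp.
rewrite (@eq_map _ _ _ (fun=> size y)); last by move=> p /=; rewrite size_map size_zip szw minnn.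
by rewrite sumnE big_map big_const_seq count_predT size_zip szu minnn iter_addn_0 mulnC.
Qed.

Lemma size_expand (Bs G : seq (seq F)) M s : (forall y, y \in Bs -> size y = M) ->
    (forall g, g \in G -> size g = s) ->
  size (expand Bs G) = (size G * size Bs)%N /\
  (forall g, g \in expand Bs G -> size g = (s * M)%N).
Proof.
move=> HB HG; split.
  rewrite size_rev size_flatten /shape -map_comp (@eq_map _ _ _ (fun=> size Bs)).
    by rewrite sumnE big_map big_const_seq count_predT iter_addn_0 mulnC.
  by move=> p /=; rewrite size_map.
move=> g; rewrite mem_rev => /flattenP[? /mapP[x xin ->] /mapP[y yin ->]].
by rewrite size_outerd ?size_nseq // (HG _ xin) (HB _ yin).
Qed.

Lemma size_constraints n cos v : v \in constraints n cos -> size v = (n.+1 * n.+1)%N.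
Proof.
rewrite mem_cat => /orP[|].
  rewrite mem_rev => /flattenP[? /mapP[x /size_basisv szx ->]].
  rewrite mem_rcons inE => /orP[/eqP->|/mapP[y /size_basisv szy ->]].
    by rewrite size_outerd ?size_unitv ?szx.
  by rewrite size_outerd ?szx ?szy.
rewrite mem_rev => vin.
have [co ->] : exists co, v = polyv n co.
  by elim: cos vin => //= co cos IH; rewrite inE => /orP[/eqP->|/IH //]; exists co.
rewrite size_flatten /shape -map_comp (@eq_map _ _ _ (fun=> n.+1)).
  by rewrite sumnE big_map big_const_seq count_predT iter_addn_0 size_iota.
by move=> i /=; rewrite size_map size_iota.
Qed.

Lemma foldl_elim1_size K gs m L : (0 < L)%N -> (forall v, v \in K -> size v = L) ->
    gs <> [::] -> (forall g, g \in gs -> size g = (m * L)%N) ->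
  [/\ size (foldl elim1 gs K) = size gs, foldl elim1 gs K <> [::] &
    forall g, g \in foldl elim1 gs K -> size g = (m * L)%N].
Proof.
move=> L_gt0; elim: K gs => [|v K IH] gs HK ne Hgs //.
have szv : size v = L by rewrite HK ?mem_head.
have nev : v <> [::] by move=> E; rewrite -szv E in L_gt0.
rewrite -szv in Hgs; have [sz1 sz2] := elim1_size Hgs nev ne; rewrite szv in sz2.
rewrite -sz1; apply: IH => //.
- by move=> u uin; apply: HK; rewrite inE uin orbT.
- by move=> E; move: sz1; rewrite E; case: (gs) ne.
Qed.

Lemma expand_nil (Bs G : seq (seq F)) : Bs <> [::] -> G <> [::] -> expand Bs G <> [::].
Proof.
move=> neB neG E; have := congr1 size E; rewrite size_rev size_flatten.
by case: (G) neG => // g G'; case: (Bs) neB => // b0 Bs'.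
Qed.

(** Expansion multiplies both the number of generators and their length by n + 1; elimination
    changes neither. *)
Lemma gens_at_size n cos e :
  [/\ size (gens_at n cos e) = (n.+1 ^ e.+1)%N, gens_at n cos e <> [::] &
    forall g, g \in gens_at n cos e -> size g = (n.+1 ^ e.+1)%N].
Proof.
elim: e => [|e [sz ne Hsz]].
  by rewrite /gens_at /= size_map size_iota expn1; split=> // g /size_basisv.
rewrite -[gens_at n cos e.+1]/(iter_gens (basisv n) (constraints n cos) (gens_at n cos e)) /iter_gens.
have [szE szE'] := size_expand (@size_basisv n) Hsz.
have Hexp g : g \in expand (basisv n) (gens_at n cos e) -> size g = (n.+1 ^ e * (n.+1 * n.+1))%N.
  by move/szE' ->; rewrite expnSr mulnA.
have := foldl_elim1_size (isT : (0 < n.+1 * n.+1)%N) (@size_constraints n cos)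
  (expand_nil _ ne) Hexp.
case=> // s1 s2 s3; split=> //.
  by rewrite s1 szE sz size_map size_iota -expnSr.
by move=> g /s3 ->; rewrite mulnA -!expnSr.
Qed.

Lemma size_eG_const (G : seq (seq F)) s : (forall g, g \in G -> size g = s) ->
  size (eG G) = (size G * s.+1)%N.
Proof.
move=> HG; rewrite size_eG mulnS addnC; congr addn.
elim: G HG => //= g G IH HG; rewrite HG ?mem_head // mulSn IH // => h hin.
by apply: HG; rewrite inE hin orbT.
Qed.

Section Iteration.
Variables (n : nat) (cos : seq (nat -> nat -> F)) (E : nat).
(** Iteration e < E handles (n+1)^(e+2) generators, each made of (n+1)^(e+2) entries, (n+1)^e
    prepended values and an end mark. Each of the three products is at most (n+1)^(2(E+1)), whence
    the factor 3. *)
Hypothesis leE : (3 * n.+1 ^ (2 * E.+1) <= B)%N.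
Hypothesis leK : (size (eG (constraints n cos)) <= B)%N.

Local Notation gens := (gens_at n cos).
Local Notation Bs := (basisv n).
Local Notation K := (constraints n cos).

Lemma run_iter e c e1 e2 nn : (e < E)%N -> (size c <= B)%N ->
  exists2 c', (size c' <= B)%N &
  run B iter_prog (enc_st (Sx (eG (gens e)) (blk n) [::] (eG Bs) (eG K) [:: Some 0] c e1 e2 nn)) =
  Some (enc_st (Sx (eG (gens e.+1)) (blk n) [::] (eG Bs) (eG K) [:: Some 0] c' e1 e2 nn)).
Proof.
move=> lteE lec; rewrite /iter_prog.
have [sz ne Hsz] := gens_at_size n cos e.
have [szE szE'] := size_expand (@size_basisv n) Hsz.
have M_gt0 q : (0 < n.+1 ^ q)%N by rewrite expn_gt0.
have leM q : (q <= 2 * E.+1)%N -> (n.+1 ^ q <= n.+1 ^ (2 * E.+1))%N.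
  by move=> leq; apply: leq_pexp2l.
have szexp : size (expand Bs (gens e)) = (n.+1 ^ e.+2)%N.
  by rewrite szE sz size_map size_iota -expnSr.
have Hexp g : g \in expand Bs (gens e) -> size g = (n.+1 ^ e.+2)%N.
  by move/szE' ->; rewrite -expnSr.
have lesq q : (q <= E.+1)%N -> (n.+1 ^ q * (n.+1 ^ q).+1 <= B)%N.
  move=> leq; apply: leq_trans leE; rewrite mulnS -expnD.
  have := leM q; have := leM (q + q)%N; have := M_gt0 (2 * E.+1)%N; lia.
have Hexp' g : g \in expand Bs (gens e) -> size g = (n.+1 ^ e * (n.+1 * n.+1))%N.
  by move/szE' ->; rewrite expnSr mulnA.
rewrite (run_then _ (run_expand _ _ _ _ _ _ _ _ _ _ _ _)); last 3 first.
- by rewrite (size_eG_const (@size_basisv n)) size_map size_iota -(expn1 n.+1); apply: lesq.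
- by rewrite (size_eG_const Hsz) sz; apply: lesq; lia.
- by rewrite (size_eG_const Hexp) szexp; apply: lesq; lia.
have Emul : (n.+1 ^ e * (n.+1 * n.+1) = n.+1 ^ e.+2)%N by rewrite mulnA -!expnSr.
have le1 : (n.+1 ^ e <= n.+1 ^ e.+2)%N by apply: leq_pexp2l => //; lia.
apply: (run_elim _ _ _ _ _ (isT : (0 < n.+1 * n.+1)%N) (@size_constraints n cos) _ Hexp') => //.
- by apply: expand_nil.
- have H : (2 <= 2 * E.+1)%N by lia.
  by apply: leq_trans leE; have := leM 2%N H; rewrite expnS expn1; lia.
- rewrite Emul; apply: leq_trans leE; have := leM e.+2; have := leM e; lia.
- rewrite Emul szexp -addnS mulnDr -expnD mulnS -expnD; apply: leq_trans leE.
  have := leM (e.+2 + e.+2)%N; have := leM (e.+2 + e)%N; have := leM e.+2; lia.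
Qed.

(** Stated for an abstract family [R] of register states so that it serves both loops of the main
    program, driven by registers 18 and 19. *)
Lemma run_iters m e c e1 e2 nn (R : nat -> seq token -> seq token -> seq (seq token)) r :
    (m <= B)%N -> (e + m <= E)%N -> (size c <= B)%N ->
    (forall g ts c, R g ts c = set_nth [::]
      (Sx (eG (gens g)) (blk n) [::] (eG Bs) (eG K) [:: Some 0] c e1 e2 nn) r ts) ->
    r = 18%N \/ r = 19%N ->
  exists2 c', (size c' <= B)%N &
  run B (while_t r false (fun _ => iter_prog)) (enc_st (R e (blk m) c)) =
  Some (enc_st (R (e + m)%N [::] c')).
Proof.
move=> lem leEm lec ER Er; rewrite run_while.
have [q Eq] : exists q, q = B by exists B.
rewrite -[X in tloop _ _ _ _ X]Eq; rewrite -Eq in lem; move: {Eq} q lem => q lem.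
elim: m e c q lem leEm lec => [|m IH] e c q lem leEm lec.
  exists c => //; rewrite addn0 tloop_end // ER.
  by case: Er => ->.
case: q lem => // q lem.
have lt : (e < E)%N by lia.
have [c1 lec1 run1] : exists2 c1, (size c1 <= B)%N &
    run B iter_prog (enc_st (R e (blk m) c)) = Some (enc_st (R e.+1 (blk m) c1)).
  by case: Er => E'; have [c1 lec1 run1] := run_iter (if r == 18%N then blk m else e1)
    (if r == 18%N then e2 else blk m) nn lt lec; exists c1; rewrite // !ER; move: run1; rewrite E'.
have [|c2 lec2 run2] := IH e.+1 c1 q lem _ lec1; first by lia.
exists c2 => //; rewrite addnS -addSn -run2.
apply: (@tloop_body _ _ _ _ _ _ None (blk m)) => //.
  by rewrite ER; case: Er => ->.
by rewrite -run1; congr (run B _ (enc_st _)); rewrite !ER; case: Er => ->.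
Qed.

End Iteration.

Lemma run_count l bs k a c e1 e2 G : (size (eG G) <= B)%N ->
  run B count_prog (enc_st (Sx (eG G) l [::] bs k a c e1 e2 [::])) =
  Some (enc_st (Sx (eG G) l [::] bs k a c e1 e2 (blk (size G)))).
Proof.
move=> leG; rewrite /count_prog.
pose I (ts : seq token) (z : seq token * seq token) :=
  [:: ts; l; [::]; z.1; [::]; [::]; [::]; [::]; [::]; [::]; [::]; [::]; bs; [::]; k; [::]; a; c; e1; e2; z.2].
pose step (z : seq token * seq token) (t : token) :=
  (t :: z.1, if t is None then None :: z.2 else z.2).
rewrite (run_then _ (while_fold (I := I) (xs := eG G) (a := ([::], [::])) (step := step)
  (P := fun _ _ => True) (fin := I [::]) _ _ _ _)) //; first last.
- move=> q t ts z _; split=> //; apply: tloop_body; [by [] | by rewrite andFb |].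
  by case: t => [t|]; rewrite /I /= ?run_seq ?run_skip /= ?(run_then _ (run_push _ _ _ _)) /= ?run_push.
- by move=> q z _; apply: tloop_end.
have Efold z s : foldl step z s = (rev s ++ z.1, blk (count_mem None s) ++ z.2).
  elim: s z => [|t s IH] [z1 z2] //=; rewrite IH /= rev_cons cat_rcons; congr (_, _).
  by case: t => [t|] //=; elim: (count_mem _ _) => //= ? ->.
rewrite Efold /I /= !cats0 run_mv //= ?size_rev // revK cats0.
have -> // : count_mem None (eG G) = size G.
elim: (G) => //= v G' IH; rewrite eG_cons count_cat IH /ev -cats1 count_cat /= count_map.
by rewrite (@eq_count _ _ pred0) ?count_pred0.
Qed.

Lemma run_main n cos k1 k2 : let E := (k1 + k2)%N in
    (3 * n.+1 ^ (2 * E.+1) <= B)%N -> (size (eG (constraints n cos)) <= B)%N ->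
    (size cos <= B)%N -> (k1 <= B)%N -> (k2 <= B)%N ->
    (forall v, v \in map (coefv n) cos -> (size v <= B)%N) ->
  exists st, head [::] st = eG (gens_at n cos E) /\ nth [::] st 20 = blk (n.+1 ^ k1.+1) /\
  run B main_prog (enc_st (Sx (eG (map (coefv n) cos)) (blk n) [::] [::] [::] [::] [::]
     (blk k1) (blk k2) [::])) = Some (enc_st st).
Proof.
move=> E leE leK lecs lek1 lek2 lec.
have leM q : (q <= 2 * E.+1)%N -> (n.+1 ^ q <= n.+1 ^ (2 * E.+1))%N.
  by move=> leq; apply: leq_pexp2l.
have lesq q : (q <= E.+1)%N -> (n.+1 ^ q * (n.+1 ^ q).+1 <= B)%N.
  move=> leq; apply: leq_trans leE; rewrite mulnS -expnD.
  have := leM q; have := leM (q + q)%N; lia.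
have leb : (size (eG (basisv n)) <= B)%N.
  by rewrite (size_eG_const (@size_basisv n)) size_map size_iota -(expn1 n.+1); apply: lesq.
rewrite /main_prog (run_then _ (run_constraints _ _ _ _ _ _)) //.
have [|c1 lec1 run1] := @run_iters n cos E leE leK k1 0 [::] [::] (blk k2) [::]
   (fun e ts c => Sx (eG (gens_at n cos e)) (blk n) [::] (eG (basisv n)) (eG (constraints n cos))
      [:: Some 0] c ts (blk k2) [::]) 18 lek1 _ (leq0n _) (fun _ _ _ => erefl _) (or_introl erefl).
  by rewrite leq_addr.
rewrite (run_then _ run1) add0n.
have [szk _ Hszk] := gens_at_size n cos k1.
rewrite (run_then _ (run_count _ _ _ _ _ _ _ _)); last first.
  by rewrite (size_eG_const Hszk) szk; apply: lesq; rewrite /E; lia.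
have [|c2 lec2 run2] := @run_iters n cos E leE leK k2 k1 c1 [::] (blk k2) (blk (n.+1 ^ k1.+1))
   (fun e ts c => Sx (eG (gens_at n cos e)) (blk n) [::] (eG (basisv n)) (eG (constraints n cos))
      [:: Some 0] c [::] ts (blk (n.+1 ^ k1.+1))) 19 lek2 _ lec1 (fun _ _ _ => erefl _) (or_intror erefl).
  by [].
by rewrite szk run2; eexists; split; last split; last reflexivity.
Qed.

End Program.

(** * Low rank moment matrices *)

Section Moments.
Variables (F : fieldType) (n : nat).
Local Open Scope ring_scope.

Notation letters := 'I_n.+1.
Notation word := (seq letters).

Definition nwords d := #|{: d.-tuple letters}|.

Definition moment_mx d (z : word -> F) : 'M[F]_(nwords d) :=
  \matrix_(a, b) z (tval (enum_val a) ++ tval (enum_val b)).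

Lemma moment_mx_neq0 d (z : word -> F) w : size w = (d + d)%N -> z w != 0 -> moment_mx d z != 0.
Proof.
move=> szw; apply: contraNneq => E.
have szt : size (take d w) == d by rewrite size_takel ?szw ?leq_addr.
have szd : size (drop d w) == d by rewrite size_drop szw addnK.
have := congr1 (fun A : 'M_(nwords d) => A (enum_rank (Tuple szt)) (enum_rank (Tuple szd))) E.
by rewrite !mxE !enum_rankK /= cat_take_drop => ->.
Qed.

(** Multiplying by this matrix on the left selects the rows indexed by words that begin with [i]. *)
Definition prefix_mx d (i : letters) : 'M[F]_(nwords d, nwords d.+1) :=
  rowsub (fun a : 'I_(nwords d) => enum_rank (cons_tuple i (enum_val a))) 1%:M.

Lemma prefix_mxE d z i j :
  prefix_mx d i *m moment_mx d.+1 z *m (prefix_mx d j)^T =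
  \matrix_(a, b) z (i :: tval (enum_val a) ++ j :: tval (enum_val b)).
Proof.
rewrite /prefix_mx -rowsubE; apply/trmx_inj; rewrite trmx_mul trmxK -rowsubE.
by apply/matrixP => a b; rewrite !mxE !enum_rankK.
Qed.

(* If two pairs of row and column selections are orthogonal through [A], the two
   blocks they cut out of [A] form a block diagonal matrix. *)
Lemma rank_blocks m p (A : 'M[F]_m) (L1 L2 : 'M_(p, m)) (R1 R2 : 'M_(m, p)) :
  L1 *m A *m R2 = 0 -> L2 *m A *m R1 = 0 ->
  (\rank (L1 *m A *m R1) + \rank (L2 *m A *m R2) <= \rank A)%N.
Proof.
move=> E1 E2; rewrite -rank_diag_block_mx.
have -> : block_mx (L1 *m A *m R1) 0 0 (L2 *m A *m R2) = col_mx L1 L2 *m A *m row_mx R1 R2.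
  by rewrite mul_col_mx mul_col_row E1 E2.
by apply: leq_trans (mxrankM_maxl _ _) _; exact: mxrankM_maxr.
Qed.

Variable Ks : (letters -> letters -> F) -> Prop.

(* The restrictions to words of a functional on polynomials vanishing on the
   multiples of [x_i^2 - x_i] and of the quadratic forms in [Ks], where the letter
   [0] stands for the constant [1]. *)
Record moments d (z : word -> F) : Prop := Moments {
  moments_perm : forall s t, size s = d.*2.+2 -> perm_eq s t -> z s = z t;
  moments_bool : forall i s, size s = d.*2 -> z (i :: i :: s) = z (i :: 0 :: s);
  moments_eqn : forall q, Ks q ->
    forall s, size s = d.*2 -> \sum_i \sum_j q i j * z (i :: j :: s) = 0 }.

(** By symmetry the two fixed letters can be moved behind the next two, where the relations of [z]
    apply. *)
Lemma moments_shift d z i j : moments d.+1 z -> moments d (fun w => z (i :: j :: w)).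
Proof.
have pm (x y : letters) s : perm_eq [:: i, j, x, y & s] [:: x, y, i, j & s].
  by rewrite -[[:: i, j, x, y & s]]/([:: i; j] ++ [:: x; y] ++ s) perm_catCA.
move=> [Hp Hb He]; split=> [s t szs pst|x s szs|q qK s szs].
- by apply: Hp; rewrite /= ?szs // !perm_cons.
- rewrite (Hp _ _ _ (pm _ _ _)) ?(Hp [:: i, j, x, 0 & s] _ _ (pm _ _ _)) /= ?szs //.
  by rewrite Hb //= szs.
- apply: etrans (He q qK [:: i, j & s] _); last by rewrite /= szs.
  by apply: eq_bigr => x _; apply: eq_bigr => y _; rewrite (Hp _ _ _ (pm _ _ _)) //= szs.
Qed.

Lemma prefix_moments d z i j : moments d z ->
  prefix_mx d i *m moment_mx d.+1 z *m (prefix_mx d j)^T = moment_mx d (fun w => z (i :: j :: w)).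
Proof.
move=> Hz; rewrite prefix_mxE; apply/matrixP => a b; rewrite !mxE.
apply: (moments_perm Hz); first by rewrite /= size_cat /= !size_tuple; lia.
by rewrite perm_cons -cat1s perm_catCA.
Qed.

Definition solution (a : letters -> F) :=
  [/\ a 0 = 1, forall i, a i = 0 \/ a i = 1 &
   forall q, Ks q ->
    \sum_i \sum_j q i j * (a i * a j) = 0].

Lemma moment_mx_words d z : moment_mx d z = 0 -> forall w, size w = (d + d)%N -> z w = 0.
Proof.
move=> E w szw; apply/eqP/negPn/negP => nz.
by have := moment_mx_neq0 szw nz; rewrite E eqxx.
Qed.

(** Every step of the induction fixes two letters, which lowers [d] by one, and passes to a nonzero
    functional of smaller rank. With k <= d the rank is exhausted before the letters are, and rank 0
    contradicts [z w != 0]. *)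
Lemma low_rank_solution k d z w : (k <= d)%N -> moments d z ->
    (\rank (moment_mx d.+1 z) <= k)%N -> size w = d.*2.+2 -> z w != 0 ->
  exists a, solution a.
Proof.
have szE q : (q.+1 + q.+1)%N = q.*2.+2 by rewrite -addnn; lia.
elim: k d z w => [|k IH] d z w lekd Hz.
  rewrite leqn0 mxrank_eq0 => /eqP E szw; rewrite (moment_mx_words E) ?eqxx //.
  by rewrite szE.
case: d lekd Hz => // d lekd Hz rk szw nz.
have Hzij i j := moments_shift i j Hz.
pose S i := prefix_mx d.+1 i.
have SE i j : S i *m moment_mx d.+2 z *m (S j)^T = moment_mx d.+1 (fun w => z (i :: j :: w)).
  exact: prefix_moments.
have mxB z1 z2 : moment_mx d.+1 z1 - moment_mx d.+1 z2 = moment_mx d.+1 (fun w => z1 w - z2 w).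
  by apply/matrixP => x y; rewrite !mxE.
have eqmx z1 z2 : (forall w, size w = d.+1.*2 -> z1 w = z2 w) ->
    moment_mx d.+1 z1 = moment_mx d.+1 z2.
  move=> E; apply/matrixP => x y; rewrite !mxE E // size_cat !size_tuple; lia.
pose z1 (i : letters) (w : word) := z (i :: 0 :: w).
pose z0 (i : letters) (w : word) := z (0 :: 0 :: w) - z (i :: 0 :: w).
(* If neither conditioning on [x_i = 1] nor on [x_i = 0] kills [z], the two conditioned
   functionals are orthogonal blocks, and both have smaller rank. *)
have [/existsP[i /andP[nz1 nz0]]|] :=
    boolP [exists i, (moment_mx d.+1 (z1 i) != 0) && (moment_mx d.+1 (z0 i) != 0)].
  have Ebool : moment_mx d.+1 (fun w => z (i :: i :: w)) = moment_mx d.+1 (z1 i).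
    by apply: eqmx => v szv; rewrite (moments_bool Hz).
  have Esym : moment_mx d.+1 (fun w => z (0 :: i :: w)) = moment_mx d.+1 (z1 i).
    apply: eqmx => v szv; apply: (moments_perm Hz); first by rewrite /= szv.
    by rewrite -cat1s -[i :: v]cat1s perm_catCA.
  (* The selections [S i] and [S 0 - S i] stand for x_i and 1 - x_i; the mixed blocks vanish because
     x_i (1 - x_i) = 0. *)
  have rkle := @rank_blocks _ _ (moment_mx d.+2 z) (S i) (S 0 - S i) (S i)^T (S 0 - S i)^T.
  rewrite !linearB /= !(mulmxBl, mulmxBr) !SE Ebool Esym !subrr in rkle.
  have {rkle} := rkle erefl erefl; rewrite subr0 mxB => rkle.
  have rk0 : (0 < \rank (moment_mx d.+1 (z0 i)))%N by rewrite lt0n mxrank_eq0.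
  have [v nzv szv] : exists2 v, z1 i v != 0 & size v = d.*2.+2.
    have /matrix0Pn[a [b nzab]] := nz1.
    exists (tval (enum_val a) ++ tval (enum_val b)); first by move: nzab; rewrite mxE.
    by rewrite size_cat !size_tuple szE.
  apply: (IH d (z1 i) v) => //; first exact: Hzij.
  by rewrite -ltnS; apply: leq_trans _ (leq_trans rkle rk); rewrite -addn1 leq_add2l.
(* Otherwise every letter [i] acts as a scalar [a i] next to the letter [0]. *)
rewrite negb_exists => /forallP Hall.
(* Letter 0 must be given the value 1 separately: [z1 0] may well vanish, and then the general
   formula would return 0. *)
pose a (i : letters) : F := if i == 0 then 1 else (moment_mx d.+1 (z1 i) != 0)%:R.
have Ha (i : letters) (v : word) : size v = d.+1.*2 -> z (i :: 0 :: v) = a i * z (0 :: 0 :: v).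
  move=> szv; rewrite /a; case: eqP => [->|_]; first by rewrite mul1r.
  have szv' : size v = (d.+1 + d.+1)%N by rewrite addnn.
  have := Hall i; case: eqP => [E|/eqP nz1 /=]; first by rewrite mul0r => _; exact: (moment_mx_words E szv').
  rewrite negbK mul1r => /eqP E0; have /eqP := moment_mx_words E0 szv'.
  by rewrite /z0 subr_eq0 => /eqP->.
have perm0 (u : word) (i : letters) c : perm_eq ((0 : letters) :: i :: u ++ nseq c 0) (i :: 0 :: u ++ nseq c 0).
  by rewrite -cat1s -[i :: u ++ _]cat1s perm_catCA.
(* The letters of [u] are replaced by 0 one after the other, each leaving its scalar as a factor. *)
have Hprod (u : word) c : (size u + c = d.*2.+3)%N ->
    z (0 :: u ++ nseq c 0) = (\prod_(i <- u) a i) * z (nseq d.*2.+4 0).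
  elim: u c => [|i u IHu] c /= szu; first by rewrite big_nil mul1r (_ : c = d.*2.+3) //; lia.
  rewrite (moments_perm Hz _ (perm0 u i c)); last by rewrite /= size_cat size_nseq; lia.
  rewrite Ha; last by rewrite size_cat size_nseq; lia.
  rewrite big_cons -mulrA -(IHu c.+1); last by lia.
  congr (_ * _); apply: (moments_perm Hz); first by rewrite /= size_cat size_nseq; lia.
  by rewrite perm_cons -cat1s -[nseq c.+1 0]cat1s perm_catCA.
have [z00|nz00] := eqVneq (z (nseq d.*2.+4 0)) 0; last first.
  exists a; split=> [|i|q qK]; first by rewrite /a eqxx.
  - by rewrite /a; case: eqP => _; [right | case: (_ != 0); [right | left]].
  (* Multiplied by the nonzero value of [z] on the zero word, the equation at [a] becomes the moment
     equation of [z] at a word of zeros. *)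
  - apply: (mulIf nz00); rewrite mul0r.
    apply: etrans (moments_eqn Hz qK (s := nseq d.+1.*2 0) _); last by rewrite size_nseq.
    rewrite mulr_suml; apply: eq_bigr => i _; rewrite mulr_suml; apply: eq_bigr => j _.
    rewrite -mulrA; congr (_ * _).
    have <- : \prod_(l <- [:: i; j]) a l = a i * a j by rewrite !big_cons big_nil mulr1.
    rewrite -(Hprod [:: i; j] d.*2.+1) //; apply: (moments_perm Hz).
      by rewrite /= size_nseq; lia.
    by rewrite /= -[0 :: i :: _]cat1s -[[:: i, j & _]]/([:: i; j] ++ _) perm_catCA.
(* Now [z] vanishes on words with a letter [0] or a repeated letter, hence the [i, j] and
   [j, i] blocks, which are equal, are orthogonal. *)
have zero_in (u : word) : size u = d.*2.+4 -> 0 \in u -> z u = 0.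
  move=> szu u0; have Eu := perm_to_rem u0.
  rewrite (moments_perm Hz _ Eu) // -[rem _ _]cats0 -[[::]]/(nseq 0 (0 : letters)).
  by rewrite Hprod ?z00 ?mulr0 // addn0 size_rem // szu.
case: w szw nz => [|i [|j w]] // [szw] nz.
have neij : i != j.
  apply: contraNneq nz => ->; rewrite (moments_bool Hz) // zero_in //= ?szw //.
  by rewrite !inE eqxx orbT.
have Ezero l : moment_mx d.+1 (fun w => z (l :: l :: w)) = 0.
  apply/matrixP => x y; rewrite !mxE (moments_bool Hz) ?zero_in //=.
  - by rewrite size_cat !size_tuple; lia.
  - by rewrite !inE eqxx orbT.
  - by rewrite size_cat !size_tuple; lia.
have Eji : moment_mx d.+1 (fun w => z (j :: i :: w)) = moment_mx d.+1 (fun w => z (i :: j :: w)).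
  apply: eqmx => v szv; apply: (moments_perm Hz); first by rewrite /= szv.
  by rewrite -cat1s -[i :: v]cat1s perm_catCA.
have rkle := @rank_blocks _ _ (moment_mx d.+2 z) (S i) (S j) (S j)^T (S i)^T.
rewrite !SE !Ezero Eji in rkle; have {}rkle := rkle erefl erefl.
apply: (IH d (fun w => z (i :: j :: w)) w) => //.
have rk0 : (0 < \rank (moment_mx d.+1 (fun w => z (i :: j :: w))))%N.
  by rewrite lt0n mxrank_eq0; apply: (moment_mx_neq0 (w := w)) => //; rewrite szw szE.
by rewrite -ltnS; apply: leq_trans _ (leq_trans rkle rk); rewrite -addn1 leq_add2l.
Qed.

End Moments.

(** * The span of the computed generators *)

Section Solutions.
Variable F : finFieldType.
Local Open Scope ring_scope.

(* Vectors are handled through their coordinate functions, extended by zero. *)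
Definition contraction (v : seq F) (f : nat -> F) u : F :=
  \sum_(q < size v) v`_q * f (u * size v + q)%N.

(** Exactly what elimination needs: stability under a row operation, and under pointwise equality in
    place of functional extensionality. *)
Definition lin_closed (P : (nat -> F) -> Prop) :=
  (forall f g, f =1 g -> P f -> P g) /\
  (forall f g s, P f -> P g -> P (fun j => f j - s * g j)).

Lemma nth_subs s (v p : seq F) j : size p = size v \/ p = [::] ->
  (subs s v p)`_j = v`_j - s * p`_j.
Proof.
elim: v p j => [|x v IH] [|y p] j [] //.
- by rewrite /= !nth_nil mulr0 subr0.
- by rewrite /= !nth_nil mulr0 subr0.
- by rewrite /= !nth_nil mulr0 subr0.
- by case=> sz; case: j => [|j] //=; apply: IH; left.
Qed.

Lemma dotE (v c : seq F) : size c = size v -> dot v c = \sum_(q < size v) v`_q * c`_q.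
Proof.
move=> sz; rewrite /dot (big_nth (0, 0)) size1_zip ?sz // big_mkord.
by apply: eq_bigr => q _; rewrite nth_zip.
Qed.

Lemma nth_values (v g : seq F) m u : size g = (m * size v)%N -> v <> [::] -> (u < m)%N ->
  (values v g)`_u = contraction v (nth 0 g) u.
Proof.
move=> szg ne lt; have v_gt0 : (0 < size v)%N by case: (v) ne.
have Ediv : (size g %/ size v = m)%N by rewrite szg mulnK.
rewrite /values Ediv (nth_map [::]) ?size_reshape ?size_nseq // nth_reshape nth_nseq lt.
have -> : sumn (take u (nseq m (size v))) = (u * size v)%N.
  by rewrite take_nseq 1?ltnW // sumn_nseq mulnC.
have le : (u * size v + size v <= size g)%N by rewrite szg -mulSnr leq_mul2r lt orbT.
rewrite dotE; last by rewrite size_takel // size_drop leq_subRL; lia.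
by apply: eq_bigr => q _; rewrite nth_take // nth_drop.
Qed.

Lemma pivot_head (gs : seq (seq F)) :
  (pivot gs = [::] /\ forall u, u \in gs -> u`_0 = 0) \/ (pivot gs \in gs /\ (pivot gs)`_0 != 0).
Proof.
rewrite /pivot; elim/last_ind: gs => [|gs u IH]; first by left.
rewrite -cats1 foldl_cat /= nth0; case: (eqVneq (head 0 u) 0) => [E|ne]; last first.
  by right; rewrite mem_cat mem_head orbT.
case: IH => [[-> IH]|[inp IH]]; last by right; rewrite mem_cat inp.
left; split=> // w; rewrite mem_cat inE => /orP[/IH //|/eqP->].
by rewrite nth0.
Qed.

Lemma round_nth (gs : seq (seq F)) m u : (forall v, v \in gs -> size v = m.+1) -> u \in gs ->
  exists p s, [/\ p = [::] \/ p \in gs, u`_0 = s * p`_0 &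
    forall j, (reduce (pivot gs) u)`_j = u`_j.+1 - s * p`_j.+1].
Proof.
move=> Hgs uin; exists (pivot gs), (head 0 u / head 0 (pivot gs)); split.
- exact: pivot_mem.
- case: (pivot_head gs) => [[-> H0]|[_ ne]]; first by rewrite H0 //= mulr0.
  by rewrite -!nth0 divfK.
- move=> j; rewrite nth_subs ?nth_behead //.
  case: (pivot_mem gs) => [->|/Hgs szp]; first by right.
  by left; rewrite !size_behead szp Hgs.
Qed.

Definition shift q (f : nat -> F) : nat -> F := fun j => f (q + j)%N.

(** After [t] of [m] rounds a vector consists of [m - t] values still to be cleared, followed by the
    generator proper. Its first [t] block values have become zero, and the remaining ones are still
    its leading entries. *)
Definition elim_inv (P : (nat -> F) -> Prop) (v : seq F) m t (f : nat -> F) :=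
  P (shift (m - t) f) /\
  forall u, (u < m)%N -> contraction v (shift (m - t) f) u = if (u < t)%N then 0 else f (u - t)%N.

Lemma contraction_sub v f g s u :
  contraction v (fun j => f j - s * g j) u = contraction v f u - s * contraction v g u.
Proof.
rewrite /contraction mulr_sumr -sumrB; apply: eq_bigr => q _.
by ring.
Qed.

Lemma eq_contraction v f g u : f =1 g -> contraction v f u = contraction v g u.
Proof. by move=> E; apply: eq_bigr => q _; rewrite E. Qed.

Lemma elim_inv_round P v m t (gs : seq (seq F)) : lin_closed P -> (t < m)%N ->
    (forall u, u \in gs -> size u = (m * size v + (m - t))%N) ->
    (forall u, u \in gs -> elim_inv P v m t (nth 0 u)) ->
  forall u, u \in round gs -> elim_inv P v m t.+1 (nth 0 u).
Proof.
move=> [Pext Plin] lt szgs Hgs u' /mapP[u uin ->].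
have szgs' w : w \in gs -> size w = (m * size v + (m - t.+1)).+1%N.
  by move/szgs => ->; lia.
have [p [s [Hp E0 Ej]]] := round_nth szgs' uin.
have Esh : shift (m - t.+1) (nth 0 (reduce (pivot gs) u)) =1
    (fun j => shift (m - t) (nth 0 u) j - s * shift (m - t) (nth 0 p) j).
  by move=> j; rewrite /shift Ej; congr (nth 0 u _ - s * nth 0 p _); lia.
have [Pu Cu] := Hgs _ uin.
have [Pp Cp] : (P (fun j => shift (m - t) (nth 0 u) j - s * shift (m - t) (nth 0 p) j)) /\
    (forall x, (x < m)%N -> contraction v (shift (m - t) (nth 0 p)) x =
       if (x < t)%N then 0 else p`_(x - t)).
  case: Hp => [->|/Hgs [Pp Cp]]; last by split=> //; apply: Plin.
  split.
    by apply: Pext Pu => j; rewrite /shift nth_nil mulr0 subr0.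
  move=> x _; rewrite /contraction big1 ?nth_nil ?if_same // => q _.
  by rewrite /shift nth_nil mulr0.
split; first by apply: Pext Pp => j; rewrite Esh.
move=> x ltx; rewrite (eq_contraction _ _ Esh) contraction_sub Cu // Cp //.
case: (ltngtP x t) => [ltxt|gtxt|Ext].
- by rewrite (ltn_trans ltxt) // mulr0 subr0.
- rewrite ltnNge gtxt /= Ej; congr (nth 0 u _ - s * nth 0 p _); lia.
- by rewrite Ext subnn ltnSn E0 subrr.
Qed.

Lemma elim_inv_rounds P v m t (gs : seq (seq F)) : lin_closed P -> (t <= m)%N ->
    (forall u, u \in gs -> size u = (m * size v + m)%N) ->
    (forall u, u \in gs -> elim_inv P v m 0 (nth 0 u)) ->
  forall u, u \in iter t (@round F) gs -> elim_inv P v m t (nth 0 u).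
Proof.
move=> HP; elim: t => [|t IH] // lt szgs Hgs.
apply: elim_inv_round => //; last by apply: IH => //; exact: ltnW.
apply: (@size_iter_round _ _ (m * size v + (m - t)) t) => u /szgs ->; lia.
Qed.

Lemma elim1_closed P v m (gs : seq (seq F)) : lin_closed P -> v <> [::] -> gs <> [::] ->
    (forall g, g \in gs -> size g = (m * size v)%N) ->
    (forall g, g \in gs -> P (nth 0 g)) ->
  forall g, g \in elim1 gs v ->
    P (nth 0 g) /\ forall u, (u < m)%N -> contraction v (nth 0 g) u = 0.
Proof.
move=> HP ne negs szgs Hgs g; rewrite (elim1E szgs) // => gin.
have [||Pg Cg] := @elim_inv_rounds P v m m _ HP (leqnn m) _ _ g gin.
- exact: size_augmented.
- move=> u; rewrite mem_rev => /mapP[h hin ->]; have szh := szgs _ hin.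
  have szv := size_values szh ne.
  have Esh : shift (m - 0) (nth 0 (values v h ++ h)) =1 nth 0 h.
    by move=> j; rewrite /shift subn0 nth_cat szv ltnNge leq_addr /= addKn.
  split; first by apply: (HP.1 _ _ (fsym Esh)); exact: Hgs.
  move=> x ltx; rewrite (eq_contraction _ _ Esh) /= subn0 nth_cat szv ltx.
  by rewrite (nth_values szh).
rewrite subnn in Pg Cg; split; first by apply: HP.1 Pg => j.
move=> u ltu; have := Cg u ltu; rewrite ltu; apply: etrans.
by apply: eq_contraction => j.
Qed.

Lemma foldl_elim1_closed P K m L (gs : seq (seq F)) : (0 < L)%N -> lin_closed P ->
    (forall v, v \in K -> size v = L) -> gs <> [::] ->
    (forall g, g \in gs -> size g = (m * L)%N) ->
    (forall g, g \in gs -> P (nth 0 g)) ->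
  forall g, g \in foldl (@elim1 F) gs K ->
    P (nth 0 g) /\ forall v u, v \in K -> (u < m)%N -> contraction v (nth 0 g) u = 0.
Proof.
move=> L_gt0; elim: K P gs => [|v K IH] P gs HP HK negs szgs Hgs g; first by move/Hgs.
have szv : size v = L by rewrite HK ?mem_head.
have nev : v <> [::] by move=> E; rewrite -szv E in L_gt0.
have szgs' h : h \in gs -> size h = (m * size v)%N by rewrite szv; apply: szgs.
have [sz1 sz2] := elim1_size szgs' nev negs.
rewrite /= => gin.
(* The constraint just imposed is added to the property [P], so that the later eliminations preserve
   it. *)
have [|||||[Pg Cv] CK] := IH (fun f => P f /\ forall u, (u < m)%N -> contraction v f u = 0)
   (elim1 gs v) _ _ _ _ _ g gin.
- split=> [f h E [Pf Cf]|f h s [Pf Cf] [Ph Ch]]; split.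
  + exact: HP.1 E Pf.
  + by move=> u ltu; rewrite -(eq_contraction _ _ E) Cf.
  + exact: HP.2.
  + by move=> u ltu; rewrite contraction_sub Cf // Ch // mulr0 subr0.
- by move=> h hin; apply: HK; rewrite inE hin orbT.
- by move=> E; move: sz1; rewrite E; case: (gs) negs.
- by move=> h /sz2; rewrite szv.
- exact: elim1_closed.
split=> // w u; rewrite inE => /orP[/eqP->|]; [exact: Cv | exact: CK].
Qed.

(** For a tensor of order e + 1 in row-major order: [K] annihilates the last two indices, and every
    earlier adjacent pair is treated inside the slices obtained by fixing the last index. *)
Fixpoint constrained n (K : seq (seq F)) e (f : nat -> F) : Prop :=
  if e is e'.+1 then
    (forall i, (i < n.+1)%N -> constrained n K e' (fun p => f (p * n.+1 + i)%N)) /\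
    (forall v u, v \in K -> (u < n.+1 ^ e')%N -> contraction v f u = 0)
  else True.

Lemma constrained_lin n K e : lin_closed (constrained n K e).
Proof.
elim: e => [|e IH] /=; first by split.
split=> [f g E [Hf Cf]|f g s [Hf Cf] [Hg Cg]]; split.
- by move=> i lti; apply: IH.1 (Hf i lti) => p; rewrite E.
- by move=> v u vin ltu; rewrite -(eq_contraction _ _ E) Cf.
- by move=> i lti; apply: IH.2; [exact: Hf | exact: Hg].
- by move=> v u vin ltu; rewrite contraction_sub Cf // Cg // mulr0 subr0.
Qed.

Lemma nth_outer (x y u w : seq F) p j : size u = size x -> size w = size y -> (j < size y)%N ->
  (outerd x y u w)`_(p * size y + j) = x`_p * y`_j - u`_p * w`_j.
Proof.
move=> szu szw ltj; rewrite /outerd.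
elim: x u p szu => [|x0 x IH] [|u0 u] p //= szu.
  by rewrite !nth_nil !mul0r subr0.
have szr : size [seq x0 * q.1 - u0 * q.2 | q <- zip y w] = size y.
  by rewrite size_map size_zip szw minnn.
rewrite nth_cat szr; case: p => [|p].
  rewrite mul0n add0n ltj (nth_map (0, 0)) ?size_zip ?szw ?minnn //.
  by rewrite nth_zip.
rewrite mulSn -addnA ltnNge leq_addr /= addKn IH //.
by case: szu.
Qed.

Lemma gens_at_constrained n cos e g : g \in gens_at n cos e ->
  constrained n (constraints n cos) e (nth 0 g).
Proof.
elim: e g => [|e IH] g //; have [_ ne Hsz] := gens_at_size n cos e.
rewrite -[gens_at n cos e.+1]/(iter_gens (basisv F n) (constraints n cos) (gens_at n cos e)).
rewrite /iter_gens => gin.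
pose P f := forall i, (i < n.+1)%N -> constrained n (constraints n cos) e (fun p => f (p * n.+1 + i)%N).
have HP : lin_closed P.
  split=> [f h E Pf i lti|f h s Pf Ph i lti].
    by apply: (constrained_lin n _ e).1 (Pf i lti) => p; rewrite E.
  by apply: (constrained_lin n _ e).2; [exact: Pf | exact: Ph].
have [_ szE] := size_expand (@size_basisv F n) Hsz.
have szE' h : h \in expand (basisv F n) (gens_at n cos e) -> size h = (n.+1 ^ e * (n.+1 * n.+1))%N.
  by move/szE ->; rewrite expnSr mulnA.
have [||Pg Cg] := foldl_elim1_closed (isT : (0 < n.+1 * n.+1)%N) HP (@size_constraints F n cos)
  (expand_nil _ ne) szE' _ gin.
- by [].
- move=> h; rewrite mem_rev => /flattenP[? /mapP[x xin ->] /mapP[y yin ->]] i lti.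
  have szy := size_basisv yin.
  (* A slice of g ⊗ y is a multiple of g. The scalar y_i is obtained as f - (1 - y_i) f, the only
     kind of combination that [lin_closed] offers. *)
  have Ex := (constrained_lin n (constraints n cos) e).2 _ _ (1 - y`_i) (IH x xin) (IH x xin).
  apply: (constrained_lin n _ e).1 Ex => p.
  rewrite -szy nth_outer ?size_nseq ?szy // nth_nseq if_same mulr0 subr0.
  by ring.
- by split=> // v u vin ltu; apply: Cg.
Qed.

(** The span is formed among coordinate functions because the vectors lose a coordinate in every
    round. *)
Inductive lspan (G : seq (seq F)) : (nat -> F) -> Prop :=
  | lspan0 f : (forall j, f j = 0) -> lspan G f
  | lspanD x g f f' : g \in G -> lspan G f -> (forall j, f' j = x * g`_j + f j) -> lspan G f'.

Lemma lspan_ext G f g : f =1 g -> lspan G f -> lspan G g.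
Proof.
move=> E Hf; case: Hf E => [{}f f0|x h {}f f' hin Hf Ef'] E.
  by apply: lspan0 => j; rewrite -E.
by apply: lspanD hin Hf _ => j; rewrite -E.
Qed.

Lemma lspan_gen G g : g \in G -> lspan G (nth 0 g).
Proof.
move=> gin; apply: (@lspanD _ 1 g (fun=> 0)) => //; first exact: lspan0.
by move=> j; rewrite mul1r addr0.
Qed.

Lemma lspan_comb G x f g : lspan G f -> lspan G g -> lspan G (fun j => x * f j + g j).
Proof.
elim=> [{}f f0|y h {}f f' hin _ IH Ef'] Hg.
  by apply: lspan_ext Hg => j; rewrite f0 mulr0 add0r.
apply: (@lspanD _ (x * y) h _ _ hin (IH Hg)) => j.
by rewrite Ef'; ring.
Qed.

Lemma lspan_map G G' (phi : (nat -> F) -> nat -> F) f :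
    (forall f g, f =1 g -> phi f =1 phi g) ->
    (forall x f g j, phi (fun j => x * f j + g j) j = x * phi f j + phi g j) ->
    (forall g, g \in G -> lspan G' (phi (nth 0 g))) ->
  lspan G f -> lspan G' (phi f).
Proof.
move=> pext plin HG; elim=> [{}f f0|x g {}f f' gin _ IH Ef'].
  (* The value of [phi] at the zero function comes from linearity, by writing f as - f + f. *)
  apply: lspan0 => j; rewrite (pext _ (fun j => - 1 * f j + f j)) ?plin.
    by rewrite mulN1r addNr.
  by move=> i; rewrite f0 mulr0 addr0.
apply: (lspan_ext _ (lspan_comb x (HG g gin) IH)) => j.
by rewrite -plin; apply: pext => i; rewrite Ef'.
Qed.

(** Subtracting (h_0 / p_0) p from h, for the pivot p, and dropping the first coordinate is linear
    in h and sends each generator to its reduction. On [f] it is the mere tail, as f_0 = 0: a round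
    loses no such vector. *)
Lemma lspan_round (gs : seq (seq F)) m f : (forall v, v \in gs -> size v = m.+1) ->
  lspan gs f -> f 0%N = 0 -> lspan (round gs) (fun j => f j.+1).
Proof.
move=> Hgs Hf f0.
pose t (h : nat -> F) := h 0%N / (pivot gs)`_0.
pose phi (h : nat -> F) j := h j.+1 - t h * (pivot gs)`_j.+1.
have : lspan (round gs) (phi f).
  apply: lspan_map Hf => [h1 h2 E j|x h1 h2 j|g gin]; rewrite /phi /t.
  - by rewrite !E.
  - by ring.
  - apply: (lspan_ext _ (lspan_gen (map_f (reduce (pivot gs)) gin))) => j.
    rewrite nth_subs ?nth_behead ?nth0 //.
    case: (pivot_mem gs) => [->|/Hgs szp]; first by right.
    by left; rewrite !size_behead szp Hgs.
by apply: lspan_ext => j; rewrite /phi /t f0 mul0r mul0r subr0.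
Qed.

(** The values prepended to a vector that satisfies the constraint are all zero, so each round only
    strips a zero from it and keeps it in the span. *)
Lemma lspan_elim1 (gs : seq (seq F)) v m f : v <> [::] -> gs <> [::] ->
    (forall g, g \in gs -> size g = (m * size v)%N) ->
    (forall u, (u < m)%N -> contraction v f u = 0) ->
  lspan gs f -> lspan (elim1 gs v) f.
Proof.
move=> ne negs szgs Cf Hf; rewrite (elim1E szgs) //.
pose phi (h : nat -> F) j := if (j < m)%N then contraction v h j else h (j - m)%N.
have Hphi : lspan (rev [seq values v g ++ g | g <- gs]) (phi f).
  apply: lspan_map Hf => [h1 h2 E j|x h1 h2 j|g gin]; rewrite /phi.
  - by rewrite E (eq_contraction _ _ E).
  - case: ifP => // _; rewrite /contraction mulr_sumr -big_split /=.
    by apply: eq_bigr => q _; ring.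
  - have gin' : values v g ++ g \in rev [seq values v g ++ g | g <- gs].
      by rewrite mem_rev; apply: map_f.
    apply: (lspan_ext _ (lspan_gen gin')) => j.
    rewrite nth_cat (size_values (szgs _ gin) ne).
    by case: ifP => // ltj; rewrite (nth_values (szgs _ gin)).
suff H t : (t <= m)%N -> lspan (iter t (@round F) (rev [seq values v g ++ g | g <- gs]))
    (fun j => phi f (t + j)%N).
  apply: lspan_ext (H m (leqnn m)) => j.
  by rewrite /phi ltnNge leq_addr /= addKn.
elim: t => [|t IH] lt; first exact: Hphi.
have szr u : u \in iter t (@round F) (rev [seq values v g ++ g | g <- gs]) ->
    size u = (m * size v + (m - t.+1)).+1.
  apply: (@size_iter_round _ _ ((m * size v + (m - t.+1)).+1) t) => w.
  by move/(size_augmented szgs ne) => ->; lia.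
apply: lspan_ext (lspan_round szr (IH (ltnW lt)) _) => [j|]; first by rewrite addnS.
by rewrite addn0 /phi lt Cf.
Qed.

(** The [e]-th tensor power of [a]: the product of [a] over the [e] digits of [p] in base n + 1,
    extended by zero. *)
Fixpoint tensor (n : nat) (a : nat -> F) (e p : nat) : F :=
  if e is e'.+1 then tensor n a e' (p %/ n.+1)%N * a (p %% n.+1)%N else (p == 0%N)%:R.

Lemma tensor_last2 n a e u b : (b < n.+1 * n.+1)%N ->
  tensor n a e.+2 (u * (n.+1 * n.+1) + b)%N = tensor n a e u * (a (b %/ n.+1)%N * a (b %% n.+1)%N).
Proof.
move=> ltb; rewrite /= mulnA divnMDl // modnMDl mulrA.
by rewrite divnMDl // modnMDl divn_small ?ltn_divLR // addn0 modn_small ?ltn_divLR.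
Qed.

Lemma nth_unitv n i j : (i <= n)%N -> (unitv F n i)`_j = (j == i)%:R.
Proof.
move=> lei; rewrite nth_cat size_nseq nth_nseq; case: (ltngtP j i) => [_|gt|->].
- by [].
- by case: (j - i)%N (subn_gt0 i j) => [|q] /=; rewrite ?gt // nth_nseq if_same.
- by rewrite subnn.
Qed.

Lemma lspan_basis n a : lspan (basisv F n) (tensor n a 1).
Proof.
suff H q : (q <= n.+1)%N -> lspan (basisv F n) (fun p => if (p < q)%N then a p else 0).
  apply: lspan_ext (H n.+1 (leqnn _)) => p /=; case: ltnP => lep.
    by rewrite divn_small // modn_small // eqxx mul1r.
  by rewrite -[_ == _]negbK -lt0n divn_gt0 // lep mul0r.
elim: q => [|q IH] leq; first by apply: lspan0.
apply: (@lspanD _ (a q) (unitv F n q) _ _ _ (IH (ltnW leq))).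
  by apply: map_f; rewrite mem_iota add0n leq.
move=> j; rewrite nth_unitv // ltnS; case: (ltngtP j q) => [_|_|->] /=.
- by rewrite mulr0 add0r.
- by rewrite mulr0 add0r.
- by rewrite mulr1 addr0.
Qed.

Lemma lspan_expand n a (G : seq (seq F)) f :
  lspan G f -> lspan (expand (basisv F n) G) (fun p => f (p %/ n.+1)%N * a (p %% n.+1)%N).
Proof.
apply: (@lspan_map G _ (fun f p => f (p %/ n.+1)%N * a (p %% n.+1)%N)).
- by move=> f1 f2 E p; rewrite E.
- by move=> x f1 f2 j; ring.
move=> g gin; suff H q : (q <= n.+1)%N -> lspan (expand (basisv F n) G)
    (fun p => g`_(p %/ n.+1) * (if (p %% n.+1 < q)%N then a (p %% n.+1)%N else 0)).
  by apply: lspan_ext (H n.+1 (leqnn _)) => p; rewrite ltn_pmod.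
elim: q => [|q IH] leq; first by apply: lspan0 => j; rewrite mulr0.
pose h := outerd g (unitv F n q) g (nseq (size (unitv F n q)) 0).
have szu : size (unitv F n q) = n.+1 by apply: size_unitv.
apply: (@lspanD _ (a q) h _ _ _ (IH (ltnW leq))).
  rewrite mem_rev; apply/flattenP; exists [seq outerd g y g (nseq (size y) 0) | y <- basisv F n].
    exact: (map_f (fun x => [seq outerd x y x (nseq (size y) 0) | y <- basisv F n])).
  apply: (map_f (fun y => outerd g y g (nseq (size y) 0))).
  by apply: map_f; rewrite mem_iota add0n leq.
move=> j; have -> : h`_j = g`_(j %/ n.+1)%N * (j %% n.+1 == q)%N%:R.
  rewrite {1}(divn_eq j n.+1) /h -{2}szu nth_outer ?size_nseq ?szu ?ltn_pmod //.
  by rewrite nth_nseq if_same mulr0 subr0 nth_unitv.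
rewrite ltnS; case: (ltngtP (j %% n.+1)%N q) => [_|_|->] /=; ring.
Qed.

Lemma gens_at_span n cos a e :
    (forall v, v \in constraints n cos ->
       \sum_(b < n.+1 * n.+1) v`_b * (a (b %/ n.+1)%N * a (b %% n.+1)%N) = 0) ->
  lspan (gens_at n cos e) (tensor n a e.+1).
Proof.
move=> Ha; elim: e => [|e IH]; first exact: lspan_basis.
rewrite -[gens_at n cos e.+1]/(iter_gens (basisv F n) (constraints n cos) (gens_at n cos e)).
rewrite /iter_gens.
have [_ ne Hsz] := gens_at_size n cos e.
have [_ szE] := size_expand (@size_basisv F n) Hsz.
have szE' h : h \in expand (basisv F n) (gens_at n cos e) -> size h = (n.+1 ^ e * (n.+1 * n.+1))%N.
  by move/szE ->; rewrite expnSr mulnA.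
have : lspan (expand (basisv F n) (gens_at n cos e)) (tensor n a e.+2).
  by apply: lspan_ext (lspan_expand n a IH) => p.
have : expand (basisv F n) (gens_at n cos e) <> [::] by exact: expand_nil.
have : {subset constraints n cos <= constraints n cos} by [].
(* The list of constraints still to be imposed shrinks, while the full list stays fixed as the one
   that contains them all. *)
elim: {1 3}(constraints n cos) (expand _ _) szE' => [|v K IHK] G szG // sub neG HG.
have szv : size v = (n.+1 * n.+1)%N by apply: size_constraints; apply: sub; rewrite mem_head.
have nev : v <> [::] by move=> E; rewrite E in szv.
have szG' h : h \in G -> size h = (n.+1 ^ e * size v)%N by rewrite szv; apply: szG.
have [sz1 sz2] := elim1_size szG' nev neG.
apply: IHK.
- by move=> h /sz2; rewrite szv.
- by move=> w win; apply: sub; rewrite inE win orbT.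
- by move=> E; move: sz1; rewrite E; case: (G) neG.
apply: (lspan_elim1 nev neG szG') HG => u ltu; rewrite /contraction szv.
transitivity (tensor n a e u *
    \sum_(b < n.+1 * n.+1) v`_b * (a (b %/ n.+1)%N * a (b %% n.+1)%N)); last first.
  by rewrite Ha ?mulr0 //; apply: sub; rewrite mem_head.
rewrite mulr_sumr; apply: eq_bigr => b _; rewrite tensor_last2 //; ring.
Qed.

End Solutions.

(** * Flattening tensors into matrices *)

Section Words.
Variables (F : finFieldType) (n : nat) (cos : seq (nat -> nat -> F)).
Local Open Scope ring_scope.

Notation letters := 'I_n.+1.
Notation word := (seq letters).
Local Notation M := n.+1.
Local Notation K := (constraints n cos).

Definition word_index (w : word) : nat := foldl (fun p (i : letters) => p * M + i)%N 0%N w.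

Lemma word_index_rcons w i : word_index (rcons w i) = (word_index w * M + i)%N.
Proof. by rewrite /word_index -cats1 foldl_cat. Qed.

Lemma word_index_cat w1 w2 :
  word_index (w1 ++ w2) = (word_index w1 * M ^ size w2 + word_index w2)%N.
Proof.
elim/last_ind: w2 => [|w2 i IH]; first by rewrite cats0 expn0 muln1 addn0.
by rewrite -rcons_cat !word_index_rcons IH size_rcons expnSr mulnDl; lia.
Qed.

Lemma word_index_lt w : (word_index w < M ^ size w)%N.
Proof.
elim/last_ind: w => [|w i IH] //; rewrite word_index_rcons size_rcons expnSr.
have lti := ltn_ord i; have : ((word_index w).+1 * M <= M ^ size w * M)%N by rewrite leq_mul2r IH orbT.
by rewrite mulSn; lia.
Qed.

Lemma word_of_index e p : (p < M ^ e)%N -> exists2 w : word, size w = e & word_index w = p.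
Proof.
elim: e p => [|e IH] p; first by rewrite expn0 ltnS leqn0 => /eqP->; exists [::].
rewrite expnSr => ltp; have /IH[w szw Ew] : (p %/ M < M ^ e)%N by rewrite ltn_divLR.
exists (rcons w (Ordinal (ltn_pmod p (ltn0Sn n)))); first by rewrite size_rcons szw.
by rewrite word_index_rcons Ew /= -divn_eq.
Qed.

Lemma sum_pairs (G : nat -> F) :
  \sum_(b < M * M) G b = \sum_(i < M) \sum_(j < M) G (i * M + j)%N.
Proof.
rewrite -(big_mkord xpredT G) big_nat_mul big_mkord; apply: eq_bigr => i _.
rewrite mulSnr -{1}[(i * M)%N]add0n big_addn addKn big_mkord.
by apply: eq_bigr => j _; rewrite addnC.
Qed.

(** Passing to slices removes the letters of [w2] one at a time until the constrained pair is the
    last one. *)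
Lemma constrained_word e f w1 w2 v : constrained n K e f -> (size w1 + size w2).+1 = e ->
    v \in K ->
  \sum_(i : letters) \sum_(j : letters) v`_(i * M + j)%N * f (word_index (w1 ++ i :: j :: w2)) = 0.
Proof.
move=> Hf szw vin; elim/last_ind: w2 e f Hf szw => [|w2 l IH] [|e] f //= [Hf Cf].
  rewrite addn0 => -[szw]; have := Cf v (word_index w1) vin.
  rewrite -szw => /(_ (word_index_lt w1)); apply: etrans.
  rewrite /contraction (size_constraints vin).
  rewrite (sum_pairs (fun b => v`_b * f (word_index w1 * (M * M) + b)%N)).
  apply: eq_bigr => i _; apply: eq_bigr => j _; congr (_ * f _).
  by rewrite word_index_cat /word_index /= expnS expn1; lia.
rewrite size_rcons addnS => -[szw].
have {IH} := IH e _ (Hf l (ltn_ord l)) szw; apply: etrans.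
apply: eq_bigr => i _; apply: eq_bigr => j _; congr (_ * f _).
by rewrite -word_index_rcons rcons_cat.
Qed.

Lemma nth_flatten_rows (r : seq (seq F)) m i j : (forall v, v \in r -> size v = m) -> (j < m)%N ->
  (flatten r)`_(i * m + j) = (nth [::] r i)`_j.
Proof.
elim: r i => [|v r IH] i Hr ltj; first by rewrite !nth_nil.
have szv : size v = m by rewrite Hr ?mem_head.
rewrite /= nth_cat szv; case: i => [|i]; first by rewrite mul0n add0n ltj.
rewrite mulSn -addnA ltnNge leq_addr /= addKn IH // => w win.
by apply: Hr; rewrite inE win orbT.
Qed.

Lemma nth_polyv (co : nat -> nat -> F) (i j : letters) :
  (polyv n co)`_(i * M + j) = if (i < j)%N || (i + j == 0)%N then co i j else 0.
Proof.
rewrite nth_flatten_rows //; last first.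
  by move=> v /mapP[q _ ->]; rewrite size_map size_iota.
by rewrite (nth_map 0%N) ?size_iota // (nth_map 0%N) ?size_iota // !nth_iota.
Qed.

Definition poly_forms (q : letters -> letters -> F) : Prop :=
  exists2 v, v \in map (polyv n) cos & q = (fun i j => v`_(i * M + j)).

Lemma unit_row (x : letters) (j : letters) : (unitv F n x)`_j = (j == x)%:R.
Proof. by rewrite nth_unitv // -ltnS. Qed.

Lemma sum_delta (x y : letters) (G : letters -> letters -> F) :
  \sum_i \sum_j ((i == x)%:R * (j == y)%:R) * G i j = G x y.
Proof.
rewrite (bigD1 x) //= [X in _ + X]big1 => [|i ne]; last first.
  by rewrite big1 // => j _; rewrite (negPf ne) !mul0r.
rewrite addr0 (bigD1 y) //= [X in _ + X]big1 => [|j ne]; last first.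
  by rewrite (negPf ne) mulr0 mul0r.
by rewrite !eqxx !mul1r addr0.
Qed.

Lemma outer_form (x y u w : letters) (G : letters -> letters -> F) :
  \sum_(i : letters) \sum_(j : letters)
    (outerd (unitv F n x) (unitv F n y) (unitv F n u) (unitv F n w))`_(i * M + j)%N * G i j =
  G x y - G u w.
Proof.
have szu (q : letters) : size (unitv F n q) = M by apply: size_unitv; rewrite -ltnS.
rewrite -(sum_delta x y G) -(sum_delta u w G) -sumrB.
apply: eq_bigr => i _; rewrite -sumrB; apply: eq_bigr => j _.
have -> : (i * M + j = i * size (unitv F n y) + j)%N by rewrite szu.
by rewrite nth_outer ?szu // !unit_row; ring.
Qed.

Lemma sym_constraintsP v :
  reflect ((exists x y : letters, v = outerd (unitv F n x) (unitv F n y) (unitv F n y) (unitv F n x)) \/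
      exists x : letters, v = outerd (unitv F n x) (unitv F n x) (unitv F n x) (unitv F n (0%R : letters)))
    (v \in sym_constraints (unitv F n 0) (basisv F n)).
Proof.
have memB (x : letters) : unitv F n x \in basisv F n by apply: map_f; rewrite mem_iota add0n /=.
have memBP b : b \in basisv F n -> exists x : letters, b = unitv F n x.
  by case/mapP => q; rewrite mem_iota add0n => ltq ->; exists (Ordinal ltq).
pose row b : seq (seq F) := rcons [seq outerd b u u b | u <- basisv F n] (outerd b b b (unitv F n 0)).
rewrite /sym_constraints mem_rev; apply: (iffP flattenP) => [[? /mapP[b /memBP[x ->] ->]]|].
  rewrite mem_rcons inE => /orP[/eqP->|/mapP[u /memBP[y ->] ->]]; first by right; exists x.
  by left; exists x, y.
case=> [[x [y ->]]|[x ->]]; exists (row (unitv F n x)); rewrite ?(map_f row) // mem_rcons inE.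
  by apply/orP; right; exact: (map_f (fun u => outerd (unitv F n x) u u (unitv F n x))).
by rewrite eqxx.
Qed.

Lemma constrained_swap e f w1 w2 (x y : letters) : constrained n K e f ->
    (size w1 + size w2).+1 = e ->
  f (word_index (w1 ++ x :: y :: w2)) = f (word_index (w1 ++ y :: x :: w2)).
Proof.
move=> Hf szw; apply/eqP; rewrite -subr_eq0; apply/eqP.
rewrite -(outer_form x y y x (fun i j => f (word_index (w1 ++ i :: j :: w2)))).
apply: constrained_word Hf szw _; rewrite mem_cat; apply/orP; left.
by apply/sym_constraintsP; left; exists x, y.
Qed.

Lemma constrained_bool e f w (x : letters) : constrained n K e f -> (size w).+1 = e ->
  f (word_index (x :: x :: w)) = f (word_index (x :: 0 :: w)).
Proof.
move=> Hf szw; apply/eqP; rewrite -subr_eq0; apply/eqP.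
rewrite -(outer_form x x x 0 (fun i j => f (word_index (i :: j :: w)))).
apply: (constrained_word (w1 := [::]) Hf szw); rewrite mem_cat; apply/orP; left.
by apply/sym_constraintsP; right; exists x.
Qed.

(** Adjacent transpositions suffice: the first letter of [s] is moved to the front of [t] past the
    letters before it, and [u] collects the letters already matched. *)
Lemma swap_perm (z : word -> F) L :
    (forall u i j v, (size u + size v).+2 = L -> z (u ++ i :: j :: v) = z (u ++ j :: i :: v)) ->
  forall s t, perm_eq s t -> size s = L -> z s = z t.
Proof.
move=> Hz; suff H : forall s u t, perm_eq s t -> size (u ++ s) = L -> z (u ++ s) = z (u ++ t).
  by move=> s t; apply: (H s [::] t).
elim=> [|x s IH] u t pst szu.
  by move/perm_size: pst; case: t.
have xt : x \in t by rewrite -(perm_mem pst) mem_head.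
case/splitPr: xt pst => t1 t2 pst.
have pst' : perm_eq s (t1 ++ t2) by rewrite -(perm_cons x) (perm_trans pst) // perm_catC /= perm_cons perm_catC.
have szt := perm_size pst'.
rewrite -cat_rcons (IH _ (t1 ++ t2)) ?cat_rcons //.
have {pst pst' IH} : (size u + size (t1 ++ t2)).+1 = L by move: szu; rewrite size_cat /= szt addnS.
elim: t1 u {szt szu} => [|y t1 IHt] u //= szL.
rewrite Hz; last by rewrite -szL addnS.
by rewrite -cat_rcons IHt ?cat_rcons // size_rcons -szL addnS.
Qed.

Lemma constrained_moments d f : constrained n K d.*2.+1 f ->
  moments poly_forms d (fun w => f (word_index w)).
Proof.
move=> Hf; split.
- move=> s t szs pst; apply: (@swap_perm (fun w => f (word_index w)) d.*2.+2) => //.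
  by move=> u i j v szuv; apply: constrained_swap Hf _; case: szuv => ->.
- by move=> i s szs; apply: constrained_bool Hf _; rewrite szs.
- move=> q [v vin ->] s szs; apply: (constrained_word (w1 := [::]) Hf); first by rewrite /= szs.
  by rewrite mem_cat; apply/orP; right; rewrite mem_rev.
Qed.

Lemma tensor_split (a : nat -> F) e1 e2 p q : (q < M ^ e2)%N ->
  tensor n a (e1 + e2) (p * M ^ e2 + q)%N = tensor n a e1 p * tensor n a e2 q.
Proof.
elim: e2 q => [|e2 IH] q ltq.
  by move: ltq; rewrite expn0 ltnS leqn0 addn0 muln1 => /eqP->; rewrite addn0 /= mulr1.
rewrite addnS /= expnSr mulnA divnMDl // modnMDl IH ?mulrA //.
by rewrite ltn_divLR // -expnSr.
Qed.

(** * The matrix space: no low rank without a solution, rank one with a solution *)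

Section Matrices.
Variable d : nat.
Local Notation N := (M ^ d.+1)%N.
Local Notation gens := (gens_at n cos d.*2.+1).

Definition matrix_of (g : seq F) : 'M[F]_N := \matrix_(i, j) g`_(i * N + j).

Lemma constrained0 e f : (forall j, f j = 0) -> constrained n K e f.
Proof.
elim: e f => //= e IH f f0; split=> [i _|v u _ _]; first exact: IH.
by rewrite /contraction big1 // => q _; rewrite f0 mulr0.
Qed.

Lemma span_constrained A : A \in <<map matrix_of gens>>%VS ->
  exists2 f, constrained n K d.*2.+1 f & forall i j, A i j = f (i * N + j)%N.
Proof.
move=> /(@coord_span _ _ _ (in_tuple (map matrix_of gens)) A) EA; rewrite EA.
have : (forall l, (l < size gens)%N -> constrained n K d.*2.+1 (nth 0 (nth [::] gens l))).
  by move=> l lt; apply: gens_at_constrained; apply: mem_nth.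
move=> Hg.
suff H (c : 'I_(size (map matrix_of gens)) -> F) r :
    exists2 f, constrained n K d.*2.+1 f & forall i j,
      (\sum_(l <- r) c l *: (map matrix_of gens)`_l) i j = f (i * N + j)%N.
  exact: (H (fun l => coord (in_tuple (map matrix_of gens)) l A)).
have lts (l : 'I_(size (map matrix_of gens))) : (l < size gens)%N.
  by apply: leq_trans (ltn_ord l) _; rewrite size_map.
elim: r => [|l r [f Hf Ef]].
  by exists (fun=> 0) => [|i j]; [exact: constrained0 | rewrite big_nil mxE].
exists (fun p => f p - (- c l) * (nth [::] gens l)`_p).
  apply: (constrained_lin n K d.*2.+1).2 => //; exact: Hg.
move=> i j; rewrite big_cons mxE Ef mxE mulNr opprK addrC; congr (_ + _ * _).
by rewrite (nth_map [::]) ?mxE.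
Qed.

Lemma span_no_low_rank k A : (k <= d)%N -> A \in <<map matrix_of gens>>%VS -> A != 0 ->
  (\rank A <= k)%N -> exists a, solution poly_forms a.
Proof.
move=> lekd /span_constrained[f Hf EA] nzA rkA.
have /matrix0Pn[i [j nzij]] := nzA.
have [wi szi Ei] := word_of_index (ltn_ord i); have [wj szj Ej] := word_of_index (ltn_ord j).
apply: (@low_rank_solution _ _ _ k d (fun w => f (word_index w)) (wi ++ wj)) => //.
- exact: constrained_moments.
- apply: leq_trans rkA.
  have wlt (a : 'I_(nwords n d.+1)) : (word_index (enum_val a) < N)%N.
    by have := word_index_lt (enum_val a); rewrite size_tuple.
  pose g a := Ordinal (wlt a).
  (* The moment matrix is [A] with rows and columns re-indexed by words, so its rank is at most that
     of [A]. *)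
  have -> : moment_mx d.+1 (fun w => f (word_index w)) = rowsub g 1%:M *m A *m (rowsub g 1%:M)^T.
    rewrite -rowsubE; apply/trmx_inj; rewrite trmx_mul trmxK -rowsubE.
    by apply/matrixP => x y; rewrite !mxE EA word_index_cat size_tuple.
  by apply: leq_trans (mxrankM_maxl _ _) _; exact: mxrankM_maxr.
- by rewrite size_cat szi szj; lia.
- by rewrite word_index_cat szj Ei Ej -EA.
Qed.

Lemma lspan_matrix f : lspan gens f ->
  (\matrix_(i < N, j < N) f (i * N + j)%N) \in <<map matrix_of gens>>%VS.
Proof.
elim=> [{}f f0|x g {}f f' gin _ IH Ef'].
  have -> : \matrix_(i < N, j < N) f (i * N + j)%N = 0; last exact: mem0v.
  by apply/matrixP => i j; rewrite !mxE f0.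
have -> : \matrix_(i < N, j < N) f' (i * N + j)%N =
    x *: matrix_of g + \matrix_(i < N, j < N) f (i * N + j)%N.
  by apply/matrixP => i j; rewrite !mxE Ef'.
by rewrite memvD // memvZ // memv_span // map_f.
Qed.

Lemma solution_rank1 a : solution poly_forms a ->
  exists A : 'M[F]_N, [/\ A \in <<map matrix_of gens>>%VS, A != 0 & \rank A = 1%N].
Proof.
move=> [a0 a01 aq]; pose b (i : nat) : F := a (inord i).
have bE (i : letters) : b i = a i by rewrite /b inord_val.
have Hb v : v \in K -> \sum_(c < M * M) v`_c * (b (c %/ M)%N * b (c %% M)%N) = 0.
  rewrite (sum_pairs (fun c => v`_c * (b (c %/ M)%N * b (c %% M)%N))) => vin.
  transitivity (\sum_(i < M) \sum_(j < M) v`_(i * M + j) * (a i * a j)).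
    apply: eq_bigr => i _; apply: eq_bigr => j _.
    by rewrite divnMDl // modnMDl divn_small // modn_small // addn0 !bE.
  move: vin; rewrite mem_cat => /orP[|]; last first.
    by rewrite mem_rev => vin; apply: (aq (fun i j => v`_(i * M + j))); exists v.
  case/sym_constraintsP => [[x [y ->]]|[x ->]].
    by rewrite (outer_form x y y x (fun i j => a i * a j)) mulrC subrr.
  rewrite (outer_form x x x 0 (fun i j => a i * a j)) a0 mulr1.
  by case: (a01 x) => ->; rewrite ?mulr0 ?mulr1 ?subrr ?subr0.
pose f := tensor n b d.*2.+2.
have Hspan : (\matrix_(i < N, j < N) f (i * N + j)%N) \in <<map matrix_of gens>>%VS.
  exact/lspan_matrix/gens_at_span.
have fE (i j : 'I_N) : f (i * N + j)%N = tensor n b d.+1 i * tensor n b d.+1 j.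
  by rewrite -tensor_split // addnn doubleS.
set A := \matrix_(i < N, j < N) f (i * N + j)%N in Hspan *.
have nzA : A != 0.
  have N_gt0 : (0 < N)%N by rewrite expn_gt0.
  apply/matrix0Pn; exists (Ordinal N_gt0), (Ordinal N_gt0); rewrite mxE fE.
  have t0 e : tensor n b e 0 = 1.
    by elim: e => [|e IH] //=; rewrite div0n mod0n IH mul1r (bE 0).
  by rewrite t0 mulr1 oner_eq0.
exists A; split=> //; apply/eqP; rewrite eqn_leq lt0n mxrank_eq0 nzA andbT.
have -> : A = (\col_i tensor n b d.+1 i) *m (\row_j tensor n b d.+1 j).
  by apply/matrixP => i j; rewrite !mxE fE big_ord1 !mxE.
by apply: leq_trans (mxrankM_maxl _ _) _; exact: rank_leq_col.
Qed.
End Matrices.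

End Words.

Local Open Scope ring_scope.

(** With n = 0 the matrices are 1 by 1 and the rank carries no information. But each form is then a
    constant whose product with the single entry vanishes, so a nonzero entry forces all the
    constants to be zero. *)
Lemma span_solution0 (F : finFieldType) (cos : seq (nat -> nat -> F)) A :
    A \in <<map (matrix_of (F := F) 0 0) (gens_at 0 cos 1)>>%VS -> A != 0 ->
  exists a, solution (poly_forms (n := 0) cos) a.
Proof.
move=> /span_constrained[f Hf EA] nzA; have [_ _ mq] := constrained_moments (d := 0) Hf.
exists (fun=> 1); split=> // [i|q /mq/(_ [::] erefl)]; first by right.
rewrite !big_ord_recr !big_ord0 /= !add0r mulr1 mulr1 => /eqP; rewrite mulf_eq0.
case/orP=> [/eqP //|/eqP f0]; case/eqP: nzA; apply/matrixP => i j; rewrite mxE EA.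
suff -> : f (i * 0.+1 ^ 1 + j)%N = 0 by [].
by move: f0; case: i j => [[|i] lti] [[|j] ltj].
Qed.

(** * Evaluation of square-free quadratic polynomials *)

Local Open Scope ring_scope.

(** Letter 0 is the monomial 1, and letter l + 1 is the variable of index l. *)
Definition letter_mnm n (i : nat) : 'X_{1..n} := [multinom (i == l.+1 :> nat) : nat | l < n].

Lemma letter_mnm0 n : letter_mnm n 0 = 0%MM.
Proof. by apply/mnmP => l; rewrite !mnmE. Qed.

Lemma letter_mnmS n (i : 'I_n) : letter_mnm n i.+1 = mnm1 i.
Proof. by apply/mnmP => l; rewrite !mnmE eqSS eq_sym. Qed.

Lemma filter_lt_iota i n : (i < n)%N -> [seq j <- iota 0 n | (i < j)%N] = iota i.+1 (n - i.+1).
Proof.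
move=> lt; rewrite -{1}(subnKC lt) iotaD add0n filter_cat.
rewrite (eq_in_filter (a2 := pred0)) => [|j]; last by rewrite mem_iota ltnS => /andP[_ le]; rewrite ltnNge le.
rewrite filter_pred0 (eq_in_filter (a2 := predT)) ?filter_predT // => j.
by rewrite mem_iota => /andP[].
Qed.

(** With letter 0 for 1, the linear monomials are the pairs (0, j), so linear and quadratic
    monomials form a single list of pairs i < j. *)
Lemma sqfree_monomialsE n : sqfree_monomials n =
  (letter_mnm n 0 + letter_mnm n 0)%MM ::
  flatten [seq [seq (letter_mnm n i + letter_mnm n j)%MM | j <- iota i.+1 (n - i)] | i <- iota 0 n.+1].
Proof.
rewrite /sqfree_monomials /= letter_mnm0 addm0 subn0; congr (_ :: _ ++ _).
  rewrite -[iota 1 n]/(iota (1 + 0) n) iotaDl -map_comp -val_enum_ord -map_comp.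
  by apply: eq_map => i /=; rewrite add1n letter_mnmS add0m.
rewrite filter_flatten map_flatten -2!map_comp; congr flatten.
rewrite -[iota 1 n]/(iota (1 + 0) n) iotaDl -val_enum_ord -2![RHS]map_comp; apply: eq_map => i /=; rewrite add1n filter_map -map_comp.
rewrite -[iota i.+2 _]/(iota (1 + i.+1) _) iotaDl -filter_lt_iota // -val_enum_ord filter_map -!map_comp.
by apply: eq_map => j /=; rewrite add1n !letter_mnmS.
Qed.

Lemma mem_sqfree_monomials n (m : 'X_{1..n}) :
  [forall i, (m i <= 1)%N] && (mdeg m <= 2)%N -> m \in sqfree_monomials n.
Proof.
move=> /andP[/forallP m1 m2]; rewrite inE mem_cat; case: (altP eqP) => //= m0.
have pick (p : 'X_{1..n}) : p != 0%MM -> exists2 i, (0 < p i)%N & exists2 q, p = (mnm1 i + q)%MM & mdeg p = (mdeg q).+1.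
  move=> p0; have /existsP[i pi] : [exists i, (0 < p i)%N].
    apply: contraR p0 => /existsPn p0; apply/eqP/mnmP => i; rewrite mnm0E.
    by apply/eqP; have := p0 i; rewrite lt0n negbK.
  have le : (mnm1 i <= p)%MM by apply/mnm_lepP => j; rewrite mnm1E; case: eqP => [<-|].
  exists i => //; exists (p - mnm1 i)%MM; first by rewrite addmC submK.
  by rewrite -{1}(submK le) mdegD mdeg1 addn1.
have [i mi [q Em Eq]] := pick _ m0; have [Eq0|q0] := eqVneq q 0%MM.
  by rewrite Em Eq0 addm0 map_f // mem_enum.
have [j qj [r Er Dr]] := pick _ q0.
have r0 : r = 0%MM by apply/eqP; rewrite -mdeg_eq0; move: m2; rewrite Eq Dr; case: (mdeg r).
rewrite r0 addm0 in Er; rewrite Er in Em; apply/orP; right.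
have ne : (i != j :> nat).
  apply/eqP => /val_inj ij; have := m1 i; rewrite Em ij mnmDE mnm1E eqxx; lia.
wlog lt : i j Em ne {mi qj Er} / (i < j)%N => [H|].
  case: (ltngtP i j) (ne) => // lt _; first exact: (H i j).
  by apply: (H j i) => //; rewrite 1?addmC // eq_sym.
rewrite Em; apply/mapP; exists (i, j) => //; rewrite mem_filter /= lt.
by apply/allpairsP; exists (i, j); rewrite !mem_enum.
Qed.

Lemma uniq_sqfree_monomials n : uniq (sqfree_monomials n).
Proof.
rewrite /sqfree_monomials cons_uniq mem_cat cat_uniq; apply/and4P; split.
- apply/norP; split; apply/mapP => -[i _ /(congr1 (@mdeg n))].
    by rewrite mdeg0 mdeg1.
  by rewrite mdegD !mdeg1 mdeg0.
- rewrite map_inj_uniq ?enum_uniq // => i j /mnmP/(_ i).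
  by rewrite !mnm1E eqxx; case: eqP.
- apply/hasPn => m /mapP[[i j] _ ->]; apply/mapP => -[l _ /(congr1 (@mdeg n))].
  by rewrite mdegD !mdeg1.
rewrite map_inj_in_uniq; last first.
  move=> [i j] [i' j']; rewrite !mem_filter /= => /andP[lt _] /andP[lt' _] /mnmP E.
  have := E i; have := E j; have := E i'; have := E j'; rewrite !mnmDE !mnm1E !eqxx /=.
  have v (a b : 'I_n) : (a == b) = (a == b :> nat) by [].
  rewrite !v => *; congr pair; apply: val_inj => /=; lia.
by rewrite filter_uniq // allpairs_uniq ?enum_uniq // => -[? ?] [? ?].
Qed.

Section Evaluation.
Variables (F : finFieldType) (n : nat).

Definition mnm_val (v : 'I_n -> F) (m : 'X_{1..n}) := \prod_i v i ^+ m i.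

Lemma mnm_valD v m1 m2 : mnm_val v (m1 + m2)%MM = mnm_val v m1 * mnm_val v m2.
Proof. by rewrite -big_split; apply: eq_bigr => i _; rewrite mnmDE exprD. Qed.

Lemma mnm_val_letter0 v : mnm_val v (letter_mnm n 0) = 1.
Proof. by apply: big1 => i _; rewrite letter_mnm0 mnm0E. Qed.

Lemma mnm_val_letterS v (i : 'I_n) : mnm_val v (letter_mnm n i.+1) = v i.
Proof.
rewrite letter_mnmS /mnm_val (bigD1 i) //= big1 => [|j ne]; first by rewrite mnm1E eqxx mulr1.
by rewrite mnm1E eq_sym (negPf ne).
Qed.

Definition coef2 (f : {mpoly F[n]}) (i j : nat) : F := f@_(letter_mnm n i + letter_mnm n j)%MM.

Lemma coefv_coef2 f : coefv n (coef2 f) = [seq f@_m | m <- sqfree_monomials n].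
Proof.
rewrite sqfree_monomialsE map_cons map_flatten -map_comp; congr (_ :: flatten _).
by apply: eq_map => i /=; rewrite -map_comp.
Qed.

Lemma meval_sqfree f v : sqfree_deg2 f ->
  f.@[v] = \sum_(m <- sqfree_monomials n) f@_m * mnm_val v m.
Proof.
move=> /allP sqf; rewrite mevalE /mnm_val.
rewrite [RHS](bigID (mem (msupp f))) /= [X in _ + X]big1 => [|m mf]; last first.
  by rewrite memN_msupp_eq0 ?mul0r.
rewrite addr0 -[RHS]big_filter; apply: perm_big; apply: uniq_perm.
- exact: msupp_uniq.
- by rewrite filter_uniq // uniq_sqfree_monomials.
move=> m; rewrite mem_filter; case: (boolP (m \in msupp f)) => //= mf.
by rewrite mem_sqfree_monomials // sqf.
Qed.

Lemma meval_coef2 f v : sqfree_deg2 f ->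
  f.@[v] = \sum_(i < n.+1) \sum_(j < n.+1)
    (polyv n (coef2 f))`_(i * n.+1 + j)%N * (mnm_val v (letter_mnm n i) * mnm_val v (letter_mnm n j)).
Proof.
move=> sqf; rewrite meval_sqfree // sqfree_monomialsE big_cons big_flatten big_map.
pose g (i j : nat) := coef2 f i j * (mnm_val v (letter_mnm n i) * mnm_val v (letter_mnm n j)).
transitivity (\sum_(i < n.+1) \sum_(j < n.+1)
    ((if (i < j)%N then g i j else 0) + (if (i + j == 0)%N then g i j else 0))); last first.
  apply: eq_bigr => i _; apply: eq_bigr => j _; rewrite nth_polyv.
  by case: ltnP => /= lt; case: eqP => e0; rewrite ?addr0 ?add0r ?mul0r // ; lia.
under [RHS]eq_bigr => i _ do rewrite big_split.
rewrite big_split addrC; congr (_ + _).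
  rewrite -[iota 0 n.+1]/(index_iota 0 n.+1) big_mkord; apply: eq_bigr => i _.
  rewrite big_map -big_mkcond -(big_geq_mkord i.+1 n.+1 xpredT (fun j => g i j)) /index_iota subSS.
  by apply: eq_bigr => j _; rewrite mnm_valD.
rewrite big_ord_recl big_ord_recl /= !big1 ?addr0 => //; first by rewrite mnm_valD.
Qed.

Lemma bool_sat_solution (fs : seq {mpoly F[n]}) : all (@sqfree_deg2 F n) fs ->
  bool_sat fs <-> exists a, solution (poly_forms (n := n) (map coef2 fs)) a.
Proof.
move=> /allP sqf; split=> [[b satb]|[a [a0 a01 aq]]].
  pose v i : F := (b i)%:R; pose a (i : 'I_n.+1) := mnm_val v (letter_mnm n i).
  exists a; split=> [|i|q [w win ->]].
  - exact: mnm_val_letter0.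
  - rewrite /a; case: (unliftP ord0 i) => [j|] ->; last by right; apply: mnm_val_letter0.
    by rewrite lift0 mnm_val_letterS /v; case: (b j); [right | left].
  - move: win; rewrite -map_comp => /mapP[f fin ->].
    by rewrite -[RHS](satb f fin) meval_coef2 ?sqf.
exists (fun i => a (lift ord0 i) != 0) => f fin.
have wq : poly_forms (map coef2 fs) (fun i j : 'I_n.+1 => (polyv n (coef2 f))`_(i * n.+1 + j)%N).
  exists (polyv n (coef2 f)) => //; rewrite -map_comp.
  exact: (map_f (polyv n \o coef2)).
rewrite meval_coef2 ?sqf // -[RHS](aq _ wq).
have E (i : 'I_n.+1) : mnm_val (fun i => (a (lift ord0 i) != 0)%:R) (letter_mnm n i) = a i.
  case: (unliftP ord0 i) => [j|] ->; last by rewrite mnm_val_letter0 a0.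
  by rewrite lift0 mnm_val_letterS; case: (a01 (lift ord0 j)) => ->; rewrite ?eqxx ?oner_eq0.
by apply: eq_bigr => i _; apply: eq_bigr => j _; rewrite !E.
Qed.

End Evaluation.

(** * The complete program *)

Local Close Scope ring_scope.

Section Machine.
Variable F : finFieldType.

Notation "p ;; q" := (Seq p q) (at level 60, right associativity).

Lemma wf_seq R p q : wf_prog R p -> wf_prog R q -> wf_prog R (p ;; q).
Proof. by move=> wfp wfq; rewrite /= wfp. Qed.

Lemma wf_skip R : wf_prog R Skip. Proof. by []. Qed.

Lemma wf_main : wf_prog 21 (main_prog F).
Proof.
rewrite /main_prog /constraints_prog /rows_prog /row_prog /poly_prog /each /rows_prog /row_prog.
rewrite /sym_prog /each /step_prog /prep_bool /prep_sym /outer_prog.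
rewrite /iter_prog /expand_prog /each /step_prog /prep_expand /outer_prog.
rewrite /elim_prog /each /augment_prog /each /contract_prog /round_prog /pivot_prog /reduce_prog.
rewrite /sub_prog /count_prog /vec /vec2 /cp /mv /clr.
by repeat match goal with
  | |- is_true (wf_prog _ Skip) => exact: wf_skip
  | |- is_true (wf_prog _ (Seq _ _)) => apply: wf_seq
  | |- is_true (wf_prog _ (push_tok _ _)) => exact: wf_push
  | |- is_true (wf_prog _ (case_tok _ _ _)) => apply: wf_case; [by []| |move=> ?]
  | |- is_true (wf_prog _ (while_tok _ _ _)) => apply: wf_while => // ?
  | |- is_true (wf_prog _ (if _ then _ else _)) => case: ifP => _
  | t : option _ |- is_true (wf_prog _ (match ?t with _ => _ end)) => case: t
  end.
Qed.

Definition pushes r k : prog := iter k (Seq (push_tok r (@None F))) Skip.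

(** The unary prefix of the input becomes the variable counter in register 1, and the separator is
    popped; what is left in register 0 is the token code of the polynomials. *)
Definition strip_prog : prog := While 0 (fun a => a == None) (fun _ => Push 1 (Some false)).

(** The counters are set to d and d + 1: the matrix size is read off at tensor order d + 1 and the
    final order is 2(d + 1). Here d is [k], or 0 if register 1 is empty. *)
Definition init_prog k : prog :=
  case_tok (F := F) 1 (push_tok 19 (@None F)) (fun t =>
    push_tok 1 t ;; pushes 18 k ;; pushes 19 k.+1).

Definition unary_prog : prog :=
  Push 0 None ;; While 20 (fun _ => false) (fun _ => Push 0 (Some true)).

Definition total_prog k : prog := strip_prog ;; init_prog k ;; main_prog F ;; unary_prog.

Lemma wf_pushes R r k : r < R -> wf_prog R (pushes r k).
Proof. by move=> lt; elim: k => //= k ->; rewrite lt. Qed.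

Lemma wf_total k : wf_prog 21 (total_prog k).
Proof.
apply: wf_seq => //; apply: wf_seq; last by apply: wf_seq => //; exact: wf_main.
apply: wf_case => // t; apply: wf_seq; first exact: wf_push.
by apply: wf_seq; apply: wf_pushes.
Qed.

Lemma run_transfer B r (stop : pred letter) d a b m w (st : regs) : r != d ->
    r < size st -> d < size st -> stop a = false -> (if w is x :: _ then stop x else true) ->
    nth [::] st r = nseq m a ++ w -> m <= B ->
  run B (While r stop (fun _ => Push d b)) st =
  Some (set_nth [::] (set_nth [::] st r (behead w)) d (nseq m b ++ nth [::] st d)).
Proof.
move=> ne ltr ltd sa sw.
pose f (_ : letter) (st' : regs) := Some (set_nth [::] st' d (b :: nth [::] st' d)).
rewrite -[run _ _ _]/(wloop r stop f B st); move: B => B'.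
elim: m B' st ltr ltd => [|m IH] k st ltr ltd Er lek.
  have Est : nth [::] (set_nth [::] st r (behead w)) d = nth [::] st d.
    by rewrite nth_set_nth /= eq_sym (negPf ne).
  have -> : wloop r stop f k st = Some (set_nth [::] st r (behead w)).
    case: w sw Er {Est} => [_|x w sx] /= Er; last by case: k {lek} => [|k] /=; rewrite Er sx.
    have -> : set_nth [::] st r [::] = st; last by case: k {lek} => [|k] /=; rewrite Er.
    apply: (@eq_from_nth _ [::]) => [|i _]; first by rewrite size_set_nth; apply/maxn_idPr.
    by rewrite nth_set_nth /=; case: eqP => [->|].
  congr Some; rewrite /= -Est; apply: (@eq_from_nth _ [::]) => [|i _].
    by rewrite !size_set_nth; apply/esym/maxn_idPr; rewrite leq_max ltd orbT.
  by rewrite [RHS]nth_set_nth /=; case: eqP => [->|].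
case: k lek => // k lek; rewrite /= Er /= sa /= IH; last first.
- by [].
- by rewrite nth_set_nth /= (negPf ne) nth_set_nth /= eqxx.
- by rewrite !size_set_nth !leq_max ltd ?orbT.
- by rewrite !size_set_nth !leq_max ltr ?orbT.
congr Some; apply: (@eq_from_nth _ [::]) => [|i _].
  by rewrite !size_set_nth; lia.
have dr : (d == r) = false by rewrite eq_sym (negPf ne).
rewrite !nth_set_nth /= !nth_set_nth /= !nth_set_nth /= eqxx dr; case: (eqVneq i d) => // _.
  by rewrite -cat_rcons -cats1 -(nseqD m 1) addn1.
by case: eqP => // ne1; rewrite nth_set_nth /=; case: eqP ne1.
Qed.

Lemma enc_blank n : enc (nseq n (@None F)) = nseq n (Some false).
Proof. by elim: n => //= n IH; rewrite /enc /= -/(enc _) IH. Qed.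

Lemma run_pushes B r k (st : seq (seq (option F))) : r < size st ->
  run B (pushes r k) (enc_st st) = Some (enc_st (set_nth [::] st r (nseq k None ++ nth [::] st r))).
Proof.
elim: k st => [|k IH] st lt; first by rewrite run_skip /= set_nth_id.
rewrite [pushes _ _]/= (run_then _ (run_push _ _ _ _)) IH; last by rewrite size_set_nth leq_max lt orbT.
by rewrite set_nth_eq nth_set_eq -cat_rcons -cats1 -(nseqD k 1) addn1.
Qed.

Arguments pushes : simpl never.

(* Without variables the time bound leaves no room for [k], but matrices of size 1 suffice. *)
Definition rounds1 n k := if n is 0 then 0 else k.

Lemma run_init B n k (g : seq (option F)) :
  run B (init_prog k) (enc_st [:: g, nseq n None & nseq 19 [::]]) =
  Some (enc_st [:: g; nseq n None; [::]; [::]; [::]; [::]; [::]; [::]; [::]; [::]; [::]; [::]; [::];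
    [::]; [::]; [::]; [::]; [::]; nseq (rounds1 n k) None; nseq ((rounds1 n k).+1) None; [::]]).
Proof.
rewrite /init_prog run_case; case: n => [|n] /=; first by rewrite run_push.
by rewrite (run_then _ (run_push _ _ _ _)) (run_then _ (run_pushes _ _ _)) //= run_pushes //= !cats0.
Qed.

Lemma run_strip B n (g : seq (option F)) : n <= B ->
  run B strip_prog ((nseq n (Some true) ++ None :: enc g) :: nseq 20 [::]) =
  Some (enc_st [:: g, nseq n None & nseq 19 [::]]).
Proof.
move=> len; rewrite [LHS](run_transfer (a := Some true) _ (m := n) (w := None :: enc g)) //.
by rewrite /enc_st /= enc_blank cats0.
Qed.

Lemma run_total B n k (cos : seq (nat -> nat -> F)) :
    let E := rounds1 n k + (rounds1 n k).+1 in let N := n.+1 ^ (rounds1 n k).+1 in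
    3 * n.+1 ^ (2 * E.+1) <= B -> size (eG (constraints n cos)) <= B ->
    size cos <= B -> rounds1 n k <= B -> (rounds1 n k).+1 <= B ->
    (forall v, v \in map (coefv n) cos -> size v <= B) ->
  exists st, head [::] st = nseq N (Some true) ++ None :: enc (eG (gens_at n cos E)) /\
  run B (total_prog k) ((nseq n (Some true) ++ None :: enc (eG (map (coefv n) cos))) :: nseq 20 [::])
    = Some st.
Proof.
move=> E N leE leK lecs lek1 lek2 lec.
have leM q : 0 < q -> q <= 2 * E.+1 -> n.+1 ^ q <= B.
  move=> q0 leq; apply: leq_trans leE; apply: (@leq_trans (n.+1 ^ (2 * E.+1))).
    exact: leq_pexp2l.
  by rewrite mulSn leq_addr.
have len : n <= B by have := leM 1 isT isT; rewrite expn1; lia.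
rewrite /total_prog (run_then _ (run_strip _ len)).
rewrite (run_then _ (run_init _ _ _ _)).
have [st [E0 [E20 Em]]] := run_main leE leK lecs lek1 lek2 lec.
rewrite (run_then _ Em) /unary_prog.
have N_gt0 : 0 < N by rewrite expn_gt0.
have szst : 20 < size st.
  by rewrite ltnNge; apply/negP => le; move: E20; rewrite nth_default // -/N; case: (N) N_gt0.
pose st1 := set_nth [::] (enc_st st) 0 (None :: nth [::] (enc_st st) 0).
have szst1 : 20 < size st1 by rewrite size_set_nth leq_max size_map szst orbT.
rewrite (@run_then _ _ _ _ st1) // (run_transfer (a := Some false) _ (m := N) (w := [::])) //.
- eexists; split; last reflexivity.
  by rewrite -nth0 !nth_set_nth /= enc_st_nth nth0 E0.
- by apply: leq_trans szst1.
- by rewrite /st1 nth_set_nth /= enc_st_nth E20 enc_blank cats0.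
- apply: leM => //; rewrite /E; lia.
Qed.

End Machine.

(** * Encodings *)

Section Encodings.
Variable F : finFieldType.
Local Notation sym_map := (map sym_of_letter).

Lemma sym_of_enc_ev (v : seq F) : sym_map (enc (ev v)) = rcons (flatten (map (@enc_elt F) v)) S0.
Proof.
elim: v => //= x v IH; rewrite rcons_cat -IH /enc /= map_cat; congr (_ ++ _).
by rewrite map_rcons map_nseq.
Qed.

Lemma sym_of_enc_eG (G : seq (seq F)) :
  sym_map (enc (eG G)) = flatten [seq rcons (flatten (map (@enc_elt F) v)) S0 | v <- G].
Proof.
elim: G => //= v G IH; rewrite eG_cons /enc map_cat flatten_cat map_cat -!/(enc _) IH.
by rewrite sym_of_enc_ev.
Qed.

Lemma sym_of_unary k w : sym_map (nseq k (Some true) ++ None :: w) = enc_nat k ++ sym_map w.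
Proof. by rewrite map_cat map_nseq /= -cat_rcons. Qed.

Lemma enc_instanceE n (fs : seq {mpoly F[n]}) : enc_instance fs =
  sym_map (nseq n (Some true) ++ None :: enc (eG (map (coefv n) (map (@coef2 F n) fs)))).
Proof.
rewrite sym_of_unary sym_of_enc_eG -!map_comp /enc_instance; congr (_ ++ flatten _).
by apply: eq_map => f; rewrite /comp coefv_coef2 -map_comp.
Qed.

Lemma allpairs_row_major (X : Type) (h : nat -> X) r m :
  [seq h (i * m + j) | i : 'I_r <- enum 'I_r, j : 'I_m <- enum 'I_m] = map h (iota 0 (r * m)).
Proof.
transitivity (flatten [seq [seq h (i * m + j) | j <- iota 0 m] | i <- iota 0 r]).
  rewrite -[iota 0 r]val_enum_ord; congr flatten; rewrite -[RHS]map_comp; apply: eq_map => i.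
  by rewrite /= -[iota 0 m]val_enum_ord -[RHS]map_comp.
elim: r => [|r IH] //; rewrite iota_rcons map_rcons flatten_rcons IH add0n mulSnr iotaD map_cat.
by congr (_ ++ _); rewrite add0n -[r * m in RHS]addn0 iotaDl -[RHS]map_comp.
Qed.

(** A matrix is written row by row, which is the order of the coordinates of the flattened tensor,
    so the generators are output as they stand. *)
Lemma enc_subspaceE n d (G : seq (seq F)) : let N := n.+1 ^ d.+1 in
    (forall g, g \in G -> size g = N * N) ->
  enc_subspace (map (matrix_of n d) G) = sym_map (nseq N (Some true) ++ None :: enc (eG G)).
Proof.
move=> N szG; rewrite sym_of_unary sym_of_enc_eG /enc_subspace -map_comp; congr (_ ++ flatten _).
apply/eq_in_map => g gin /=; rewrite /enc_matrix; congr (rcons (flatten _) _).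
transitivity [seq enc_elt (nth 0%R g (i * N + j)) | i : 'I_N <- enum 'I_N, j : 'I_N <- enum 'I_N].
  by congr flatten; apply: eq_map => i; apply: eq_map => j; rewrite mxE.
rewrite (allpairs_row_major (fun p => enc_elt (nth 0%R g p))) -(szG g gin).
by rewrite -[g in RHS](mkseq_nth 0%R) /mkseq -map_comp.
Qed.

End Encodings.

(** * Running time *)

Section Time.
Variable F : finFieldType.

Lemma size_constraint_list n (cos : seq (nat -> nat -> F)) :
  size (constraints n cos) = n.+1 * n.+2 + size cos.
Proof.
rewrite size_cat !size_rev size_map size_flatten /shape -map_comp; congr addn.
rewrite (@eq_map _ _ _ (fun=> n.+2)).
  by rewrite sumnE big_map big_const_seq count_predT iter_addn_0 size_map size_iota mulnC.
by move=> v /=; rewrite size_rcons !size_map size_iota.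
Qed.

Lemma size_polyv n (co : nat -> nat -> F) : size (polyv n co) = n.+1 * n.+1.
Proof.
by apply: (@size_constraints _ _ [:: co]); rewrite mem_cat mem_rev mem_head orbT.
Qed.

(** As k >= 1, the exponent 12 k covers both 2(E+1) <= 4 k + 4 and the exponent 4 of the
    constraints. The latter number at most 3 I (n+1)^2 and take at most 2 (n+1)^2 tokens each,
    whence the factor 6. *)
Lemma fuel_bounds n k (cos : seq (nat -> nat -> F)) I : 0 < k -> 0 < I -> size cos <= I ->
    let E := rounds1 n k + (rounds1 n k).+1 in let B := 6 * (I * n.+1 ^ (12 * k)) in
  [/\ 3 * n.+1 ^ (2 * E.+1) <= B, size (eG (constraints n cos)) <= B, size cos <= B,
      rounds1 n k < B & forall v, v \in map (coefv n) cos -> size v <= B].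
Proof.
move=> k_gt0 I_gt0 lecs E B.
have leM q : q <= 12 * k -> n.+1 ^ q <= n.+1 ^ (12 * k) by move=> leq; exact: leq_pexp2l.
have P_gt0 : 0 < n.+1 ^ (12 * k) by rewrite expn_gt0.
have leIM q : q <= 12 * k -> n.+1 ^ q <= I * n.+1 ^ (12 * k).
  by move/leM => le; apply: leq_trans le _; rewrite leq_pmull.
have lek : rounds1 n k <= k by rewrite /rounds1; case: (n).
have lek' : rounds1 n k <= n.+1 ^ (12 * k).
  rewrite /rounds1; case: (n) => // m; apply: ltnW; apply: leq_trans (ltn_expl k (isT : 1 < m.+2)) _.
  by apply: leq_pexp2l => //; lia.
have le4 : n.+1 ^ 4 <= n.+1 ^ (12 * k) by apply: leM; lia.
split.
- apply: leq_mul => //; apply: leIM; rewrite /E; lia.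
- rewrite (size_eG_const (@size_constraints _ n cos)) size_constraint_list.
  have sq : n.+1 ^ 4 = (n.+1 * n.+1) * (n.+1 * n.+1) by rewrite !expnS expn0; lia.
  have := leq_mul (leqnn I) le4; rewrite sq -/B.
  have le1 : n.+1 * n.+2 + size cos <= I * (3 * (n.+1 * n.+1)) by nia.
  have le2 : (n.+1 * n.+1).+1 <= 2 * (n.+1 * n.+1) by lia.
  have := leq_mul le1 le2; rewrite /B; nia.
- by apply: leq_trans lecs _; rewrite /B; nia.
- rewrite /B; nia.
have: size (map (coefv n) cos) = size cos by rewrite size_map.
move=> _ v; elim: cos {lecs} => //= co cos IH; rewrite inE => /orP[/eqP->|/IH //].
apply: leq_trans (size_coefv _ _) _; rewrite size_polyv.
have le2 : n.+1 ^ 2 <= n.+1 ^ (12 * k) by apply: leM; lia.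
have := leIM 2; rewrite expnS expn1 /B; lia.
Qed.

Definition fixed_prog : prog := Seq strip_prog (Seq (main_prog F) unary_prog).

Lemma scost_pushes B r k : scost B (pushes F r k) = k.
Proof. by elim: k => //= k; rewrite /pushes /= => ->. Qed.

Lemma cost_seq B p q st st1 : run B p st = Some st1 ->
  cost B (Seq p q) st = cost B p st + cost B q st1.
Proof. by rewrite /= => ->. Qed.

Lemma scost_seq B p q : scost B (Seq p q) = scost B p + scost B q.
Proof. by []. Qed.

Lemma cost_seq_le B p q st : cost B (Seq p q) st <= cost B p st + scost B q.
Proof. by rewrite /= leq_add2l; case: (run B p st) => // st1; exact: cost_le. Qed.

Lemma cost_case B r pe f st : cost B (Case r pe f) st =
  2 + (if nth [::] st r is a :: w then cost B (f a) (set_nth [::] st r w) else cost B pe st).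
Proof. by []. Qed.

(** For n = 0 no push depends on [k]; otherwise there are 2 k + 2 pushes, and k < 2^k lets a power
    of n + 1 absorb them. *)
Lemma cost_init B n k (g : seq (option F)) : 0 < k ->
  cost B (init_prog F k) (enc_st [:: g, nseq n None & nseq 19 [::]]) <= 4 * n.+1 ^ (12 * k).
Proof.
move=> k_gt0; rewrite /init_prog cost_case enc_st_nth [nth _ _ 1]/=.
case: n => [|n]; first by rewrite exp1n.
have [a [s [[<- <-] ->]]] := enc_cons (@None F) (nseq n None).
rewrite [read_tok _ _ _]/=.
apply: leq_trans (leq_add (leqnn 2) (cost_le _ _ _)) _.
have scost_push r x : scost B (Push r x) = 1 by [].
rewrite !scost_seq !scost_pushes !scost_push -[scost B Skip]/0.
have := ltn_expl k (isT : 1 < 2).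
have le : 2 ^ k <= n.+2 ^ (12 * k).
  by apply: (@leq_trans (n.+2 ^ k)); [rewrite leq_exp2r | apply: leq_pexp2l => //; lia].
lia.
Qed.

Lemma cost_total B n k (g : seq (option F)) : 0 < k -> n <= B ->
  cost B (total_prog F k) ((nseq n (Some true) ++ None :: enc g) :: nseq 20 [::]) <=
    scost B fixed_prog + 4 * n.+1 ^ (12 * k).
Proof.
move=> k_gt0 len; rewrite /total_prog (cost_seq _ (run_strip _ len)) /fixed_prog 2!scost_seq.
have le_init := cost_init B n g k_gt0.
apply: leq_trans (leq_add (cost_le _ _ _) (cost_seq_le _ _ _ _)) _.
by rewrite -addnA leq_add2l addnC leq_add // scost_seq.
Qed.

Lemma size_instance n (fs : seq {mpoly F[n]}) : size fs < size (enc_instance fs).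
Proof.
rewrite size_cat size_rcons size_nseq addSn ltnS (leq_trans _ (leq_addl _ _)) //.
elim: fs => //= f fs IH; rewrite size_cat size_rcons addSn ltnS.
exact: leq_trans IH (leq_addl _ _).
Qed.

(* The program depends on [k] only through [init_prog], which is charged separately: the
   exponent [e] is that of [fixed_prog] and thus the same for all [k]. *)
Lemma machine_spec : exists C0 e, forall k, 0 < k -> exists M : TM,
  forall n (fs : seq {mpoly F[n]}), let d := rounds1 n k in
    tm_computes_within M (enc_instance fs)
      (C0 * (size (enc_instance fs) * n.+1 ^ (12 * k)) ^ e)
      (enc_subspace (map (matrix_of n d) (gens_at n (map (@coef2 F n) fs) d.*2.+1))).
Proof.
have [c [e He]] := scost_poly fixed_prog.
(* Let X = I (n+1)^(12 k) and Y = X^(e+1). From B + 1 <= 7 X and the cost of the initialisation, the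
   program takes at most D Y register steps; each costs at most 4 (I + D Y + 21) + 10 <= (4 D + 98)
   Y machine steps. The product of the two bounds has exponent 2 (e + 1). *)
pose D := c * 7 ^ e + 4; exists (D * (4 * D + 98)), (e.+1 * 2) => k k_gt0.
exists (asm_tm 21 (compile 0 (total_prog F k))) => n fs d.
set I := size (enc_instance fs); set cos := map _ fs.
have I_gt : size cos < I by rewrite size_map size_instance.
have I_gt0 : 0 < I by apply: leq_ltn_trans I_gt.
have [b1 b2 b3 b4 b5] := fuel_bounds n k_gt0 I_gt0 (ltnW I_gt).
set B := 6 * _ in b1 b2 b3 b4 b5.
have [st [Est runst]] := run_total b1 b2 b3 (ltnW b4) b4 b5.
have lenB : n <= B.
  apply: leq_trans b1; apply: (@leq_trans n.+1) => //; rewrite -{1}(expn1 n.+1).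
  by apply: (leq_trans (leq_pexp2l _ _)) (leq_pmull _ _).
set w := nseq n (Some true) ++ _ in runst.
have Ew : enc_instance fs = map sym_of_letter w by exact: enc_instanceE.
have szw : size w = I by rewrite /I Ew size_map.
have Edd : rounds1 n k + (rounds1 n k).+1 = d.*2.+1 by rewrite /d addnS addnn.
have out : enc_subspace (map (matrix_of n d) (gens_at n cos d.*2.+1)) =
    map sym_of_letter (head [::] st).
  rewrite Est Edd; apply: enc_subspaceE => g gin.
  by have [_ _ ->] // := gens_at_size n cos d.*2.+1; rewrite -expnD addnS addSn addnn.
have code0 : code_at (compile 0 (total_prog F k)) 0 (compile 0 (total_prog F k)).
  by exists [::], [::]; rewrite cats0.
have [t let_ ar] := compileP code0 runst.
have wfc : wf_code 21 (compile 0 (total_prog F k)).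
  by rewrite /wf_code size_compile; apply: wf_compile => //; exact: wf_total.
rewrite out Ew; apply: (@asm_tm_computes 21 _ isT wfc _ t st).
  by rewrite ar size_compile.
have le_t : t <= scost B fixed_prog + 4 * n.+1 ^ (12 * k).
  exact: leq_trans let_ (cost_total _ k_gt0 lenB).
rewrite szw; set X := I * n.+1 ^ (12 * k).
have X_gt0 : 0 < X by rewrite muln_gt0 I_gt0 expn_gt0.
have lePX : n.+1 ^ (12 * k) <= X by rewrite leq_pmull.
have leIX : I <= X by rewrite leq_pmulr // expn_gt0.
set Y := X ^ e.+1; have Y_gt0 : 0 < Y by rewrite expn_gt0 X_gt0.
have leXY : X <= Y by rewrite -{1}(expn1 X) leq_pexp2l.
have leXe : X ^ e <= Y by rewrite leq_pexp2l.
have le_s : scost B fixed_prog <= c * 7 ^ e * Y.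
  apply: leq_trans (He B) _; rewrite -mulnA leq_mul2l; apply/orP; right.
  apply: leq_trans (leq_mul (leqnn (7 ^ e)) leXe); rewrite -expnMn.
  case: (e) => // q; rewrite leq_exp2r // /B -/X; lia.
have le_tY : t <= D * Y by rewrite /D mulnDl; lia.
have leT : 4 * (I + t + 21) + 10 <= (4 * D + 98) * Y.
  by rewrite mulnDl -mulnA; lia.
by apply: leq_trans (leq_mul le_tY leT) _; rewrite mulnACA expnM expnS expn1.
Qed.

End Time.

(** * Assembly of the reduction *)

Lemma tm_exec_leq (M : TM) T T' (c : 'I_(tm_ns M).+1 * tape) t :
  tm_exec T c = Some t -> (T <= T')%N -> tm_exec T' c = Some t.
Proof.
by elim: T T' c => [|T IH] [|T'] c //=; case: (tm_step c) => // c' /IH; apply.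
Qed.

Unset Implicit Arguments.
Local Open Scope ring_scope.

Theorem theorem4p2 (F : finFieldType) :
  exists C : nat,
  forall k : nat, (1 <= k)%N ->
  exists M : TM,
  forall (n : nat) (fs : seq {mpoly F[n]}),
    all (@sqfree_deg2 F n) fs ->
    exists (N : nat) (gens : seq 'M[F]_N),
      [/\ tm_computes_within M (enc_instance fs)
            (C * (size (enc_instance fs)) ^ C * n.+1 ^ (C * k))%N
            (enc_subspace gens),
          (N <= C * n.+1 ^ (C * k))%N,
          (bool_sat fs ->
             exists A : 'M[F]_N, [/\ A \in <<gens>>%VS, A != 0 & \rank A = 1%N]) &
          (~ bool_sat fs ->
             forall A : 'M[F]_N, A \in <<gens>>%VS -> A != 0 -> (k < \rank A)%N)].
Proof.
(* The time bound expands to C0 I^e (n+1)^(12 k e), and [C] exceeds each of C0, e and 12 e. *)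
have [C0 [e Hspec]] := @machine_spec F; pose C := (C0 + 12 * e.+1)%N; exists C => k k_gt0.
have [M HM] := Hspec k k_gt0; exists M => n fs sqf.
pose d := rounds1 n k.
exists (n.+1 ^ d.+1)%N, (map (matrix_of n d) (gens_at n (map (@coef2 F n) fs) d.*2.+1)).
have satP := bool_sat_solution sqf.
have le_d : (d.+1 <= C * k)%N.
  by rewrite /C /d /rounds1; case: (n) => [|m]; nia.
split.
- have [t [ex out]] := HM n fs; exists t; split=> //.
  apply: tm_exec_leq ex _; rewrite expnMn -expnM mulnA.
  have I_gt0 : (0 < size (enc_instance fs))%N by apply: leq_ltn_trans (size_instance fs).
  apply: leq_mul; last by apply: leq_pexp2l => //; rewrite /C; nia.
  by apply: leq_mul; [rewrite /C; lia | apply: leq_pexp2l => //; rewrite /C; lia].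
- apply: (@leq_trans (n.+1 ^ (C * k))); first exact: leq_pexp2l.
  by rewrite leq_pmull // /C; lia.
- by move=> /satP[a sol]; exact: solution_rank1 sol.
move=> unsat A Ain nzA; rewrite ltnNge; apply/negP => rkA; apply/unsat/satP.
(* The low rank argument needs k <= d, which fails only in the case without variables. *)
have [lekd|n0] : (k <= d)%N \/ n = 0%N by rewrite /d; case: (n) => [|m]; [right | left].
  exact: span_no_low_rank lekd Ain nzA rkA.
by subst n; exact: span_solution0 Ain nzA.
Qed.
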